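(* Let $\Omega_1$ and $\Omega_2$ be open sets in $\mathbb{C}$ such that $\Omega_1\cap\Omega_2\neq\emptyset$ and $\Omega_1\cup\Omega_2$ is hyperbolic. Then $$\lambda_{\Omega_1}(z)\,\lambda_{\Omega_2}(z)\ge\lambda_{\Omega_1\cup\Omega_2}(z)\,\lambda_{\Omega_1\cap\Omega_2}(z)\quad\text{for all } z\in\Omega_1\cap\Omega_2 .$$ If equality holds at one point $z\in\Omega_1\cap\Omega_2$, then $\Omega_1(z)\subseteq\Omega_2(z)$ or $\Omega_2(z)\subseteq\Omega_1(z)$, and in this case equality holds at every point of $\Omega_1(z)\cap\Omega_2(z)$.
   Context: An open set $\Omega\subseteq\mathbb{C}$ is hyperbolic if $\hat{\mathbb{C}}\setminus\Omega$ contains at least three distinct points. For such $\Omega$, $\lambda_\Omega(z)\,|dz|$ denotes the hyperbolic (Poincaré) metric: on each connected component of $\Omega$ it is the unique complete conformal metric of constant curvature $-1$, i.e. $\Delta\log\lambda_\Omega=\lambda_\Omega^2$. For an open set $U\subseteq\mathbb{C}$ and $z\in U$, $U(z)$ denotes the connected component of $U$ containing $z$. *)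

(* Defs.v *)
From Stdlib Require Import Reals.
Open Scope R_scope.

Definition Cpt := (R * R)%type.

Definition cdist (z w : Cpt) : R :=
  sqrt ((fst z - fst w) ^ 2 + (snd z - snd w) ^ 2).

Definition is_open (O : Cpt -> Prop) : Prop :=
  forall z, O z -> exists r, 0 < r /\ forall w, cdist z w < r -> O w.

Definition inter (A B : Cpt -> Prop) : Cpt -> Prop := fun z => A z /\ B z.
Definition union (A B : Cpt -> Prop) : Cpt -> Prop := fun z => A z \/ B z.
Definition subset (A B : Cpt -> Prop) : Prop := forall z, A z -> B z.

(* Hyperbolic open set: the complement in the Riemann sphere has >= 3 points;
   since infinity is never in O, this means C \ O has >= 2 points. *)
Definition hyperbolic (O : Cpt -> Prop) : Prop :=
  exists a b : Cpt, a <> b /\ ~ O a /\ ~ O b.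

Definition cont2_at (f : R -> R -> R) (z : Cpt) : Prop :=
  forall eps, 0 < eps -> exists d, 0 < d /\
    forall w, cdist z w < d -> Rabs (f (fst w) (snd w) - f (fst z) (snd z)) < eps.

(* Connected component U(z): points of U joinable to z by a continuous path in U
   (for open sets of the plane components = path components). *)
Definition component (U : Cpt -> Prop) (z : Cpt) : Cpt -> Prop :=
  fun w => U z /\ U w /\
    exists g1 g2 : R -> R, continuity g1 /\ continuity g2 /\
      g1 0 = fst z /\ g2 0 = snd z /\ g1 1 = fst w /\ g2 1 = snd w /\
      forall t, 0 <= t <= 1 -> U (g1 t, g2 t).

(* There is a C^1 curve in O from a to b whose lam-length is < r.
   The infimum of such lengths is the distance d_lam(a,b). *)
Definition short_curve (O : Cpt -> Prop) (lam : R -> R -> R) (a b : Cpt) (r : R)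
  : Prop :=
  exists g1 g2 d1 d2 : R -> R,
    (forall t, derivable_pt_lim g1 t (d1 t)) /\
    (forall t, derivable_pt_lim g2 t (d2 t)) /\
    continuity d1 /\ continuity d2 /\
    g1 0 = fst a /\ g2 0 = snd a /\ g1 1 = fst b /\ g2 1 = snd b /\
    (forall t, 0 <= t <= 1 -> O (g1 t, g2 t)) /\
    exists pr : Riemann_integrable
                  (fun t => lam (g1 t) (g2 t) * sqrt (d1 t ^ 2 + d2 t ^ 2)) 0 1,
      RiemannInt pr < r.

Definition complete_metric (O : Cpt -> Prop) (lam : R -> R -> R) : Prop :=
  forall x : nat -> Cpt,
    (forall n, O (x n)) ->
    (forall eps, 0 < eps -> exists N, forall m n, (N <= m)%nat -> (N <= n)%nat ->
        short_curve O lam (x m) (x n) eps) ->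
    exists p, O p /\
      forall eps, 0 < eps -> exists N, forall n, (N <= n)%nat ->
        short_curve O lam (x n) p eps.

(* lam |dz| is the hyperbolic metric of O: a positive C^2 conformal density on O
   with Gaussian curvature -1, i.e. Laplacian(log lam) = lam^2, which is complete
   (on each component of O). *)
Definition hyperbolic_metric (O : Cpt -> Prop) (lam : R -> R -> R) : Prop :=
  (forall z, O z -> 0 < lam (fst z) (snd z)) /\
  (forall z, O z -> cont2_at lam z) /\
  (exists ux uy uxx uyy : R -> R -> R,
     forall z, O z ->
       let x := fst z in let y := snd z in
       derivable_pt_lim (fun t => ln (lam t y)) x (ux x y) /\
       derivable_pt_lim (fun t => ln (lam x t)) y (uy x y) /\
       derivable_pt_lim (fun t => ux t y) x (uxx x y) /\
       derivable_pt_lim (fun t => uy x t) y (uyy x y) /\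
       cont2_at ux z /\ cont2_at uy z /\ cont2_at uxx z /\ cont2_at uyy z /\
       uxx x y + uyy x y = (lam x y) ^ 2) /\
  complete_metric O lam.

Definition lamv (lam : R -> R -> R) (z : Cpt) : R := lam (fst z) (snd z).

(* Main.v *)
(* The theorem follows from one comparison principle (Ahlfors, Yau): if [exp u] is a complete
   density on [O] with [Lap u <= exp (2 u)] and [Lap v >= exp (2 v)], then [v <= u].
   It gives [lU <= l1] and [lU <= l2].  Hence [mu = l1 l2 / lU] satisfies
   [Lap (ln mu) = l1^2 + l2^2 - lU^2 <= mu^2], because [(l1^2 - lU^2) (l2^2 - lU^2) >= 0];
   moreover [mu >= l1, l2], so [mu] is complete on the intersection, and the principle
   applied to [mu] and [lI] is the inequality.  If equality holds at [z], the strong maximum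
   principle gives [mu = lI] near [z]; comparing curvatures, [l1 = lU] or [l2 = lU] at [z],
   so, say, [l1 = lU] on the component of [O1] at [z], which by completeness of [l1] is a
   whole component of the union.

   The comparison principle is the maximum principle on polygons [z 0 = x0, ..., z N]:
   one maximises [v - u] at the end point, penalised by a discrete energy [E].  Under a
   variation by a complex parameter [s] along a discrete parallel transport, the Laplacian
   of [E] in [s] is bounded in terms of [E] for every polygon, geodesic or not; so only the
   Hopf-Rinow compactness of balls is needed. *)
From Stdlib Require Import Reals Lra Lia ClassicalEpsilon FunctionalExtensionality.
From Coquelicot Require Import Coquelicot.
Require Import Defs.
Open Scope R_scope.

(** The usual proof of such a comparison applies the maximum principle to the distance from a point,
    which calls for minimising geodesics, a cut locus and a Laplacian comparison theorem. The energy
    of a polygon is as regular in its vertices as [u], so none of this arises. Discretisation is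
    harmless because the number [N] of edges is chosen last: the second-order errors of the
    transport sum to at most a constant times the energy over [N], while the final inequality has
    constants free of [N] and of the local bound [M].

    Two gaps separate the definitions from this argument. A density comes with continuous pure
    second derivatives, whereas a variation needs a second-order expansion in all directions; the
    curvature equation supplies the mixed term, through an interior gradient estimate for difference
    quotients. And completeness is phrased with C^1 curves, so polygons have to be smoothed to
    exploit it, and short curves have to be shown to end near where they start. *)

(** * Modulus, subsequences and attained maxima *)

Lemma cdist_Cmod (z w : C) : cdist z w = Cmod (z - w)%C.
Proof. reflexivity. Qed.

Lemma Cmod_sym (z w : C) : Cmod (z - w)%C = Cmod (w - z)%C.
Proof. rewrite <- (Cmod_opp (z - w)%C). f_equal. ring. Qed.

Lemma Cmod_diag (z : C) : Cmod (z - z)%C = 0.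
Proof. rewrite <- Cmod_0. f_equal. ring. Qed.

Lemma Cmod_dist_triangle (a b c : C) : Cmod (a - c)%C <= Cmod (a - b)%C + Cmod (b - c)%C.
Proof. replace (a - c)%C with ((a - b) + (b - c))%C by ring. apply Cmod_triangle. Qed.

Lemma Cmod_sqr (z : C) : Cmod z ^ 2 = fst z ^ 2 + snd z ^ 2.
Proof.
  unfold Cmod. rewrite <- Rsqr_pow2. rewrite Rsqr_sqrt; [reflexivity|].
  pose proof (pow2_ge_0 (fst z)); pose proof (pow2_ge_0 (snd z)); lra.
Qed.

Lemma fst_le_Cmod (z : C) : Rabs (fst z) <= Cmod z.
Proof.
  apply Rle_trans with (2 := Rmax_Cmod z). apply Rmax_l.
Qed.

Lemma snd_le_Cmod (z : C) : Rabs (snd z) <= Cmod z.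
Proof.
  apply Rle_trans with (2 := Rmax_Cmod z). apply Rmax_r.
Qed.

Lemma Cmod_le_sum (z : C) : Cmod z <= Rabs (fst z) + Rabs (snd z).
Proof.
  apply Rsqr_incr_0_var.
  - rewrite 2!Rsqr_pow2, Cmod_sqr, <- (pow2_abs (fst z)), <- (pow2_abs (snd z)).
    pose proof (Rabs_pos (fst z)); pose proof (Rabs_pos (snd z)). nra.
  - pose proof (Rabs_pos (fst z)); pose proof (Rabs_pos (snd z)). lra.
Qed.

Lemma open_ball (O : C -> Prop) z : is_open O -> O z ->
  exists r, 0 < r /\ forall w, Cmod (w - z)%C < r -> O w.
Proof.
  intros HO Hz. destruct (HO z Hz) as [r [Hr H]]. exists r. split; [exact Hr|].
  intros w Hw. apply H. rewrite cdist_Cmod, Cmod_sym. exact Hw.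
Qed.

Definition ccv (Z : nat -> C) (l : C) : Prop :=
  forall eps, 0 < eps -> exists N, forall n, (N <= n)%nat -> Cmod (Z n - l)%C < eps.

Lemma inv_INR_small (eps : R) : 0 < eps -> exists N, forall n, (N <= n)%nat -> / (INR n + 1) < eps.
Proof.
  intros He. destruct (INR_unbounded (/ eps)) as [N HN]. exists N. intros n Hn.
  apply le_INR in Hn. assert (0 < / eps) by (apply Rinv_0_lt_compat; lra).
  rewrite <- (Rinv_inv eps). apply Rinv_lt_contravar; nra.
Qed.

(** An accumulation point gives, for each [n], an index [q >= n] whose value is within [1 / (n + 1)]
    of it. The selection need not be increasing: [n <= p n] suffices for passing to limits and is
    stable under composition. *)
Lemma bounded_subseq (U : nat -> R) (B : R) : (forall n, Rabs (U n) <= B) ->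
  exists (p : nat -> nat) l, (forall n, (n <= p n)%nat) /\ Un_cv (fun n => U (p n)) l.
Proof.
  intros HB.
  destruct (Bolzano_Weierstrass U _ (compact_P3 (- B) B)) as [l Hl].
  { intros n. specialize (HB n). apply Rabs_le_between in HB. lra. }
  assert (H : forall n, exists q, (n <= q)%nat /\ Rabs (U q - l) < / (INR n + 1)).
  { intros n.
    assert (Hp : 0 < / (INR n + 1)).
    { apply Rinv_0_lt_compat. pose proof (pos_INR n). lra. }
    destruct (Hl (disc l (mkposreal _ Hp)) n) as [q [Hq1 Hq2]].
    { exists (mkposreal _ Hp). intros x Hx. exact Hx. }
    exists q. split; [exact Hq1|exact Hq2]. }
  destruct (choice _ H) as [p Hp]. exists p, l. split; [intros n; apply Hp|].
  intros eps He. destruct (inv_INR_small eps He) as [N HN]. exists N. intros n Hn.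
  apply Rlt_trans with (/ (INR n + 1)); [apply Hp|apply HN; lia].
Qed.

Lemma Un_cv_subseq (U : nat -> R) l (p : nat -> nat) :
  (forall n, (n <= p n)%nat) -> Un_cv U l -> Un_cv (fun n => U (p n)) l.
Proof.
  intros Hp HU eps He. destruct (HU eps He) as [N HN]. exists N. intros n Hn. apply HN.
  specialize (Hp n). lia.
Qed.

Lemma ccv_subseq (U : nat -> C) l (p : nat -> nat) :
  (forall n, (n <= p n)%nat) -> ccv U l -> ccv (fun n => U (p n)) l.
Proof.
  intros Hp HU eps He. destruct (HU eps He) as [N HN]. exists N. intros n Hn. apply HN.
  specialize (Hp n). lia.
Qed.

(** Vertices are treated one after the other, real and imaginary parts separately; limits already
    obtained persist along later selections. This is the compactness used for polygons. *)
Lemma bounded_chain_subseq (M : nat) (Z : nat -> nat -> C) (B : R) :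
  (forall n j, (j < M)%nat -> Cmod (Z n j) <= B) ->
  exists (p : nat -> nat) (l : nat -> C), (forall n, (n <= p n)%nat) /\
    forall j, (j < M)%nat -> ccv (fun n => Z (p n) j) (l j).
Proof.
  induction M as [|M IH]; intros HB.
  { exists (fun n => n), (fun _ => 0%C). split; [auto|lia]. }
  destruct IH as [p [l [Hp Hl]]]. { intros n j Hj. apply HB. lia. }
  destruct (bounded_subseq (fun n => fst (Z (p n) M)) B) as [q [a [Hq Ha]]].
  { intros n. eapply Rle_trans; [apply fst_le_Cmod|]. apply HB. lia. }
  destruct (bounded_subseq (fun n => snd (Z (p (q n)) M)) B) as [s [b [Hs Hb]]].
  { intros n. eapply Rle_trans; [apply snd_le_Cmod|]. apply HB. lia. }
  exists (fun n => p (q (s n))), (fun j => if Nat.eq_dec j M then (a, b) else l j).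
  split.
  { intros n. specialize (Hs n). specialize (Hq (s n)). specialize (Hp (q (s n))). lia. }
  intros j Hj. destruct (Nat.eq_dec j M) as [->|Hne].
  - intros eps He.
    destruct (Un_cv_subseq _ _ s Hs Ha (eps / 2) ltac:(lra)) as [N1 H1].
    destruct (Hb (eps / 2) ltac:(lra)) as [N2 H2].
    exists (max N1 N2). intros n Hn. eapply Rle_lt_trans; [apply Cmod_le_sum|].
    specialize (H1 n ltac:(lia)). specialize (H2 n ltac:(lia)). unfold Rdist in *.
    simpl. unfold Rminus in *. lra.
  - apply (ccv_subseq (fun n => Z (p n) j) (l j) (fun n => q (s n))).
    + intros n. specialize (Hs n). specialize (Hq (s n)). lia.
    + apply Hl. lia.
Qed.

(** The type is arbitrary because maxima are taken over polygons [nat -> C] as well as over points.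
    A sequence with [F (X n) > n] excludes an infinite supremum; a maximising sequence then has the
    maximiser as limit. *)
Lemma max_attained (T : Type) (A : T -> Prop) (F : T -> R) :
  (exists x, A x) ->
  (forall X : nat -> T, (forall n, A (X n)) ->
     exists (p : nat -> nat) l, (forall n, (n <= p n)%nat) /\ A l /\
       Un_cv (fun n => F (X (p n))) (F l)) ->
  exists x, A x /\ forall y, A y -> F y <= F x.
Proof.
  intros [x0 Hx0] Hc.
  assert (Hbd : bound (fun r => exists x, A x /\ r = F x)).
  { apply NNPP. intros Hn.
    assert (H : forall n : nat, exists x, A x /\ INR n < F x).
    { intros n. apply NNPP. intros Hx. apply Hn. exists (INR n). intros r [x [Hx1 ->]].
      apply Rnot_lt_le. intros K. apply Hx. exists x. auto. }
    destruct (choice _ H) as [X HX].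
    destruct (Hc X (fun n => proj1 (HX n))) as [p [l [Hp [_ Hl]]]].
    destruct (Hl 1 Rlt_0_1) as [N HN]. destruct (INR_unbounded (F l + 1)) as [K HK].
    specialize (HN (max N K) ltac:(lia)). unfold Rdist in HN. apply Rabs_def2 in HN.
    pose proof (proj2 (HX (p (max N K)))). specialize (Hp (max N K)).
    assert (INR K <= INR (p (max N K))) by (apply le_INR; lia). lra. }
  destruct (completeness _ Hbd (ex_intro _ (F x0) (ex_intro _ x0 (conj Hx0 eq_refl))))
    as [S [HS1 HS2]].
  assert (H : forall n : nat, exists x, A x /\ S - / (INR n + 1) < F x).
  { intros n. apply NNPP. intros Hx.
    assert (Hp : 0 < / (INR n + 1)) by (apply Rinv_0_lt_compat; pose proof (pos_INR n); lra).
    assert (S <= S - / (INR n + 1)); [|lra].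
    apply HS2. intros r [x [Hx1 ->]].
    apply Rnot_lt_le. intros K. apply Hx. exists x. auto. }
  destruct (choice _ H) as [X HX].
  destruct (Hc X (fun n => proj1 (HX n))) as [p [l [Hp [Hl1 Hl]]]].
  exists l. split; [exact Hl1|]. intros y Hy.
  apply Rle_trans with S; [apply HS1; exists y; auto|].
  apply Rnot_lt_le. intros Hlt.
  destruct (Hl ((S - F l) / 2) ltac:(lra)) as [N HN].
  destruct (inv_INR_small ((S - F l) / 2) ltac:(lra)) as [K HK].
  specialize (HN (max N K) ltac:(lia)). specialize (Hp (max N K)).
  specialize (HK (p (max N K)) ltac:(lia)).
  pose proof (proj2 (HX (p (max N K)))).
  unfold Rdist in HN. apply Rabs_def2 in HN. lra.
Qed.

(** * Continuity and relative compactness in the plane *)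

Definition ccont (f : C -> R) (z : C) : Prop :=
  forall eps, 0 < eps -> exists d, 0 < d /\
    forall w, Cmod (w - z)%C < d -> Rabs (f w - f z) < eps.

Lemma ccont_cv f z (Z : nat -> C) : ccont f z -> ccv Z z -> Un_cv (fun n => f (Z n)) (f z).
Proof.
  intros Hf HZ eps He. destruct (Hf eps He) as [d [Hd H]]. destruct (HZ d Hd) as [N HN].
  exists N. intros n Hn. apply H, HN. lia.
Qed.

Lemma ccv_Cmod_le (Z : nat -> C) l a (B : R) :
  ccv Z l -> (forall n, Cmod (Z n - a)%C <= B) -> Cmod (l - a)%C <= B.
Proof.
  intros HZ HB. apply Rnot_lt_le. intros Hlt.
  destruct (HZ (Cmod (l - a)%C - B) ltac:(lra)) as [N HN]. specialize (HN N (le_n _)).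
  pose proof (Cmod_dist_triangle l (Z N) a). rewrite Cmod_sym in HN. specialize (HB N). lra.
Qed.

Lemma Cmod_le_0_eq (a b : C) : Cmod (a - b)%C <= 0 -> a = b.
Proof.
  intros H. assert (E : (a - b)%C = 0%C) by (apply Cmod_eq_0; pose proof (Cmod_ge_0 (a - b)%C); lra).
  replace a with ((a - b) + b)%C by ring. rewrite E. ring.
Qed.

Lemma ccv_unique (X : nat -> C) l l' : ccv X l -> ccv X l' -> l = l'.
Proof.
  intros H1 H2. apply Cmod_le_0_eq, Rnot_lt_le. intros K.
  destruct (H1 (Cmod (l - l')%C / 2) ltac:(lra)) as [N1 K1].
  destruct (H2 (Cmod (l - l')%C / 2) ltac:(lra)) as [N2 K2].
  specialize (K1 (max N1 N2) ltac:(lia)). specialize (K2 (max N1 N2) ltac:(lia)).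
  pose proof (Cmod_dist_triangle l (X (max N1 N2)) l') as T. rewrite (Cmod_sym l (X _)) in T. lra.
Qed.

Lemma closed_disc_subseq (a : C) (B : R) (Z : nat -> C) :
  (forall n, Cmod (Z n - a)%C <= B) ->
  exists (p : nat -> nat) l, (forall n, (n <= p n)%nat) /\ ccv (fun n => Z (p n)) l /\
    Cmod (l - a)%C <= B.
Proof.
  intros HB.
  destruct (bounded_chain_subseq 1 (fun n _ => Z n) (B + Cmod a)) as [p [l [Hp Hl]]].
  { intros n _ _. replace (Z n) with ((Z n - a) + a)%C by ring.
    eapply Rle_trans; [apply Cmod_triangle|]. specialize (HB n). lra. }
  specialize (Hl 0%nat ltac:(lia)). exists p, (l 0%nat). split; [exact Hp|]. split; [exact Hl|].
  apply (ccv_Cmod_le _ _ a B Hl). intros n. apply HB.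
Qed.

(* [P] is monotone in the bound; for open [O] this says that [A] is relatively
   compact in [O], in a form that needs neither covers nor sequences. *)
Definition rel_compact (O A : C -> Prop) : Prop :=
  forall P : R -> C -> Prop,
    (forall M M' z, M <= M' -> P M z -> P M' z) ->
    (forall z, O z -> exists r M, 0 < r /\ forall w, Cmod (w - z)%C < r -> P M w) ->
    exists M, forall z, A z -> P M z.

Lemma rel_compact_subset O A B : subset B A -> rel_compact O A -> rel_compact O B.
Proof.
  intros HBA HA P H1 H2. destruct (HA P H1 H2) as [M HM]. exists M. intros z Hz. auto.
Qed.

Lemma rel_compact_disc (O : C -> Prop) (a : C) (B : R) :
  (forall z, Cmod (z - a)%C <= B -> O z) -> rel_compact O (fun z => Cmod (z - a)%C <= B).
Proof.
  intros HO P Hmon Hloc. apply NNPP. intros Hn.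
  assert (H : forall n : nat, exists z, Cmod (z - a)%C <= B /\ ~ P (INR n) z).
  { intros n. apply NNPP. intros Hx. apply Hn. exists (INR n). intros z Hz. apply NNPP.
    intros Hz'. apply Hx. exists z. auto. }
  destruct (choice _ H) as [Z HZ].
  destruct (closed_disc_subseq a B Z (fun n => proj1 (HZ n))) as [p [l [Hp [Hl Hla]]]].
  destruct (Hloc l (HO l Hla)) as [r [M [Hr HM]]].
  destruct (Hl r Hr) as [N HN]. destruct (INR_unbounded M) as [K HK].
  set (n := max N K). apply (proj2 (HZ (p n))).
  apply Hmon with M.
  - specialize (Hp n). assert (INR K <= INR (p n)) by (apply le_INR; lia). lra.
  - apply HM, HN. lia.
Qed.

(** Reading the radius as [/ Rmax 1 M] turns a property that weakens as a constant grows into one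
    that weakens as a radius shrinks. *)
Lemma rel_compact_radius (O A : C -> Prop) (P : R -> C -> Prop) :
  (forall d d' z, d' <= d -> P d z -> P d' z) ->
  (forall z, O z -> exists r d, 0 < r /\ 0 < d /\ forall w, Cmod (w - z)%C < r -> P d w) ->
  rel_compact O A -> exists d, 0 < d /\ forall z, A z -> P d z.
Proof.
  intros Hmon Hloc HA. destruct (HA (fun M => P (/ Rmax 1 M))) as [M HM].
  - intros M M' z HMM. apply Hmon. pose proof (Rmax_l 1 M).
    apply Rinv_le_contravar; [lra|]. apply Rle_max_compat_l, HMM.
  - intros z Hz. destruct (Hloc z Hz) as [r [d [Hr [Hd H]]]]. exists r, (/ d). split; [exact Hr|].
    intros w Hw. apply (Hmon d); [|apply H, Hw]. rewrite <- (Rinv_inv d) at 2.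
    apply Rinv_le_contravar; [apply Rinv_0_lt_compat, Hd|apply Rmax_r].
  - exists (/ Rmax 1 M). split; [|exact HM]. apply Rinv_0_lt_compat. pose proof (Rmax_l 1 M). lra.
Qed.

Lemma rel_compact_room (O A : C -> Prop) : is_open O -> rel_compact O A ->
  exists d, 0 < d /\ forall z, A z -> forall w, Cmod (w - z)%C < d -> O w.
Proof.
  intros HO. apply (rel_compact_radius O A (fun d z => forall w, Cmod (w - z)%C < d -> O w)).
  - intros d d' z Hdd H w Hw. apply H. lra.
  - intros z Hz. destruct (open_ball O z HO Hz) as [r [Hr H]].
    exists (r / 2), (r / 2). repeat (split; [lra|]). intros w Hw w' Hw'. apply H.
    pose proof (Cmod_dist_triangle w' w z). lra.
Qed.

Lemma rel_compact_bounded (O A : C -> Prop) (f : C -> R) :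
  rel_compact O A ->
  (forall z, O z -> exists r M, 0 < r /\ forall w, Cmod (w - z)%C < r -> f w <= M) ->
  exists M, forall z, A z -> f z <= M.
Proof.
  intros HA Hf. apply (HA (fun M z => f z <= M)).
  - intros M M' z H1 H2. lra.
  - exact Hf.
Qed.

(** * Second-order jets at a point *)

Lemma mvt_quotient (f f1 : R -> R) (y k c e : R) :
  (forall t, Rabs (t - y) <= Rabs k -> is_derive f t (f1 t)) ->
  (forall t, Rabs (t - y) <= Rabs k -> Rabs (f1 t - c) <= e) ->
  Rabs (f (y + k) - f y - c * k) <= e * Rabs k.
Proof.
  intros Hd He.
  assert (Hin : forall t, Rmin y (y + k) <= t <= Rmax y (y + k) -> Rabs (t - y) <= Rabs k).
  { intros t. unfold Rmin, Rmax, Rabs. repeat destruct Rle_dec; repeat destruct Rcase_abs; lra. }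
  destruct (MVT_gen f y (y + k) f1) as [t [Ht1 Ht2]].
  - intros t Ht. apply Hd, Hin. lra.
  - intros t Ht. apply derivable_continuous_pt. exists (f1 t). apply is_derive_Reals, Hd, Hin, Ht.
  - rewrite Ht2. replace (f1 t * (y + k - y) - c * k) with ((f1 t - c) * k) by ring.
    rewrite Rabs_mult. apply Rmult_le_compat_r; [apply Rabs_pos|]. apply He, Hin, Ht1.
Qed.

Lemma mvt_bound (f f1 : R -> R) (d M t : R) :
  (forall s, Rabs s < d -> is_derive f s (f1 s)) ->
  (forall s, Rabs s <= Rabs t -> Rabs (f1 s) <= M) ->
  Rabs t < d -> Rabs (f t - f 0) <= M * Rabs t.
Proof.
  intros Hd HM Ht. pose proof (mvt_quotient f f1 0 t 0 M) as H.
  rewrite Rplus_0_l, Rmult_0_l, Rminus_0_r in H. apply H; intros s Hs; rewrite Rminus_0_r in Hs.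
  - apply Hd. lra.
  - rewrite Rminus_0_r. apply HM, Hs.
Qed.

(** The mean value bound is applied to the remainder and to its derivative. The constant [c] need
    not be [f2 0], so that one statement gives both the expansion at a point and, with [c = 0], a
    uniform quadratic bound. *)
Lemma taylor2 (f f1 f2 : R -> R) (d c eps t : R) :
  (forall s, Rabs s < d -> is_derive f s (f1 s)) ->
  (forall s, Rabs s < d -> is_derive f1 s (f2 s)) ->
  (forall s, Rabs s < d -> Rabs (f2 s - c) <= eps) ->
  Rabs t < d -> Rabs (f t - f 0 - f1 0 * t - c / 2 * t ^ 2) <= eps * t ^ 2.
Proof.
  intros H1 H2 H3 Ht.
  pose (F := fun s => f s - f1 0 * s - c / 2 * s ^ 2).
  pose (F1 := fun s => f1 s - f1 0 - c * s).
  assert (He : 0 <= eps).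
  { eapply Rle_trans; [apply Rabs_pos|]. apply (H3 t Ht). }
  assert (HF1 : forall s, Rabs s < d -> Rabs (F1 s) <= eps * Rabs s).
  { intros s Hs. unfold F1.
    replace (f1 s - f1 0 - c * s) with ((f1 s - c * s) - (f1 0 - c * 0)) by ring.
    apply (mvt_bound (fun s => f1 s - c * s) (fun s => f2 s - c) d); [| |exact Hs].
    - intros x Hx. specialize (H2 x Hx).
      replace (f2 x - c) with (minus (f2 x) (c * 1)) by (unfold minus, plus, opp; simpl; ring).
      apply (is_derive_minus f1 (fun s => c * s) x); [exact H2|].
      apply (is_derive_scal (fun s => s)). apply (is_derive_id (K := R_AbsRing)).
    - intros x Hx. apply H3. lra. }
  replace (f t - f 0 - f1 0 * t - c / 2 * t ^ 2) with (F t - F 0) by (unfold F; field).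
  replace (eps * t ^ 2) with (eps * Rabs t * Rabs t) by (rewrite <- (pow2_abs t); ring).
  apply (mvt_bound F F1 d); [| |exact Ht].
  - intros s Hs. unfold F, F1. specialize (H1 s Hs).
    auto_derive; [exists (f1 s); exact H1|].
    replace (Derive (fun x => f x) s) with (f1 s) by (symmetry; apply is_derive_unique; exact H1).
    field.
  - intros s Hs. eapply Rle_trans; [apply HF1; lra|]. apply Rmult_le_compat_l; lra.
Qed.

Definition rjet (G : R -> R) (a G1 G2 : R) : Prop :=
  forall eps, 0 < eps -> exists d, 0 < d /\ forall k, Rabs k < d ->
    Rabs (G (a + k) - G a - G1 * k - G2 / 2 * k ^ 2) <= eps * k ^ 2.

Lemma rjet_derive (G G1 G2 : R -> R) (a d0 : R) : 0 < d0 ->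
  (forall x, Rabs (x - a) < d0 -> is_derive G x (G1 x)) ->
  (forall x, Rabs (x - a) < d0 -> is_derive G1 x (G2 x)) ->
  continuity_pt G2 a -> rjet G a (G1 a) (G2 a).
Proof.
  intros Hd0 H1 H2 Hc eps He.
  destruct (Hc eps He) as [d1 [Hd1 Hd1']].
  exists (Rmin d0 d1). split; [apply Rmin_pos; lra|]. intros k Hk.
  assert (Hsh : forall H H' : R -> R, (forall x, Rabs (x - a) < d0 -> is_derive H x (H' x)) ->
    forall s, Rabs s < Rmin d0 d1 -> is_derive (fun s => H (a + s)) s (H' (a + s))).
  { intros H H' HH s Hs.
    replace (H' (a + s)) with (scal 1 (H' (a + s)))
      by (unfold scal; simpl; unfold mult; simpl; ring).
    apply (is_derive_comp H (fun s => a + s)).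
    - apply HH. replace (a + s - a) with s by ring. pose proof (Rmin_l d0 d1). lra.
    - auto_derive; [auto|ring]. }
  pose proof (taylor2 (fun s => G (a + s)) (fun s => G1 (a + s)) (fun s => G2 (a + s))
    (Rmin d0 d1) (G2 a) eps k (Hsh _ _ H1) (Hsh _ _ H2)) as HT.
  cbv beta in HT. rewrite Rplus_0_r in HT. apply HT; [|exact Hk].
  intros s Hs. destruct (Req_dec s 0) as [->|Hs0].
  - rewrite Rplus_0_r, Rminus_diag, Rabs_R0. lra.
  - left. apply (Hd1' (a + s)). split.
    + split; [exact I|]. lra.
    + simpl. unfold R_dist. replace (a + s - a) with s by ring. pose proof (Rmin_r d0 d1). lra.
Qed.

Lemma rjet_exp a : rjet exp a (exp a) (exp a).
Proof.
  apply (rjet_derive exp exp exp a 1); [lra| | |].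
  - intros x _. apply is_derive_Reals, derivable_pt_lim_exp.
  - intros x _. apply is_derive_Reals, derivable_pt_lim_exp.
  - apply derivable_continuous_pt, derivable_pt_exp.
Qed.

Lemma rjet_ln a : 0 < a -> rjet ln a (/ a) (- / a ^ 2).
Proof.
  intros Ha.
  apply (rjet_derive ln (fun x => / x) (fun x => - / x ^ 2) a a Ha).
  - intros x Hx. apply Rabs_def2 in Hx. apply is_derive_Reals, derivable_pt_lim_ln. lra.
  - intros x Hx. apply Rabs_def2 in Hx. auto_derive; [lra|]. field. lra.
  - apply continuity_pt_opp, continuity_pt_inv.
    + apply derivable_continuous_pt, derivable_pt_pow.
    + apply pow_nonzero. lra.
Qed.

Lemma rjet_affine b c a : rjet (fun x => b + c * x) a c 0.
Proof.
  intros eps He. exists 1. split; [lra|]. intros k _.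
  replace (_ - _ - _ - _) with 0 by field. rewrite Rabs_R0.
  apply Rmult_le_pos; [lra|apply pow2_ge_0].
Qed.

Lemma rjet_sqr a : rjet (fun x => x ^ 2) a (2 * a) 2.
Proof.
  intros eps He. exists 1. split; [lra|]. intros k _.
  replace (_ - _ - _ - _) with 0 by field. rewrite Rabs_R0.
  apply Rmult_le_pos; [lra|apply pow2_ge_0].
Qed.

(* [f s = f 0 + Re (g s) + Re (Q s^2) + (L / 4) |s|^2 + o(|s|^2)]: in real terms
   [g = f_x - i f_y] and [L] is the Laplacian of [f] at [0]. *)
Definition cjet (f : C -> R) (g : C) (L : R) : Prop :=
  exists Q : C, forall eps, 0 < eps -> exists d, 0 < d /\ forall s : C, Cmod s < d ->
    Rabs (f s - f 0%C - fst (g * s)%C - fst (Q * s * s)%C - L / 4 * Cmod s ^ 2)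
      <= eps * Cmod s ^ 2.

Lemma fst_Cmult_le (a b : C) : Rabs (fst (a * b)%C) <= Cmod a * Cmod b.
Proof. rewrite <- Cmod_mult. apply fst_le_Cmod. Qed.

Lemma fst_Cmult3_le (a b c : C) : Rabs (fst (a * b * c)%C) <= Cmod a * Cmod b * Cmod c.
Proof. rewrite <- !Cmod_mult. apply fst_le_Cmod. Qed.

Lemma cjet_ext f f' g L : (forall s, f s = f' s) -> cjet f g L -> cjet f' g L.
Proof.
  intros Hf [Q HQ]. exists Q. intros eps He. destruct (HQ eps He) as [d [Hd H]].
  exists d. split; [exact Hd|]. intros s Hs. rewrite <- !Hf. apply H, Hs.
Qed.

Lemma cjet_const c : cjet (fun _ => c) 0%C 0.
Proof.
  exists 0%C. intros eps He. exists 1. split; [lra|]. intros s _.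
  rewrite !Cmult_0_l. simpl fst. replace (_ - _ - _ - _ - _) with 0 by field.
  rewrite Rabs_R0. apply Rmult_le_pos; [lra|apply pow2_ge_0].
Qed.

Lemma cjet_plus f1 f2 g1 g2 L1 L2 : cjet f1 g1 L1 -> cjet f2 g2 L2 ->
  cjet (fun s => f1 s + f2 s) (g1 + g2)%C (L1 + L2).
Proof.
  intros [Q1 H1] [Q2 H2]. exists (Q1 + Q2)%C. intros eps He.
  destruct (H1 (eps / 2) ltac:(lra)) as [d1 [Hd1 H1']].
  destruct (H2 (eps / 2) ltac:(lra)) as [d2 [Hd2 H2']].
  exists (Rmin d1 d2). split; [apply Rmin_pos; lra|]. intros s Hs.
  specialize (H1' s ltac:(pose proof (Rmin_l d1 d2); lra)).
  specialize (H2' s ltac:(pose proof (Rmin_r d1 d2); lra)).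
  replace (eps * Cmod s ^ 2) with (eps / 2 * Cmod s ^ 2 + eps / 2 * Cmod s ^ 2) by field.
  eapply Rle_trans; [|apply Rplus_le_compat; [exact H1'|exact H2']].
  eapply Rle_trans; [|apply Rabs_triang]. right. f_equal.
  replace ((g1 + g2) * s)%C with (g1 * s + g2 * s)%C by ring.
  replace ((Q1 + Q2) * s * s)%C with (Q1 * s * s + Q2 * s * s)%C by ring.
  unfold Cplus. simpl fst. field.
Qed.

Lemma cjet_remainder f g L : cjet f g L -> exists K d, 1 <= K /\ 0 < d /\
  forall s, Cmod s < d -> Cmod s <= 1 ->
    Rabs (f s - f 0%C - fst (g * s)%C) <= K * Cmod s ^ 2 /\
    Rabs (f s - f 0%C) <= (Cmod g + K) * Cmod s.
Proof.
  intros [Q HQ]. destruct (HQ 1 ltac:(lra)) as [d [Hd H]].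
  pose proof (Cmod_ge_0 Q) as HQ0. pose proof (Rabs_pos L) as HL0.
  set (K := Cmod Q + Rabs L / 4 + 1). assert (HK : 1 <= K) by (unfold K; lra).
  exists K, d. split; [exact HK|]. split; [exact Hd|]. intros s Hs Hs1. specialize (H s Hs).
  pose proof (Cmod_ge_0 s) as Hs0. pose proof (fst_Cmult_le g s) as Hl.
  pose proof (fst_Cmult3_le Q s s) as Hq. revert H Hl Hq.
  set (l := fst (g * s)%C). set (q := fst (Q * s * s)%C). set (m := Cmod s) in *. intros H Hl Hq.
  assert (Hm2 : 0 <= m ^ 2) by apply pow2_ge_0.
  assert (HL : Rabs (L / 4 * m ^ 2) = Rabs L / 4 * m ^ 2).
  { unfold Rdiv. rewrite !Rabs_mult, (Rabs_right (/ 4)), (Rabs_right (m ^ 2)); lra. }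
  assert (Hr : Rabs (f s - f 0%C - l) <= K * m ^ 2).
  { replace (f s - f 0%C - l) with ((f s - f 0%C - l - q - L / 4 * m ^ 2) + (q + L / 4 * m ^ 2)) by ring.
    eapply Rle_trans; [apply Rabs_triang|]. pose proof (Rabs_triang q (L / 4 * m ^ 2)).
    unfold K. lra. }
  split; [exact Hr|]. replace (f s - f 0%C) with (l + (f s - f 0%C - l)) by ring.
  eapply Rle_trans; [apply Rabs_triang|].
  assert (K * m ^ 2 <= K * m) by (apply Rmult_le_compat_l; [lra|nra]). lra.
Qed.

Lemma cjet_comp f g L G G1 G2 : cjet f g L -> rjet G (f 0%C) G1 G2 ->
  cjet (fun s => G (f s)) (RtoC G1 * g)%C (G1 * L + G2 * Cmod g ^ 2).
Proof.
  intros Hj HG. destruct (cjet_remainder f g L Hj) as [K [d1 [HK [Hd1 H1]]]].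
  destruct Hj as [Q Hf]. exists (RtoC G1 * Q + RtoC (G2 / 4) * g * g)%C. intros eps He.
  pose proof (Cmod_ge_0 g) as Hg0. pose proof (Rabs_pos G1) as HG1. pose proof (Rabs_pos G2) as HG2.
  set (K2 := Cmod g + K) in *. assert (HK2 : 1 <= K2) by (unfold K2; lra).
  (* Three errors get [eps / 3] each: the remainder of [f] multiplied by [G1], the remainder of [G]
     at the increment [k] with [|k| <= K2 |s|], and the replacement of [k ^ 2] by the square of its
     linear part. *)
  destruct (Hf (eps / 3 / (Rabs G1 + 1))) as [d2 [Hd2 H2]].
  { apply Rdiv_lt_0_compat; lra. }
  destruct (HG (eps / 3 / K2 ^ 2)) as [d3 [Hd3 H3]].
  { apply Rdiv_lt_0_compat; [lra|]. apply pow_lt. lra. }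
  set (d4 := eps / 3 / (Rabs G2 * K * K2 + 1)).
  assert (Hd4 : 0 < d4).
  { apply Rdiv_lt_0_compat; [lra|]. assert (0 <= Rabs G2 * K * K2); [|lra].
    apply Rmult_le_pos; [apply Rmult_le_pos|]; lra. }
  set (d := Rmin (Rmin d1 d2) (Rmin (d3 / K2) (Rmin d4 1))).
  assert (Hd3' : 0 < d3 / K2) by (apply Rdiv_lt_0_compat; lra).
  assert (Hd : 0 < d /\ d <= d1 /\ d <= d2 /\ d <= d3 / K2 /\ d <= d4 /\ d <= 1).
  { unfold d, Rmin. repeat destruct Rle_dec; lra. }
  destruct Hd as [Hd [E1 [E2 [E3 [E4 E5]]]]].
  exists d. split; [exact Hd|]. intros s Hs.
  destruct (H1 s ltac:(lra) ltac:(lra)) as [Hr Hk]. specialize (H2 s ltac:(lra)).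
  pose proof (Cmod_ge_0 s) as Hs0. set (m := Cmod s) in *.
  assert (Hm2 : 0 <= m ^ 2) by apply pow2_ge_0.
  set (l := fst (g * s)%C) in *. set (q := fst (Q * s * s)%C) in *.
  set (k := f s - f 0%C) in *.
  assert (Hl : Rabs l <= Cmod g * m) by apply fst_Cmult_le.
  assert (Hk' : Rabs k < d3).
  { apply Rle_lt_trans with (1 := Hk). assert (m < d3 / K2) by lra.
    replace d3 with (K2 * (d3 / K2)) by (field; lra). apply Rmult_lt_compat_l; lra. }
  specialize (H3 k Hk'). replace (f 0%C + k) with (f s) in H3 by (unfold k; ring).
  replace (RtoC G1 * g * s)%C with (RtoC G1 * (g * s))%C by ring.
  (* [(Re w)^2 = (Re (w^2) + |w|^2) / 2] with [w = g s]: the squared linear part feeds both the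
     quadratic coefficient and the Laplacian. *)
  assert (Hid : G2 / 2 * l ^ 2 =
    fst (RtoC (G2 / 4) * g * g * s * s)%C + G2 * Cmod g ^ 2 / 4 * m ^ 2).
  { unfold l, m. rewrite !Cmod_sqr. destruct g as [g1 g2], s as [s1 s2].
    unfold Cmult, RtoC. simpl. field. }
  assert (Hid2 : fst (RtoC G1 * (g * s))%C = G1 * l) by (unfold l, Cmult, RtoC; simpl; ring).
  assert (Hid3 : fst ((RtoC G1 * Q + RtoC (G2 / 4) * g * g) * s * s)%C =
     G1 * q + fst (RtoC (G2 / 4) * g * g * s * s)%C).
  { unfold q, Cplus, Cmult, RtoC; simpl; ring. }
  rewrite Hid2, Hid3. clear Hid2 Hid3.
  replace (G (f s) - G (f 0%C) - G1 * l - _ - _) with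
    ((G (f s) - G (f 0%C) - G1 * k - G2 / 2 * k ^ 2)
     + (G1 * (k - l - q - L / 4 * m ^ 2) + G2 / 2 * ((k - l) * (k + l)))).
  2: { revert Hid. generalize (fst (RtoC (G2 / 4) * g * g * s * s)%C). intros X HX.
       replace X with (G2 / 2 * l ^ 2 - G2 * Cmod g ^ 2 / 4 * m ^ 2) by lra. field. }
  eapply Rle_trans; [apply Rabs_triang|].
  assert (B1 : eps / 3 / K2 ^ 2 * k ^ 2 <= eps / 3 * m ^ 2).
  { rewrite <- (pow2_abs k).
    assert (Rabs k ^ 2 <= (K2 * m) ^ 2) by (apply pow_incr; split; [apply Rabs_pos|exact Hk]).
    replace (eps / 3 * m ^ 2) with (eps / 3 / K2 ^ 2 * (K2 * m) ^ 2) by (field; lra).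
    apply Rmult_le_compat_l; [|exact H]. left.
    apply Rdiv_lt_0_compat; [lra|]. apply pow_lt. lra. }
  assert (B2 : Rabs (G1 * (k - l - q - L / 4 * m ^ 2)) <= eps / 3 * m ^ 2).
  { rewrite Rabs_mult.
    apply Rle_trans with ((Rabs G1 + 1) * (eps / 3 / (Rabs G1 + 1) * m ^ 2)).
    - apply Rmult_le_compat; try apply Rabs_pos; lra.
    - right. field. lra. }
  assert (B3 : Rabs (G2 / 2 * ((k - l) * (k + l))) <= eps / 3 * m ^ 2).
  { rewrite Rabs_mult, Rabs_mult.
    assert (Hkl : Rabs (k + l) <= 2 * K2 * m).
    { eapply Rle_trans; [apply Rabs_triang|].
      assert (Cmod g * m <= K2 * m) by (apply Rmult_le_compat_r; [lra|unfold K2; lra]). lra. }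
    assert (Hp : Rabs (k - l) * Rabs (k + l) <= K * m ^ 2 * (2 * K2 * m)).
    { apply Rmult_le_compat; auto using Rabs_pos. }
    replace (Rabs (G2 / 2)) with (Rabs G2 / 2)
      by (unfold Rdiv; rewrite Rabs_mult, (Rabs_right (/ 2)); lra).
    apply Rle_trans with (Rabs G2 / 2 * (K * m ^ 2 * (2 * K2 * m))).
    { apply Rmult_le_compat_l; lra. }
    replace (Rabs G2 / 2 * (K * m ^ 2 * (2 * K2 * m))) with (Rabs G2 * K * K2 * m * m ^ 2) by field.
    apply Rmult_le_compat_r; [lra|].
    assert (Hc : 0 <= Rabs G2 * K * K2) by (apply Rmult_le_pos; [apply Rmult_le_pos|]; lra).
    apply Rle_trans with ((Rabs G2 * K * K2 + 1) * d4).
    - apply Rmult_le_compat; lra.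
    - right. unfold d4. field. lra. }
  pose proof (Rabs_triang (G1 * (k - l - q - L / 4 * m ^ 2)) (G2 / 2 * ((k - l) * (k + l)))).
  replace (eps * m ^ 2) with (eps / 3 * m ^ 2 + (eps / 3 * m ^ 2 + eps / 3 * m ^ 2)) by field.
  lra.
Qed.

Lemma cjet_eq f g g' L L' : cjet f g L -> g = g' -> L = L' -> cjet f g' L'.
Proof. intros H <- <-. exact H. Qed.

Lemma cjet_affine f g L b c : cjet f g L -> cjet (fun s => b + c * f s) (RtoC c * g)%C (c * L).
Proof.
  intros H. eapply cjet_eq; [exact (cjet_comp f g L _ _ _ H (rjet_affine b c (f 0%C)))|ring|ring].
Qed.

(** Polarisation, [4 f1 f2 = (f1 + f2)^2 - (f1 - f2)^2], reduces the product rule to sums and to the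
    chain rule for the square. *)
Lemma cjet_mult f1 f2 g1 g2 L1 L2 : cjet f1 g1 L1 -> cjet f2 g2 L2 ->
  cjet (fun s => f1 s * f2 s) (RtoC (f1 0%C) * g2 + RtoC (f2 0%C) * g1)%C
    (f1 0%C * L2 + f2 0%C * L1 + 2 * fst (g1 * Cconj g2)%C).
Proof.
  intros H1 H2.
  pose proof (cjet_plus _ _ _ _ _ _ H1 H2) as Hp.
  pose proof (cjet_plus _ _ _ _ _ _ H1 (cjet_affine _ _ _ 0 (-1) H2)) as Hm.
  pose proof (cjet_affine _ _ _ 0 (/ 4) (cjet_comp _ _ _ _ _ _ Hp (rjet_sqr _))) as Hp2.
  pose proof (cjet_affine _ _ _ 0 (- / 4) (cjet_comp _ _ _ _ _ _ Hm (rjet_sqr _))) as Hm2.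
  eapply cjet_eq.
  - eapply cjet_ext; [|exact (cjet_plus _ _ _ _ _ _ Hp2 Hm2)]. intros s. simpl. field.
  - destruct g1, g2. unfold Cplus, Cmult, RtoC; simpl. f_equal; field.
  - rewrite !Cmod_sqr. destruct g1, g2. unfold Cplus, Cmult, RtoC, Cconj; simpl. field.
Qed.

(** Multiplication by [p] is conformal: the parts [Re (Q s^2)] and [|s|^2] are rescaled without
    mixing. *)
Lemma cjet_dilate f g L (p : C) : cjet f g L ->
  cjet (fun s => f (s * p)%C) (g * p)%C (L * Cmod p ^ 2).
Proof.
  intros [Q HQ]. exists (Q * p * p)%C. intros eps He. pose proof (Cmod_ge_0 p).
  destruct (HQ (eps / (Cmod p + 1) ^ 2)) as [d [Hd H']].
  { apply Rdiv_lt_0_compat; [lra|]. apply pow_lt. lra. }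
  exists (d / (Cmod p + 1)). split; [apply Rdiv_lt_0_compat; lra|]. intros s Hs.
  pose proof (Cmod_ge_0 s).
  assert (Hsp : Cmod s * (Cmod p + 1) < d).
  { replace d with (d / (Cmod p + 1) * (Cmod p + 1)) by (field; lra).
    apply Rmult_lt_compat_r; lra. }
  specialize (H' (s * p)%C). rewrite Cmod_mult in H'. specialize (H' ltac:(nra)).
  rewrite Cmult_0_l. replace (g * p * s)%C with (g * (s * p))%C by ring.
  replace (Q * p * p * s * s)%C with (Q * (s * p) * (s * p))%C by ring.
  replace (L * Cmod p ^ 2 / 4 * Cmod s ^ 2) with (L / 4 * (Cmod s * Cmod p) ^ 2) by field.
  eapply Rle_trans; [exact H'|].
  replace (eps / (Cmod p + 1) ^ 2 * (Cmod s * Cmod p) ^ 2)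
    with (eps * Cmod s ^ 2 * (Cmod p ^ 2 / (Cmod p + 1) ^ 2)) by (field; lra).
  rewrite <- (Rmult_1_r (eps * Cmod s ^ 2)) at 2. apply Rmult_le_compat_l.
  - apply Rmult_le_pos; [lra|apply pow2_ge_0].
  - apply Rle_div_l; [apply pow_lt; lra|]. nra.
Qed.

(* Averaging over the four points [t, i t, -t, -i t] kills the terms in [g] and [Q]. *)
Lemma cjet_local_max f g L r : cjet f g L -> 0 < r ->
  (forall s, Cmod s < r -> f s <= f 0%C) -> L <= 0.
Proof.
  intros [Q HQ] Hr Hmax. apply Rnot_lt_le. intros HL.
  destruct (HQ (L / 8) ltac:(lra)) as [d [Hd H]].
  set (t := Rmin d r / 2).
  assert (Ht : 0 < t /\ t < d /\ t < r) by (unfold t, Rmin; destruct Rle_dec; lra).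
  assert (Hm : forall a b : R, a ^ 2 + b ^ 2 = t ^ 2 -> Cmod (a, b) = t).
  { intros a b Hab. unfold Cmod. simpl fst. simpl snd. rewrite Hab. apply sqrt_pow2. lra. }
  pose proof (Hm t 0 ltac:(ring)) as M1. pose proof (Hm (- t) 0 ltac:(ring)) as M2.
  pose proof (Hm 0 t ltac:(ring)) as M3. pose proof (Hm 0 (- t) ltac:(ring)) as M4.
  pose proof (H (t, 0)) as H1. pose proof (H (- t, 0)) as H2.
  pose proof (H (0, t)) as H3. pose proof (H (0, - t)) as H4.
  pose proof (Hmax (t, 0)) as X1. pose proof (Hmax (- t, 0)) as X2.
  pose proof (Hmax (0, t)) as X3. pose proof (Hmax (0, - t)) as X4.
  rewrite M1 in H1, X1. rewrite M2 in H2, X2. rewrite M3 in H3, X3. rewrite M4 in H4, X4.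
  specialize (H1 ltac:(lra)). specialize (H2 ltac:(lra)). specialize (H3 ltac:(lra)).
  specialize (H4 ltac:(lra)). specialize (X1 ltac:(lra)). specialize (X2 ltac:(lra)).
  specialize (X3 ltac:(lra)). specialize (X4 ltac:(lra)).
  apply Rabs_le_between in H1, H2, H3, H4.
  destruct g as [g1 g2], Q as [q1 q2]. unfold Cmult in H1, H2, H3, H4. simpl in H1, H2, H3, H4.
  assert (0 < t * t) by nra. nra.
Qed.

Lemma cjet_cont f g L : cjet f g L -> ccont f 0%C.
Proof.
  intros H eps He. destruct (cjet_remainder f g L H) as [K [d [HK [Hd HR]]]].
  pose proof (Cmod_ge_0 g) as Hg. set (K2 := Cmod g + K).
  assert (HeK : 0 < eps / K2) by (apply Rdiv_lt_0_compat; unfold K2; lra).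
  set (d' := Rmin d (Rmin 1 (eps / K2))).
  assert (Hd' : 0 < d' /\ d' <= d /\ d' <= 1 /\ d' <= eps / K2).
  { unfold d', Rmin. repeat destruct Rle_dec; lra. }
  exists d'. split; [lra|]. intros s Hs. replace (s - 0)%C with s in Hs by ring.
  destruct (HR s ltac:(lra) ltac:(lra)) as [_ Hk]. apply Rle_lt_trans with (1 := Hk).
  fold K2. replace eps with (K2 * (eps / K2)) by (field; unfold K2; lra).
  apply Rmult_lt_compat_l; unfold K2 in *; lra.
Qed.

(** * Polygonal distance and the Hopf-Rinow theorem *)

Definition seg (a b : C) (t : R) : C := (a + RtoC t * (b - a))%C.

Lemma seg_0 a b : seg a b 0 = a.
Proof. unfold seg. ring. Qed.

Lemma seg_1 a b : seg a b 1 = b.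
Proof. unfold seg. ring. Qed.

Lemma seg_sub_l a b t : (seg a b t - a)%C = (RtoC t * (b - a))%C.
Proof. unfold seg. ring. Qed.

Lemma Cmod_Rmult (t : R) (z : C) : Cmod (RtoC t * z)%C = Rabs t * Cmod z.
Proof. rewrite Cmod_mult, Cmod_R. reflexivity. Qed.

Lemma Cmod_seg_le a b t p r : 0 <= t <= 1 -> Cmod (a - p)%C < r -> Cmod (b - p)%C < r ->
  Cmod (seg a b t - p)%C < r.
Proof.
  intros Ht Ha Hb.
  replace (seg a b t - p)%C with (RtoC (1 - t) * (a - p) + RtoC t * (b - p))%C
    by (unfold seg; rewrite RtoC_minus; ring).
  eapply Rle_lt_trans; [apply Cmod_triangle|]. rewrite !Cmod_Rmult, !Rabs_right by lra.
  destruct (Rle_lt_dec t (1 / 2)); nra.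
Qed.

(* An upper bound [r] for the [rho]-distance from [a] to [b], witnessed by a polygon
   with a constant bound [m] for the density on each edge; this avoids integrals. *)
Inductive chain_dist (O : C -> Prop) (rho : C -> R) : C -> C -> R -> Prop :=
| chain_seg a b m r :
    (forall t, 0 <= t <= 1 -> O (seg a b t) /\ rho (seg a b t) <= m) ->
    m * Cmod (b - a)%C < r -> 0 < r -> chain_dist O rho a b r
| chain_cat a b c r1 r2 :
    chain_dist O rho a b r1 -> chain_dist O rho b c r2 -> chain_dist O rho a c (r1 + r2).

Section Chain.
Variables (O : C -> Prop) (rho : C -> R).
Notation cd := (chain_dist O rho).

Lemma chain_pos a b r : cd a b r -> 0 < r.
Proof. induction 1; lra. Qed.

Lemma chain_dom a b r : cd a b r -> O a /\ O b.
Proof.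
  induction 1 as [a b m r H _ _|]; [|tauto]. split.
  - rewrite <- (seg_0 a b). apply H. lra.
  - rewrite <- (seg_1 a b). apply H. lra.
Qed.

Lemma chain_refl a r : O a -> 0 < r -> cd a a r.
Proof.
  intros Ha Hr.
  assert (Hs : forall t, seg a a t = a) by (intros t; unfold seg; ring).
  apply (chain_seg O rho a a (rho a)); [|rewrite Cmod_diag; lra|exact Hr].
  intros t _. rewrite Hs. split; [exact Ha|lra].
Qed.

Lemma chain_weaken a b r r' : cd a b r -> r <= r' -> cd a b r'.
Proof.
  intros H Hr. destruct (Req_dec r r') as [<-|Hne]; [exact H|].
  replace r' with (r + (r' - r)) by ring. apply (chain_cat O rho a b b); [exact H|].
  apply chain_refl; [apply (chain_dom _ _ _ H)|lra].
Qed.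

Lemma chain_sym a b r : cd a b r -> cd b a r.
Proof.
  induction 1 as [a b m r H Hm Hr|a b c r1 r2 H1 IH1 H2 IH2].
  - apply (chain_seg O rho b a m); [|rewrite Cmod_sym; exact Hm|exact Hr].
    intros t Ht. replace (seg b a t) with (seg a b (1 - t)).
    + apply H. lra.
    + unfold seg. rewrite RtoC_minus. ring.
  - rewrite Rplus_comm. apply (chain_cat O rho c b a); assumption.
Qed.

(** The length-space property on which Hopf-Rinow rests: a ball of radius [r1 + r2] is covered by
    the [r2]-balls about the points of the [r1]-ball. A single edge is cut in the ratio of the two
    bounds, which keeps its strict inequality. *)
Lemma chain_split a b r : cd a b r -> forall r1 r2, 0 < r1 -> 0 < r2 -> r = r1 + r2 ->
  exists c, cd a c r1 /\ cd c b r2.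
Proof.
  induction 1 as [a b m r H Hm Hr|a b c s1 s2 H1 IH1 H2 IH2]; intros r1 r2 Hr1 Hr2 E.
  - set (th := r1 / r).
    assert (Hth : 0 < th < 1).
    { unfold th. split; [apply Rdiv_lt_0_compat; lra|]. apply Rlt_div_l; lra. }
    assert (Ea : th * r = r1) by (unfold th; field; lra).
    exists (seg a b th). split.
    + apply (chain_seg O rho _ _ m); [| |exact Hr1].
      * intros t Ht. replace (seg a (seg a b th) t) with (seg a b (t * th)).
        -- apply H. nra.
        -- unfold seg. rewrite RtoC_mult. ring.
      * rewrite seg_sub_l, Cmod_Rmult, Rabs_right by lra. nra.
    + apply (chain_seg O rho _ _ m); [| |exact Hr2].
      * intros t Ht. replace (seg (seg a b th) b t) with (seg a b (th + t * (1 - th))).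
        -- apply H. nra.
        -- unfold seg. rewrite RtoC_plus, RtoC_mult, RtoC_minus. ring.
      * replace (b - seg a b th)%C with (RtoC (1 - th) * (b - a))%C
          by (unfold seg; rewrite RtoC_minus; ring).
        rewrite Cmod_Rmult, Rabs_right by lra. nra.
  - destruct (Rtotal_order r1 s1) as [Hlt|[->|Hgt]].
    + destruct (IH1 r1 (s1 - r1)) as [d [Hd1 Hd2]]; try lra. exists d. split; [exact Hd1|].
      replace r2 with ((s1 - r1) + s2) by lra. apply (chain_cat O rho d b c); assumption.
    + exists b. split; [exact H1|]. replace r2 with s2 by lra. exact H2.
    + destruct (IH2 (r1 - s1) r2) as [d [Hd1 Hd2]]; try lra. exists d. split; [|exact Hd2].
      replace r1 with (s1 + (r1 - s1)) by lra. apply (chain_cat O rho a b d); assumption.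
Qed.

Lemma chain_near z eps : is_open O -> (forall z, O z -> ccont rho z) -> O z -> 0 < eps ->
  exists d, 0 < d /\ forall w, Cmod (w - z)%C < d -> cd z w eps.
Proof.
  intros HO Hc Hz He. destruct (open_ball O z HO Hz) as [r [Hr HB]].
  destruct (Hc z Hz 1 Rlt_0_1) as [d [Hd Hrho]].
  set (m := Rabs (rho z) + 1). assert (Hm : 0 < m) by (unfold m; pose proof (Rabs_pos (rho z)); lra).
  set (d' := Rmin r (Rmin d (eps / m))).
  assert (Hem : 0 < eps / m) by (apply Rdiv_lt_0_compat; lra).
  assert (Hd' : 0 < d' /\ d' <= r /\ d' <= d /\ d' <= eps / m).
  { unfold d', Rmin. repeat destruct Rle_dec; lra. }
  exists d'. split; [lra|]. intros w Hw.
  apply (chain_seg O rho z w m); [| |exact He].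
  - intros t Ht.
    assert (Hs : Cmod (seg z w t - z)%C < d').
    { apply Cmod_seg_le; [exact Ht| |exact Hw].
      rewrite Cmod_diag. lra. }
    split; [apply HB; lra|]. specialize (Hrho (seg z w t) ltac:(lra)).
    apply Rabs_def2 in Hrho. pose proof (Rle_abs (rho z)). unfold m. lra.
  - apply Rlt_le_trans with (m * (eps / m)); [apply Rmult_lt_compat_l; lra|].
    right. field. lra.
Qed.

(** The truncated function [c * min (|w - p|, r)] is 1-Lipschitz along chains. An edge starting
    inside the disc has [m >= c], already by the value of [rho] at its start; an edge starting
    outside cannot raise the truncated value. So no exit point has to be found. *)
Lemma chain_escape p r c : 0 < c ->
  (forall w, Cmod (w - p)%C < r -> c <= rho w) ->
  forall a b L, cd a b L -> c * Rmin (Cmod (b - p)%C) r <= c * Rmin (Cmod (a - p)%C) r + L.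
Proof.
  intros Hc Hrho a b L H. induction H as [a b m L H Hm HL|]; [|lra].
  pose proof (Cmod_ge_0 (b - a)%C) as Hn.
  assert (Ht : Cmod (b - p)%C <= Cmod (b - a)%C + Cmod (a - p)%C) by apply Cmod_dist_triangle.
  assert (K : c <= m -> c * Cmod (b - a)%C < L) by (intros K; nra).
  unfold Rmin. destruct (Rle_dec (Cmod (a - p)%C) r) as [Ha|Ha].
  - destruct (Rle_lt_or_eq_dec _ _ Ha) as [Ha'|Ha'].
    + specialize (H 0 ltac:(lra)). rewrite seg_0 in H. specialize (Hrho a Ha').
      specialize (K ltac:(lra)). destruct Rle_dec; nra.
    + destruct Rle_dec; nra.
  - destruct Rle_dec; nra.
Qed.

Lemma chain_ball_small p r c : 0 < c -> 0 < r ->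
  (forall w, Cmod (w - p)%C < r -> c <= rho w) ->
  forall b L, cd p b L -> L < c * r -> c * Cmod (b - p)%C <= L.
Proof.
  intros Hc Hr Hrho b L H HL.
  pose proof (chain_escape p r c Hc Hrho p b L H) as Hm.
  rewrite Cmod_diag in Hm.
  revert Hm. unfold Rmin. repeat destruct Rle_dec; intros Hm; nra.
Qed.

(** Geometric steps are all that Hopf-Rinow produces. The limit is taken in the Euclidean sense,
    independently of [rho], so that completeness passes to larger densities and limits for different
    densities can be identified. *)
Definition chain_complete : Prop :=
  forall (x : nat -> C) (K : R), (forall n, cd (x n) (x (S n)) (K * (/ 2) ^ n)) ->
    exists p, O p /\ ccv x p.

Hypothesis Oopen : is_open O.
Hypothesis rho_pos : forall z, O z -> 0 < rho z.
Hypothesis rho_cont : forall z, O z -> ccont rho z.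

(** Compactness of the [s]-ball is applied to the property that [P M] holds on the whole
    [3/8 r]-ball about [y]. For [y] in the [r]-ball, it holds near [y] by compactness of the
    [r/2]-ball about [y], the spare [r/8] absorbing the move of the centre. For other [y] it is
    vacuous nearby, because [s + r/8 <= r]. *)
Lemma chain_ball_extend x r s : 0 < r -> 0 < s -> s + r / 8 <= r ->
  (forall y, cd x y r -> rel_compact O (fun z => cd y z (r / 2))) ->
  rel_compact O (fun z => cd x z s) -> rel_compact O (fun z => cd x z (s + 3 / 8 * r)).
Proof.
  intros Hr Hs Hsr Hy Hx P Hmon Hloc.
  destruct (Hx (fun M y => cd x y s -> forall z, cd y z (3 / 8 * r) -> P M z)) as [M HM].
  - intros M M' z HMM H1 H2 w Hw. apply (Hmon M M' w HMM). apply H1; assumption.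
  - intros y HOy. destruct (chain_near y (r / 8) Oopen rho_cont HOy ltac:(lra)) as [d [Hd Hnear]].
    destruct (classic (cd x y r)) as [Hxy|Hxy].
    + destruct (Hy y Hxy P Hmon Hloc) as [M HM]. exists d, M. split; [exact Hd|].
      intros w Hw _ z Hz. apply HM. replace (r / 2) with (r / 8 + 3 / 8 * r) by field.
      apply (chain_cat O rho y w z); [apply Hnear, Hw|exact Hz].
    + exists d, 0. split; [exact Hd|]. intros w Hw Hxw. exfalso. apply Hxy.
      apply chain_weaken with (s + r / 8); [|lra].
      apply (chain_cat O rho x w y); [exact Hxw|]. apply chain_sym, Hnear, Hw.
  - exists M. intros z Hz.
    destruct (chain_split _ _ _ Hz s (3 / 8 * r)) as [y [H1 H2]]; [lra|lra|reflexivity|].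
    apply (HM y H1 H1 z H2).
Qed.

Lemma chain_ball_step x r : 0 < r -> O x -> ~ rel_compact O (fun z => cd x z r) ->
  exists y, cd x y r /\ ~ rel_compact O (fun z => cd y z (r / 2)).
Proof.
  intros Hr HOx Hn. apply NNPP. intros Hn2. apply Hn.
  assert (Hy : forall y, cd x y r -> rel_compact O (fun z => cd y z (r / 2))).
  { intros y Hy. apply NNPP. intros H. apply Hn2. exists y. auto. }
  (* Two extensions take the radius from [4/8 r] to [7/8 r] and then to [10/8 r], past [r]. *)
  assert (H1 := chain_ball_extend x r (r / 2) Hr ltac:(lra) ltac:(lra) Hy
    (Hy x (chain_refl x r HOx Hr))).
  assert (H2 := chain_ball_extend x r (r / 2 + 3 / 8 * r) Hr ltac:(lra) ltac:(lra) Hy H1).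
  apply (rel_compact_subset _ _ _) with (2 := H2). intros z Hz.
  apply chain_weaken with (1 := Hz). lra.
Qed.

Lemma chain_ball_near_compact p : O p -> exists e, 0 < e /\ rel_compact O (fun z => cd p z e).
Proof.
  intros Hp. destruct (open_ball O p Oopen Hp) as [r [Hr HB]].
  pose proof (rho_pos p Hp) as Hrp.
  destruct (rho_cont p Hp (rho p / 2) ltac:(lra)) as [d [Hd Hrho]].
  set (r' := Rmin r d / 2).
  assert (Hr' : 0 < r' /\ r' < r /\ r' < d) by (unfold r', Rmin; destruct Rle_dec; lra).
  exists (rho p / 4 * r'). split; [nra|].
  apply (rel_compact_subset _ (fun z => Cmod (z - p)%C <= r')).
  - intros z Hz.
    assert (H := chain_ball_small p r' (rho p / 2) ltac:(lra) ltac:(lra)).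
    assert (Hc : forall w, Cmod (w - p)%C < r' -> rho p / 2 <= rho w).
    { intros w Hw. specialize (Hrho w ltac:(lra)). apply Rabs_def2 in Hrho. lra. }
    specialize (H Hc z _ Hz ltac:(nra)). nra.
  - apply rel_compact_disc. intros z Hz. apply HB. lra.
Qed.

(* Hopf-Rinow. A ball that is not relatively compact contains the centre of one of half
   the radius that is not either; the centres converge to a point with no compact ball. *)
Theorem chain_ball_compact x r : chain_complete -> O x -> 0 < r ->
  rel_compact O (fun z => cd x z r).
Proof.
  intros Hcomp HOx Hr. apply NNPP. intros Hn.
  pose (bad := fun (s : R) (y : C) => O y /\ ~ rel_compact O (fun z => cd y z s)).
  (* Badness is a premise inside the existential, so that choice yields a total function of
     [(n, y)]; a point that is not bad gets the dummy value [y]. *)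
  assert (Hstep : forall (n : nat) (y : C), exists y', bad (r * (/ 2) ^ n) y ->
    cd y y' (r * (/ 2) ^ n) /\ bad (r * (/ 2) ^ S n) y').
  { intros n y. assert (0 < r * (/ 2) ^ n) by (apply Rmult_lt_0_compat; [lra|apply pow_lt; lra]).
    destruct (classic (bad (r * (/ 2) ^ n) y)) as [[H1 H2]|H1]; [|exists y; tauto].
    destruct (chain_ball_step y _ H H1 H2) as [y' [H3 H4]]. exists y'. intros _.
    split; [exact H3|]. split; [apply (chain_dom _ _ _ H3)|].
    simpl. replace (r * (/ 2 * (/ 2) ^ n)) with (r * (/ 2) ^ n / 2) by field. exact H4. }
  destruct (choice (fun ny y' => bad (r * (/ 2) ^ fst ny) (snd ny) ->
    cd (snd ny) y' (r * (/ 2) ^ fst ny) /\ bad (r * (/ 2) ^ S (fst ny)) y')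
    (fun ny : nat * C => Hstep (fst ny) (snd ny))) as [F HF].
  pose (X := fix X (n : nat) : C := match n with 0%nat => x | S m => F (m, X m) end).
  assert (HX : forall n, bad (r * (/ 2) ^ n) (X n)).
  { induction n as [|n IH].
    - simpl. rewrite Rmult_1_r. split; assumption.
    - apply (HF (n, X n) IH). }
  destruct (Hcomp X r (fun n => proj1 (HF (n, X n) (HX n)))) as [p [Hp Hcv]].
  destruct (chain_ball_near_compact p Hp) as [e [He Hpe]].
  destruct (chain_near p (e / 2) Oopen rho_cont Hp ltac:(lra)) as [d [Hd Hnear]].
  destruct (Hcv d Hd) as [N HN].
  destruct (pow_lt_1_zero (/ 2) ltac:(rewrite Rabs_right; lra) (e / 2 / r)) as [N2 HN2].
  { apply Rdiv_lt_0_compat; lra. }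
  set (n := max N N2). specialize (HN n ltac:(lia)). specialize (HN2 n ltac:(lia)).
  rewrite Rabs_right in HN2 by (apply Rle_ge, pow_le; lra).
  apply (proj2 (HX n)). apply (rel_compact_subset _ _ _) with (2 := Hpe). intros z Hz.
  apply chain_weaken with (e / 2 + r * (/ 2) ^ n).
  - apply (chain_cat O rho p (X n) z); [apply Hnear, HN|exact Hz].
  - assert (r * (/ 2) ^ n < r * (e / 2 / r)) by (apply Rmult_lt_compat_l; lra).
    replace (r * (e / 2 / r)) with (e / 2) in H by (field; lra). lra.
Qed.

End Chain.

Lemma chain_mono (O O' : C -> Prop) (rho rho' : C -> R) a b r :
  subset O O' -> (forall z, O z -> rho' z <= rho z) ->
  chain_dist O rho a b r -> chain_dist O' rho' a b r.
Proof.
  intros HO Hrho. induction 1 as [a b m r H Hm Hr|a b c r1 r2 _ IH1 _ IH2].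
  - apply (chain_seg O' rho' a b m); [|exact Hm|exact Hr].
    intros t Ht. destruct (H t Ht) as [H1 H2]. split; [apply HO, H1|].
    specialize (Hrho _ H1). lra.
  - exact (chain_cat O' rho' a b c r1 r2 IH1 IH2).
Qed.

(** * Energy of polygons *)

Lemma Un_cv_const (c : R) : Un_cv (fun _ => c) c.
Proof.
  intros eps He. exists 0%nat. intros n _. unfold Rdist. rewrite Rminus_diag, Rabs_R0. exact He.
Qed.

Fixpoint psum (f : nat -> R) (n : nat) : R :=
  match n with 0%nat => 0 | S m => psum f m + f m end.

Lemma psum_S f n : psum f (S n) = psum f n + f n.
Proof. reflexivity. Qed.

Lemma psum_le f h n : (forall i, (i < n)%nat -> f i <= h i) -> psum f n <= psum h n.
Proof.
  induction n as [|n IH]; intros H; simpl; [lra|].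
  apply Rplus_le_compat; [apply IH; intros; apply H|apply H]; lia.
Qed.

Lemma psum_mono f i n : (forall j, 0 <= f j) -> (i <= n)%nat -> psum f i <= psum f n.
Proof. intros Hf. induction 1; simpl; [lra|]. specialize (Hf m). lra. Qed.

Lemma psum_ge0 f n : (forall j, 0 <= f j) -> 0 <= psum f n.
Proof. intros Hf. apply (psum_mono f 0 n Hf). lia. Qed.

Lemma psum_term_le f i n : (forall j, 0 <= f j) -> (i < n)%nat -> f i <= psum f n.
Proof.
  intros Hf Hi. apply Rle_trans with (psum f (S i)).
  - simpl. pose proof (psum_ge0 f i Hf). lra.
  - apply psum_mono; [exact Hf|lia].
Qed.

Lemma psum_scal c f n : psum (fun i => c * f i) n = c * psum f n.
Proof. induction n as [|n IH]; simpl; [ring|]. rewrite IH. ring. Qed.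

Lemma psum_affine b c f n : psum (fun i => c * f i + b) n = c * psum f n + INR n * b.
Proof. induction n as [|n IH]; [simpl; ring|]. rewrite S_INR. simpl. rewrite IH. ring. Qed.

Lemma psum_cauchy_schwarz f n : psum f n ^ 2 <= INR n * psum (fun i => f i ^ 2) n.
Proof.
  induction n as [|n IH]; [simpl; lra|]. rewrite S_INR, !psum_S.
  set (S := psum f n) in *. set (Q := psum (fun i => f i ^ 2) n) in *. set (a := f n).
  pose proof (pos_INR n) as Hn.
  assert (HQ : 0 <= Q) by (apply psum_ge0; intros; apply pow2_ge_0).
  assert (H2 : 2 * S * a <= Q + INR n * a ^ 2); [|nra].
  destruct (Req_dec (INR n) 0) as [E|E].
  - rewrite E in IH |- *. assert (S = 0) by nra. rewrite H. lra.
  - apply (Rmult_le_reg_l (INR n)); [lra|].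
    pose proof (pow2_ge_0 (S - INR n * a)). nra.
Qed.

Lemma psum_cv (F : nat -> nat -> R) (l : nat -> R) n :
  (forall i, (i < n)%nat -> Un_cv (fun k => F k i) (l i)) ->
  Un_cv (fun k => psum (F k) n) (psum l n).
Proof.
  induction n as [|n IH]; intros H; simpl.
  - apply Un_cv_const.
  - apply CV_plus; [apply IH; intros; apply H|apply H]; lia.
Qed.

Lemma cjet_psum (n : nat) (f : nat -> C -> R) (g : nat -> C) (L : nat -> R) :
  (forall i, (i < n)%nat -> cjet (f i) (g i) (L i)) ->
  exists G, cjet (fun s => psum (fun i => f i s) n) G (psum L n) /\
    Cmod G <= psum (fun i => Cmod (g i)) n.
Proof.
  induction n as [|n IH]; intros H.
  - exists 0%C. split; [apply (cjet_const 0)|simpl; rewrite Cmod_0; lra].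
  - destruct IH as [G [HG1 HG2]]. { intros i Hi. apply H. lia. }
    exists (G + g n)%C. split.
    + simpl. apply cjet_plus; [exact HG1|]. apply H. lia.
    + simpl. eapply Rle_trans; [apply Cmod_triangle|]. lra.
Qed.

Lemma cjet_normsq (a b : C) :
  cjet (fun s => Cmod (a + s * b)%C ^ 2) (RtoC 2 * Cconj a * b)%C (4 * Cmod b ^ 2).
Proof.
  exists 0%C. intros eps He. exists 1. split; [lra|]. intros s _.
  replace (_ - _ - _ - _ - _) with 0.
  - rewrite Rabs_R0. apply Rmult_le_pos; [lra|apply pow2_ge_0].
  - rewrite !Cmod_sqr. destruct a, b, s. unfold Cplus, Cmult, Cconj, RtoC. simpl. field.
Qed.

(* Twice differentiable at each point of [O], with [g = u_x - i u_y] and [L] the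
   Laplacian, and [C^{1,1}] locally uniformly. *)
Definition jet_on (O : C -> Prop) (u : C -> R) (g : C -> C) (L : C -> R) : Prop :=
  forall z, O z ->
    cjet (fun s => u (z + s)%C) (g z) (L z) /\
    exists r M, 0 < r /\ forall w h, Cmod (w - z)%C < r -> Cmod h < r ->
      Cmod (g w) <= M /\ Rabs (u (w + h)%C - u w - fst (g w * h)%C) <= M * Cmod h ^ 2.

Lemma cjet_ccont u z g L : cjet (fun s => u (z + s)%C) g L -> ccont u z.
Proof.
  intros Hj eps He. destruct (cjet_cont _ _ _ Hj eps He) as [d [Hd H]]. exists d. split; [exact Hd|].
  intros w Hw. specialize (H (w - z)%C). rewrite Cplus_0_r in H.
  replace (z + (w - z))%C with w in H by ring. apply H.
  replace (w - z - 0)%C with (w - z)%C by ring. exact Hw.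
Qed.

Lemma jet_on_cont O u g L z : jet_on O u g L -> O z -> ccont u z.
Proof. intros H Hz. apply (cjet_ccont u z (g z) (L z)), H, Hz. Qed.

Lemma ccont_ext f h z : (forall p, f p = h p) -> ccont f z -> ccont h z.
Proof.
  intros E H eps He. destruct (H eps He) as [d [Hd H']]. exists d. split; [exact Hd|].
  intros w Hw. rewrite <- !E. apply H', Hw.
Qed.

Lemma ccont_lin (f g : C -> R) (a b : R) z : ccont f z -> ccont g z ->
  ccont (fun p => a * f p + b * g p) z.
Proof.
  intros Hf Hg eps He. pose proof (Rabs_pos a). pose proof (Rabs_pos b).
  assert (He' : 0 < eps / (Rabs a + Rabs b + 1)) by (apply Rdiv_lt_0_compat; lra).
  destruct (Hf _ He') as [d1 [Hd1 H1]]. destruct (Hg _ He') as [d2 [Hd2 H2]].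
  exists (Rmin d1 d2). split; [apply Rmin_pos; lra|]. intros w Hw.
  specialize (H1 w ltac:(pose proof (Rmin_l d1 d2); lra)).
  specialize (H2 w ltac:(pose proof (Rmin_r d1 d2); lra)).
  replace (a * f w + b * g w - (a * f z + b * g z)) with (a * (f w - f z) + b * (g w - g z)) by ring.
  eapply Rle_lt_trans; [apply Rabs_triang|]. rewrite !Rabs_mult.
  set (e := eps / (Rabs a + Rabs b + 1)) in *.
  replace eps with ((Rabs a + Rabs b + 1) * e) by (unfold e; field; lra).
  assert (Rabs a * Rabs (f w - f z) <= Rabs a * e) by (apply Rmult_le_compat_l; lra).
  assert (Rabs b * Rabs (g w - g z) <= Rabs b * e) by (apply Rmult_le_compat_l; lra). lra.
Qed.

Lemma ccont_comp (G : R -> R) (f : C -> R) z : continuity_pt G (f z) -> ccont f z ->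
  ccont (fun p => G (f p)) z.
Proof.
  intros HG Hf eps He. destruct (HG eps He) as [a [Ha H]].
  destruct (Hf a Ha) as [d [Hd H']]. exists d. split; [exact Hd|]. intros w Hw.
  destruct (Req_dec (f w) (f z)) as [E|E].
  - rewrite E, Rminus_diag, Rabs_R0. exact He.
  - apply H. split; [split; [exact I|auto]|]. apply H', Hw.
Qed.

Lemma continuity_pt_exp x : continuity_pt exp x.
Proof. apply derivable_continuous_pt, derivable_pt_exp. Qed.

Lemma ccont_exp u z : ccont u z -> ccont (fun z => exp (u z)) z.
Proof. apply (ccont_comp exp), continuity_pt_exp. Qed.

(** One constant bounds the function, its gradient and its quadratic remainder, and its inverse is
    the radius of a disc inside [O]: the predicate is thus monotone in [M], as [rel_compact]
    demands. *)
Definition uniform_at (O : C -> Prop) (u : C -> R) (g : C -> C) (M : R) (z : C) : Prop :=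
  Rabs (u z) <= M /\ Cmod (g z) <= M /\
  forall h, Cmod h < / M ->
    O (z + h)%C /\ Rabs (u (z + h)%C - u z - fst (g z * h)%C) <= M * Cmod h ^ 2.

Lemma rel_compact_cont_bound O A f : rel_compact O A -> (forall z, O z -> ccont f z) ->
  exists M, 0 <= M /\ forall z, A z -> Rabs (f z) <= M.
Proof.
  intros HA Hf. destruct (rel_compact_bounded O A (fun z => Rabs (f z)) HA) as [M HM].
  2: { exists (Rabs M). split; [apply Rabs_pos|]. intros z Hz. pose proof (Rle_abs M).
       specialize (HM z Hz). lra. }
  intros z Hz. destruct (Hf z Hz 1 Rlt_0_1) as [r [Hr H]].
  exists r, (Rabs (f z) + 1). split; [exact Hr|]. intros w Hw. specialize (H w Hw).
  pose proof (Rabs_triang (f w - f z) (f z)) as H1.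
  replace (f w - f z + f z) with (f w) in H1 by ring. lra.
Qed.

Lemma uniform_at_weaken O u g M M' z : 0 < M -> M <= M' -> uniform_at O u g M z ->
  uniform_at O u g M' z.
Proof.
  intros HM HMM [H1 [H2 H3]]. split; [lra|]. split; [lra|]. intros h Hh. destruct (H3 h) as [H4 H5].
  { apply Rlt_le_trans with (1 := Hh). apply Rinv_le_contravar; lra. }
  split; [exact H4|]. pose proof (pow2_ge_0 (Cmod h)). nra.
Qed.

Lemma jet_on_uniform O A u g L : is_open O -> jet_on O u g L -> rel_compact O A ->
  exists M, 1 <= M /\ forall z, A z -> uniform_at O u g M z.
Proof.
  intros HO Hj HA.
  destruct (HA (fun M z => 0 < M /\ uniform_at O u g M z)) as [M HM].
  - intros M M' z HMM [H0 H1]. split; [lra|]. apply (uniform_at_weaken O u g M); assumption.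
  - intros z Hz. destruct (open_ball O z HO Hz) as [r1 [Hr1 HB]].
    destruct (jet_on_cont _ _ _ _ z Hj Hz 1 Rlt_0_1) as [r2 [Hr2 Hu]].
    destruct (Hj z Hz) as [_ [r3 [M3 [Hr3 H3]]]].
    set (r := Rmin (r1 / 2) (Rmin r2 r3)).
    assert (Hr : 0 < r /\ r <= r1 / 2 /\ r <= r2 /\ r <= r3).
    { unfold r, Rmin. repeat destruct Rle_dec; lra. }
    set (M := Rmax (Rabs (u z) + 1) (Rmax M3 (/ r))).
    assert (HM1 : Rabs (u z) + 1 <= M) by apply Rmax_l.
    assert (HM2 : M3 <= M) by (eapply Rle_trans; [apply Rmax_l|apply Rmax_r]).
    assert (HM3 : / r <= M) by (eapply Rle_trans; [apply Rmax_r|apply Rmax_r]).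
    assert (HrM : / M <= r).
    { rewrite <- (Rinv_inv r). apply Rinv_le_contravar; [apply Rinv_0_lt_compat|]; lra. }
    exists r, M. split; [lra|]. intros w Hw.
    pose proof (Rabs_pos (u z)) as Hp.
    split; [lra|]. split.
    { specialize (Hu w ltac:(lra)). pose proof (Rabs_triang (u w - u z) (u z)).
      replace (u w - u z + u z) with (u w) in H by ring. lra. }
    split.
    { destruct (H3 w 0%C ltac:(lra)) as [Hg _]; [rewrite Cmod_0|]; lra. }
    intros h Hh. destruct (H3 w h ltac:(lra) ltac:(lra)) as [_ H5].
    split.
    + apply HB. replace (w + h - z)%C with ((w - z) + h)%C by ring.
      eapply Rle_lt_trans; [apply Cmod_triangle|]. lra.
    + pose proof (pow2_ge_0 (Cmod h)). nra.
  - exists (Rmax M 1). split; [apply Rmax_r|]. intros z Hz. destruct (HM z Hz) as [H0 H1].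
    apply (uniform_at_weaken O u g M); [exact H0|apply Rmax_l|exact H1].
Qed.

Definition edge (z : nat -> C) (i : nat) : C := (z (S i) - z i)%C.

(* The factor [N] makes this dominate the square of the length of the polygon. *)
Definition energy (u : C -> R) (N : nat) (z : nat -> C) : R :=
  INR N * psum (fun i => exp (2 * u (z i)) * Cmod (edge z i) ^ 2) N.

Definition elen (u : C -> R) (z : nat -> C) (i : nat) : R := exp (u (z i)) * Cmod (edge z i).

Lemma exp_double x : exp (2 * x) = exp x ^ 2.
Proof. replace (2 * x) with (x + x) by ring. rewrite exp_plus. ring. Qed.

Lemma elen_ge0 u z i : 0 <= elen u z i.
Proof. apply Rmult_le_pos; [left; apply exp_pos|apply Cmod_ge_0]. Qed.

Lemma energy_elen u N z : energy u N z = INR N * psum (fun i => elen u z i ^ 2) N.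
Proof.
  unfold energy. f_equal. apply Rle_antisym; apply psum_le; intros i _; right;
  unfold elen; rewrite exp_double; ring.
Qed.

Lemma length_energy u N z : psum (elen u z) N ^ 2 <= energy u N z.
Proof. rewrite energy_elen. apply psum_cauchy_schwarz. Qed.

Lemma energy_ge0 u N z : 0 <= energy u N z.
Proof.
  rewrite energy_elen. apply Rmult_le_pos; [apply pos_INR|]. apply psum_ge0.
  intros j. apply pow2_ge_0.
Qed.

Lemma exp_monotone x y : x <= y -> exp x <= exp y.
Proof.
  intros [H| ->]; [left; apply exp_increasing, H|lra].
Qed.

Lemma exp_half_le : exp (1 / 2) <= 2.
Proof.
  assert (H : exp 1 = exp (1 / 2) ^ 2) by (rewrite <- exp_double; f_equal; field).
  pose proof exp_le_3. pose proof (exp_pos (1 / 2)). nra.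
Qed.

(** Such a step has [M |h| <= 1/4], so [u] varies by at most [1/2] along it and the density at most
    doubles. *)
Lemma uniform_step O u g M z h : 1 <= M -> uniform_at O u g M z -> Cmod h ^ 2 <= / (50 * M ^ 2) ->
  Cmod h < / M /\ M * Cmod h <= 1 / 4 /\ Rabs (u (z + h)%C - u z) <= 2 * M * Cmod h.
Proof.
  intros HM [H1 [H2 H3]] Hh. pose proof (Cmod_ge_0 h) as Hh0.
  assert (Hh2 : (M * Cmod h) ^ 2 <= / 50).
  { rewrite Rpow_mult_distr. apply Rle_trans with (M ^ 2 * / (50 * M ^ 2)).
    - apply Rmult_le_compat_l; [apply pow2_ge_0|exact Hh].
    - right. field. lra. }
  assert (Hh3 : M * Cmod h <= 1 / 4) by nra.
  assert (Hh4 : Cmod h < / M).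
  { apply Rle_lt_trans with (1 / 4 * / M).
    - replace (Cmod h) with (M * Cmod h * / M) by (field; lra).
      apply Rmult_le_compat_r; [|exact Hh3]. left. apply Rinv_0_lt_compat. lra.
    - assert (0 < / M) by (apply Rinv_0_lt_compat; lra). lra. }
  split; [exact Hh4|]. split; [exact Hh3|].
  destruct (H3 h Hh4) as [_ H5]. pose proof (fst_Cmult_le (g z) h) as H6.
  replace (u (z + h)%C - u z) with
    ((u (z + h)%C - u z - fst (g z * h)%C) + fst (g z * h)%C) by ring.
  eapply Rle_trans; [apply Rabs_triang|].
  assert (Cmod (g z) * Cmod h <= M * Cmod h) by (apply Rmult_le_compat_r; lra).
  assert (Cmod h <= 1) by nra. nra.
Qed.

Section ShortChains.
Variables (O : C -> Prop) (u : C -> R) (g : C -> C) (x0 : C) (M B : R) (N : nat).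
Notation cd := (chain_dist O (fun z => exp (u z))).
Hypothesis Ox0 : O x0.
Hypothesis HM : 1 <= M.
Hypothesis HB : 0 < B.
Hypothesis HN : exp M ^ 2 * B <= INR N * / (50 * M ^ 2).
Hypothesis Hball : forall z, cd x0 z (2 * sqrt B + 1) -> uniform_at O u g M z.
Variable z : nat -> C.
Hypothesis Hz0 : z 0%nat = x0.
Hypothesis HE : energy u N z <= B.

Lemma psum_elen_le i : (i <= N)%nat -> psum (elen u z) i <= sqrt B.
Proof.
  intros Hi. apply Rle_trans with (psum (elen u z) N).
  - apply psum_mono; [apply elen_ge0|exact Hi].
  - rewrite <- (sqrt_pow2 (psum (elen u z) N)) by (apply psum_ge0, elen_ge0).
    apply sqrt_le_1_alt. apply Rle_trans with (2 := HE). apply length_energy.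
Qed.

Lemma edge_sqr_le i : Rabs (u (z i)) <= M ->
  Cmod (edge z i) ^ 2 <= exp M ^ 2 * elen u z i ^ 2.
Proof.
  intros Hu. unfold elen. rewrite Rpow_mult_distr, <- Rmult_assoc.
  rewrite <- (Rmult_1_l (Cmod (edge z i) ^ 2)) at 1.
  apply Rmult_le_compat_r; [apply pow2_ge_0|].
  rewrite <- Rpow_mult_distr, <- exp_plus.
  assert (1 <= exp (M + u (z i))); [|nra].
  rewrite <- exp_0. apply Rabs_le_between in Hu.
  destruct (Req_dec 0 (M + u (z i))) as [<-|]; [lra|]. left. apply exp_increasing. lra.
Qed.

Lemma N_pos : 0 < INR N.
Proof.
  assert (0 < exp M ^ 2 * B).
  { apply Rmult_lt_0_compat; [apply pow_lt, exp_pos|exact HB]. }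
  assert (0 < / (50 * M ^ 2)) by (apply Rinv_0_lt_compat; nra). pose proof (pos_INR N).
  destruct (Req_dec (INR N) 0) as [E|E]; [|lra]. rewrite E in HN. lra.
Qed.

Lemma psum_sqr_le i : (i <= N)%nat -> exp M ^ 2 * psum (fun j => elen u z j ^ 2) i <= / (50 * M ^ 2).
Proof.
  intros Hi. pose proof N_pos as HNp.
  assert (H1 : psum (fun j => elen u z j ^ 2) i <= psum (fun j => elen u z j ^ 2) N).
  { apply psum_mono; [|exact Hi]. intros j. apply pow2_ge_0. }
  rewrite energy_elen in HE.
  assert (He : 0 < exp M ^ 2) by (apply pow_lt, exp_pos).
  apply (Rmult_le_reg_l (INR N)); [exact HNp|].
  apply Rle_trans with (exp M ^ 2 * B); [|exact HN].
  replace (INR N * (exp M ^ 2 * psum (fun j => elen u z j ^ 2) i)) with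
    (exp M ^ 2 * (INR N * psum (fun j => elen u z j ^ 2) i)) by ring.
  apply Rmult_le_compat_l; [lra|]. nra.
Qed.

Lemma edge_small i : (i < N)%nat -> Rabs (u (z i)) <= M -> Cmod (edge z i) ^ 2 <= / (50 * M ^ 2).
Proof.
  intros Hi Hu. apply Rle_trans with (1 := edge_sqr_le i Hu).
  apply Rle_trans with (2 := psum_sqr_le N (le_n _)).
  apply Rmult_le_compat_l; [apply pow2_ge_0|].
  apply (psum_term_le (fun j => elen u z j ^ 2) i N); [|exact Hi]. intros j. apply pow2_ge_0.
Qed.

(** A bootstrap, since edges are not assumed to lie in [O]. The ball hypothesis at [z i] provides
    the uniform bounds there; they make the next edge short, so that it stays in [O] with density at
    most twice that at [z i]. Hence the factor 2, which the radius [2 * sqrt B + 1] anticipates. *)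
Lemma vertex_dist i : (i <= N)%nat -> forall e, 0 < e -> cd x0 (z i) (2 * psum (elen u z) i + e).
Proof.
  induction i as [|i IH]; intros Hi e He.
  - simpl. rewrite Hz0. apply chain_refl; [exact Ox0|lra].
  - specialize (IH ltac:(lia)).
    assert (Hu : uniform_at O u g M (z i)).
    { apply Hball. eapply chain_weaken; [apply (IH 1); lra|].
      pose proof (psum_elen_le i ltac:(lia)). lra. }
    pose proof (edge_small i Hi (proj1 Hu)) as Hsm.
    assert (Hseg : forall t, 0 <= t <= 1 ->
       seg (z i) (z (S i)) t = (z i + RtoC t * edge z i)%C /\
       Cmod (RtoC t * edge z i)%C ^ 2 <= / (50 * M ^ 2) /\
       Cmod (RtoC t * edge z i)%C <= Cmod (edge z i)).
    { intros t Ht. split; [unfold seg, edge; ring|].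
      rewrite Cmod_Rmult, Rabs_right by lra. pose proof (Cmod_ge_0 (edge z i)). split; [|nra].
      apply Rle_trans with (2 := Hsm). apply pow_incr. nra. }
    simpl psum.
    replace (2 * (psum (elen u z) i + elen u z i) + e) with
      ((2 * psum (elen u z) i + e / 2) + (2 * elen u z i + e / 2)) by field.
    apply (chain_cat _ _ _ (z i)); [apply IH; lra|].
    pose proof (elen_ge0 u z i).
    apply (chain_seg _ _ _ _ (2 * exp (u (z i)))).
    + intros t Ht. destruct (Hseg t Ht) as [-> [H1 H1']].
      destruct (uniform_step O u g M (z i) _ HM Hu H1) as [H2 [H3 H4]].
      split; [apply (proj2 (proj2 Hu)), H2|].
      apply Rle_trans with (exp (1 / 2) * exp (u (z i))).
      * rewrite <- exp_plus. apply exp_monotone. apply Rabs_le_between in H4. lra.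
      * apply Rmult_le_compat_r; [left; apply exp_pos|apply exp_half_le].
    + fold (edge z i). unfold elen. lra.
    + lra.
Qed.

Lemma vertex_in_ball i : (i <= N)%nat -> cd x0 (z i) (2 * sqrt B + 1).
Proof.
  intros Hi. eapply chain_weaken; [apply (vertex_dist i Hi 1); lra|].
  pose proof (psum_elen_le i Hi). lra.
Qed.

Lemma vertex_uniform i : (i <= N)%nat -> uniform_at O u g M (z i).
Proof. intros Hi. apply Hball, vertex_in_ball, Hi. Qed.

(* A discrete parallel transport: [exp (2 u)] is conformal, so its Levi-Civita connection
   is multiplication by the [(1,0)]-form [g dz]. *)
Fixpoint transport (i : nat) : C :=
  match i with
  | 0%nat => RtoC (exp (- u (z 0%nat)))
  | S j => (transport j * (1 - g (z j) * edge z j))%C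
  end.

Definition tnorm (i : nat) : R := exp (2 * u (z i)) * Cmod (transport i) ^ 2.

Lemma tnorm_ge0 i : 0 <= tnorm i.
Proof. apply Rmult_le_pos; [left; apply exp_pos|apply pow2_ge_0]. Qed.

(** First-order terms cancel. Conformality multiplies the norm by [exp (2 x)], the connection by
    [1 - 2 l + q], and [x - l] is of second order. With [k = M^2 |edge|^2], the product
    [(1 + 2 x) (1 - 2 x)] loses at most [4 x^2 <= 16 k], and the error [e], at most [3 k] in size,
    enters with a factor at most 3: hence [25 = 16 + 9]. *)
Lemma tnorm_step i : (i < N)%nat ->
  (1 - 25 * M ^ 2 * Cmod (edge z i) ^ 2) * tnorm i <= tnorm (S i) <=
  (1 + 25 * M ^ 2 * Cmod (edge z i) ^ 2) * tnorm i.
Proof.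
  intros Hi. pose proof (vertex_uniform i ltac:(lia)) as Hu.
  pose proof (edge_small i Hi (proj1 Hu)) as Hsm.
  destruct (uniform_step O u g M (z i) _ HM Hu Hsm) as [H2 [H3 H4]].
  destruct Hu as [_ [Hg Hu]]. destruct (Hu _ H2) as [_ H5].
  assert (Ez : (z i + edge z i)%C = z (S i)) by (unfold edge; ring). rewrite Ez in H4, H5.
  set (m := Cmod (edge z i)) in *. assert (Hm : 0 <= m) by apply Cmod_ge_0.
  set (x := u (z (S i)) - u (z i)) in *. set (l := fst (g (z i) * edge z i)%C) in *.
  set (q := Cmod (g (z i) * edge z i)%C ^ 2).
  assert (Hq : 0 <= q <= M ^ 2 * m ^ 2).
  { unfold q. rewrite Cmod_mult. fold m. pose proof (Cmod_ge_0 (g (z i))).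
    rewrite <- Rpow_mult_distr. split; [apply pow2_ge_0|]. apply pow_incr. nra. }
  assert (E1 : Cmod (1 - g (z i) * edge z i)%C ^ 2 = 1 - 2 * l + q).
  { unfold l, q. rewrite !Cmod_sqr. destruct (g (z i) * edge z i)%C as [a b].
    simpl. ring. }
  assert (E2 : tnorm (S i) = tnorm i * (exp (2 * x) * (1 - 2 * l + q))).
  { unfold tnorm. simpl transport. rewrite Cmod_mult, Rpow_mult_distr, E1.
    replace (2 * u (z (S i))) with (2 * u (z i) + 2 * x) by (unfold x; ring).
    rewrite exp_plus. ring. }
  pose proof (tnorm_ge0 i) as Ht.
  apply Rabs_le_between in H4, H5.
  set (e := 2 * (x - l) + q).
  assert (Hmm : m ^ 2 * M <= M ^ 2 * m ^ 2) by (assert (0 <= m ^ 2 * M) by (apply Rmult_le_pos; nra); nra).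
  assert (He : - (3 * (M ^ 2 * m ^ 2)) <= e <= 3 * (M ^ 2 * m ^ 2)).
  { unfold e. lra. }
  assert (Hx2 : x ^ 2 <= 4 * (M ^ 2 * m ^ 2)) by nra.
  assert (X1 : 1 + 2 * x <= exp (2 * x)).
  { destruct (Req_dec x 0) as [->|Hx]; [rewrite Rmult_0_r, exp_0; lra|].
    left. apply exp_ineq1. lra. }
  assert (X2 : (1 - 2 * x) * exp (2 * x) <= 1).
  { assert (1 - 2 * x <= exp (- (2 * x))).
    { destruct (Req_dec x 0) as [->|Hx]; [rewrite Rmult_0_r, Ropp_0, exp_0; lra|].
      left. pose proof (exp_ineq1 (- (2 * x))). lra. }
    apply Rle_trans with (exp (- (2 * x)) * exp (2 * x)).
    - apply Rmult_le_compat_r; [left; apply exp_pos|exact H].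
    - rewrite <- exp_plus, Rplus_opp_l, exp_0. lra. }
  assert (X3 : exp (2 * x) <= 3).
  { apply Rle_trans with (exp 1); [|apply exp_le_3]. apply exp_monotone. lra. }
  pose proof (exp_pos (2 * x)) as X4.
  set (y := exp (2 * x)) in *. set (k := M ^ 2 * m ^ 2) in *.
  assert (Hk : 0 <= k) by lra.
  assert (E3 : 1 - 2 * l + q = (1 - 2 * x) + e) by (unfold e; ring).
  rewrite E2, E3.
  replace (25 * M ^ 2 * m ^ 2) with (25 * k) by (unfold k; ring).
  assert (Y1 : - (9 * k) <= y * e <= 9 * k) by nra.
  assert (Y2 : 1 - 16 * k <= y * (1 - 2 * x)) by nra.
  nra.
Qed.

(** This is what a large [N] buys: the sum of the squared edges is at most a constant times the
    energy over [N], so transport errors do not accumulate. The 50 in the hypothesis on [N] is twice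
    the 25 of [tnorm_step]. *)
Lemma psum_edge_le i : (i <= N)%nat -> psum (fun j => 25 * M ^ 2 * Cmod (edge z j) ^ 2) i <= 1 / 2.
Proof.
  intros Hi.
  apply Rle_trans with (psum (fun j => 25 * M ^ 2 * exp M ^ 2 * elen u z j ^ 2) i).
  - apply psum_le. intros j Hj. rewrite !Rmult_assoc. apply Rmult_le_compat_l; [lra|].
    apply Rmult_le_compat_l; [apply pow2_ge_0|].
    apply edge_sqr_le. apply vertex_uniform. lia.
  - rewrite psum_scal.
    apply Rle_trans with (25 * M ^ 2 * / (50 * M ^ 2)); [|right; field; lra].
    rewrite Rmult_assoc. apply Rmult_le_compat_l; [nra|]. apply psum_sqr_le, Hi.
Qed.

Lemma tnorm_bounds i : (i <= N)%nat -> 1 / 2 <= tnorm i <= 2.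
Proof.
  intros Hi. set (a := fun j => 25 * M ^ 2 * Cmod (edge z j) ^ 2).
  assert (Ha : forall j, 0 <= a j).
  { intros j. apply Rmult_le_pos; [nra|apply pow2_ge_0]. }
  (* The norm starts at 1 and is multiplied by factors between [1 - a j] and [1 + a j]. Both bounds
     are put in terms of [1 - psum a i], a form that passes through the induction without infinite
     products or exponentials. *)
  assert (H : 1 - psum a i <= tnorm i /\ tnorm i * (1 - psum a i) <= 1).
  { induction i as [|i IH].
    - simpl. unfold tnorm. simpl. rewrite Cmod_R, Rabs_right by (left; apply exp_pos).
      rewrite Rmult_1_r, <- !exp_plus.
      replace (2 * u (z 0%nat) + (- u (z 0%nat) + - u (z 0%nat))) with 0 by ring.
      rewrite exp_0. lra.
    - specialize (IH ltac:(lia)). pose proof (tnorm_step i Hi) as Hs. fold (a i) in Hs.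
      pose proof (psum_edge_le (S i) Hi) as Hp. fold a in Hp. simpl psum in *.
      pose proof (psum_ge0 a i Ha) as Hp0. specialize (Ha i). pose proof (tnorm_ge0 i) as Ht.
      set (S0 := psum a i) in *. set (b := tnorm i) in *. set (b' := tnorm (S i)) in *.
      destruct IH as [IH1 IH2]. split.
      + assert (0 <= S0 * a i) by (apply Rmult_le_pos; lra). nra.
      + apply Rle_trans with ((1 + a i) * b * (1 - (S0 + a i))).
        * apply Rmult_le_compat_r; lra.
        * replace ((1 + a i) * b * (1 - (S0 + a i))) with
            (b * (1 - S0) - b * (a i * (S0 + a i))) by ring.
          assert (0 <= b * (a i * (S0 + a i))); [|lra].
          apply Rmult_le_pos; [lra|]. apply Rmult_le_pos; lra. }
  pose proof (psum_edge_le i Hi) as Hp. fold a in Hp. pose proof (tnorm_ge0 i). nra.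
Qed.

End ShortChains.

(** The start is held and the end moves by [s] times the transported vector. In complex dimension
    one a single complex parameter sweeps all directions at the end, so the Laplacian in [s] is a
    multiple of the Laplacian there. *)
Definition vary (u : C -> R) (g : C -> C) (N : nat) (z : nat -> C) (s : C) (i : nat) : C :=
  (z i + s * (RtoC (INR i / INR N) * transport u g z i))%C.

Lemma vary_0 u g N z i : vary u g N z 0%C i = z i.
Proof. unfold vary. ring. Qed.

Lemma jet_exp_dilate u (z p g : C) L : cjet (fun s => u (z + s)%C) g L ->
  cjet (fun s => exp (2 * u (z + s * p)%C)) (RtoC (2 * exp (2 * u z)) * (g * p))%C
    (exp (2 * u z) * (2 * L * Cmod p ^ 2 + 4 * Cmod (g * p)%C ^ 2)).
Proof.
  intros H.
  pose proof (cjet_affine _ _ _ 0 2 (cjet_dilate _ _ _ p H)) as H1.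
  pose proof (cjet_comp _ _ _ exp _ _ H1 (rjet_exp _)) as H2. cbv beta in H2.
  replace (0 + 2 * u (z + 0 * p)%C) with (2 * u z) in H2
    by (replace (z + 0 * p)%C with z by ring; ring).
  eapply cjet_eq.
  - eapply cjet_ext; [|exact H2]. intros s. cbv beta. f_equal. ring.
  - rewrite RtoC_mult. ring.
  - rewrite Cmod_mult, Cmod_R, (Rabs_right 2) by lra. ring.
Qed.

(** A discrete second variation formula, exact for every edge: [p2 - p1 + g * p1 * (z2 - z1)] is the
    covariant difference of the displacement along the edge, and the term in [L] is the curvature
    term. The square of the covariant difference absorbs every first derivative of [u]. *)
Lemma energy_term_jet u (z1 z2 p1 p2 g : C) L : cjet (fun s => u (z1 + s)%C) g L ->
  cjet (fun s => exp (2 * u (z1 + s * p1)%C) * Cmod ((z2 + s * p2) - (z1 + s * p1))%C ^ 2)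
    (RtoC (2 * exp (2 * u z1)) * Cconj (z2 - z1) * (p2 - p1 + g * p1 * (z2 - z1)))%C
    (2 * exp (2 * u z1) * (L * Cmod p1 ^ 2 * Cmod (z2 - z1)%C ^ 2
       + 2 * Cmod (p2 - p1 + g * p1 * (z2 - z1))%C ^ 2)).
Proof.
  intros H.
  pose proof (cjet_mult _ _ _ _ _ _ (jet_exp_dilate u z1 p1 g L H)
    (cjet_normsq (z2 - z1)%C (p2 - p1)%C)) as H1. cbv beta in H1.
  replace (z1 + 0 * p1)%C with z1 in H1 by ring.
  replace (z2 - z1 + 0 * (p2 - p1))%C with (z2 - z1)%C in H1 by ring.
  eapply cjet_eq.
  - eapply cjet_ext; [|exact H1]. intros s. cbv beta. f_equal. f_equal. f_equal. ring.
  - set (e := exp (2 * u z1)). rewrite !Cmod_sqr. destruct z1, z2, p1, p2, g.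
    unfold Cplus, Cminus, Cmult, Cconj, Copp, Cplus, RtoC. simpl. f_equal; ring.
  - set (e := exp (2 * u z1)). rewrite !Cmod_sqr. destruct z1, z2, p1, p2, g.
    unfold Cplus, Cminus, Cmult, Cconj, Copp, Cplus, RtoC. simpl. ring.
Qed.

Lemma transport_S u g z i :
  transport u g z (S i) = (transport u g z i * (1 - g (z i) * edge z i))%C.
Proof. reflexivity. Qed.

(* The factor [i / N] in [vary] makes [p2 - p1 + g p1 (z2 - z1)] collapse to a single
   transported vector over [N]. *)
Lemma energy_jet u g (L : C -> R) N z : (0 < N)%nat ->
  (forall i, (i < N)%nat -> cjet (fun s => u (z i + s)%C) (g (z i)) (L (z i))
     /\ L (z i) <= exp (2 * u (z i)) /\ tnorm u g z i <= 2
     /\ Cmod (g (z i) * edge z i)%C <= 1) ->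
  exists G l, cjet (fun s => energy u N (vary u g N z s)) G l /\
    l <= 32 * (1 + energy u N z) /\ Cmod G ^ 2 <= 36 * energy u N z.
Proof.
  intros HN H. assert (HNR : 0 < INR N) by (apply lt_0_INR; exact HN).
  set (P := transport u g z). set (p := fun i => (RtoC (INR i / INR N) * P i)%C).
  set (G := fun i => (RtoC (2 * exp (2 * u (z i))) * Cconj (edge z i) * (P (S i) / RtoC (INR N)))%C).
  set (l := fun i => 2 * exp (2 * u (z i)) * (L (z i) * Cmod (p i) ^ 2 * Cmod (edge z i) ^ 2
       + 2 * Cmod (P (S i) / RtoC (INR N))%C ^ 2)).
  assert (HNC : RtoC (INR N) <> 0%C) by (intros E; apply RtoC_inj in E; lra).
  assert (Hj : forall i, (i < N)%nat -> cjet (fun s => exp (2 * u (vary u g N z s i)) *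
      Cmod (edge (vary u g N z s) i) ^ 2) (G i) (l i)).
  { intros i Hi. destruct (H i Hi) as [Hc _].
    pose proof (energy_term_jet u (z i) (z (S i)) (p i) (p (S i)) _ _ Hc) as Hj.
    assert (E : (p (S i) - p i + g (z i) * p i * (z (S i) - z i))%C = (P (S i) / RtoC (INR N))%C).
    { unfold p. replace (P (S i)) with (P i * (1 - g (z i) * edge z i))%C by reflexivity.
      rewrite S_INR. unfold edge, Rdiv. rewrite !RtoC_mult, RtoC_plus, RtoC_inv by lra.
      field. exact HNC. }
    rewrite E in Hj. exact Hj. }
  (* The next transported vector is measured at the present vertex: a factor of modulus at most 2,
     on top of [tnorm <= 2]. From 8 come [32 = 4 * 8] in the Laplacian and, as its root is at most
     3, [6 = 2 * 3] in the gradient. *)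
  assert (HP : forall i, (i < N)%nat -> exp (2 * u (z i)) * Cmod (P (S i)) ^ 2 <= 8).
  { intros i Hi. destruct (H i Hi) as [_ [_ [Ht Hg]]]. unfold P. rewrite transport_S, Cmod_mult.
    assert (H1 : Cmod (1 - g (z i) * edge z i)%C <= 2).
    { eapply Rle_trans; [apply Cmod_triangle|]. rewrite Cmod_1, Cmod_opp. lra. }
    unfold tnorm in Ht. rewrite Rpow_mult_distr, <- Rmult_assoc.
    pose proof (tnorm_ge0 u g z i) as Ht0. unfold tnorm in Ht0.
    pose proof (Cmod_ge_0 (1 - g (z i) * edge z i)%C).
    apply Rle_trans with (2 * 2 ^ 2); [|lra].
    apply Rmult_le_compat; [exact Ht0|apply pow2_ge_0|exact Ht|]. apply pow_incr. lra. }
  destruct (cjet_psum N _ G l Hj) as [G0 [HG1 HG2]].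
  exists (RtoC (INR N) * G0)%C, (INR N * psum l N). split; [|split].
  - unfold energy. eapply cjet_ext; [|exact (cjet_affine _ _ _ 0 (INR N) HG1)].
    intros s. cbv beta. ring.
  - rewrite energy_elen.
    apply Rle_trans with (INR N * psum (fun i => 4 * elen u z i ^ 2 + 32 / INR N ^ 2) N).
    + apply Rmult_le_compat_l; [lra|]. apply psum_le. intros i Hi.
      destruct (H i Hi) as [_ [HL [Ht _]]]. specialize (HP i Hi).
      unfold l, elen. rewrite Rpow_mult_distr, <- exp_double.
      rewrite Cmod_div by exact HNC. rewrite Cmod_R, (Rabs_right (INR N)) by lra.
      set (e := exp (2 * u (z i))) in *. set (D := Cmod (edge z i) ^ 2).
      assert (He : 0 < e) by apply exp_pos. assert (HD : 0 <= D) by apply pow2_ge_0.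
      assert (Hp : e * Cmod (p i) ^ 2 <= 2).
      { unfold p. rewrite Cmod_Rmult. fold e in Ht.
        assert (Hf : 0 <= INR i / INR N <= 1).
        { assert (INR i < INR N) by (apply lt_INR; exact Hi). pose proof (pos_INR i). split.
          - apply Rmult_le_pos; [lra|]. left. apply Rinv_0_lt_compat. lra.
          - apply Rle_div_l; lra. }
        rewrite Rabs_right by lra. rewrite Rpow_mult_distr.
        unfold tnorm in Ht. fold e P in Ht.
        pose proof (pow2_ge_0 (Cmod (P i))). set (q := Cmod (P i) ^ 2) in *.
        assert ((INR i / INR N) ^ 2 <= 1) by nra.
        assert (0 <= e * q) by (apply Rmult_le_pos; lra). nra. }
      assert (H1 : 2 * e * (L (z i) * Cmod (p i) ^ 2 * D) <= 4 * (e * D)).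
      { pose proof (pow2_ge_0 (Cmod (p i))). set (q := Cmod (p i) ^ 2) in *.
        assert (HeD : 0 <= e * D) by (apply Rmult_le_pos; lra).
        assert (H2 : L (z i) * q <= 2) by nra.
        nra. }
      assert (H2 : 2 * e * (2 * (Cmod (P (S i)) / INR N) ^ 2) <= 32 / INR N ^ 2).
      { replace (2 * e * (2 * (Cmod (P (S i)) / INR N) ^ 2)) with
          (4 * (e * Cmod (P (S i)) ^ 2) / INR N ^ 2) by (field; lra).
        apply Rmult_le_compat_r; [left; apply Rinv_0_lt_compat, pow_lt; lra|]. lra. }
      lra.
    + rewrite psum_affine. pose proof (energy_ge0 u N z) as H0. rewrite energy_elen in H0.
      set (S0 := psum (fun i => elen u z i ^ 2) N) in *.
      replace (INR N * (4 * S0 + INR N * (32 / INR N ^ 2))) with (4 * (INR N * S0) + 32)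
        by (field; lra). lra.
  - apply Rle_trans with ((6 * psum (elen u z) N) ^ 2).
    + apply pow_incr. split; [apply Cmod_ge_0|].
      rewrite Cmod_Rmult, Rabs_right by lra.
      apply Rle_trans with (INR N * psum (fun i => 6 / INR N * elen u z i) N).
      * apply Rmult_le_compat_l; [lra|]. apply Rle_trans with (1 := HG2). apply psum_le.
        intros i Hi. specialize (HP i Hi). unfold G, elen.
        rewrite !Cmod_mult, Cmod_conj, Cmod_div by exact HNC.
        rewrite !Cmod_R, (Rabs_right (INR N)) by lra.
        rewrite Rabs_right by (left; apply Rmult_lt_0_compat; [lra|apply exp_pos]).
        rewrite exp_double in HP |- *. set (e := exp (u (z i))) in *.
        assert (He : 0 < e) by apply exp_pos.
        pose proof (Cmod_ge_0 (P (S i))). pose proof (Cmod_ge_0 (edge z i)).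
        assert (e * Cmod (P (S i)) <= 3) by nra.
        replace (2 * e ^ 2 * Cmod (edge z i) * (Cmod (P (S i)) / INR N)) with
          (2 * (e * Cmod (P (S i))) * (e * Cmod (edge z i)) / INR N) by (field; lra).
        replace (6 / INR N * (e * Cmod (edge z i))) with
          (2 * 3 * (e * Cmod (edge z i)) / INR N) by (field; lra).
        apply Rmult_le_compat_r; [left; apply Rinv_0_lt_compat; lra|].
        apply Rmult_le_compat_r; [apply Rmult_le_pos; lra|]. lra.
      * rewrite psum_scal. right. field. lra.
    + rewrite Rpow_mult_distr. pose proof (length_energy u N z). lra.
Qed.

(** * The comparison principle *)

Lemma Un_cv_le (U : nat -> R) l c : Un_cv U l -> (forall n, U n <= c) -> l <= c.
Proof. intros HU Hc. apply (@Rle_cv_lim U (fun _ => c) l c); [exact Hc|exact HU|apply Un_cv_const]. Qed.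

Lemma Un_cv_ge (U : nat -> R) l c : Un_cv U l -> (forall n, c <= U n) -> c <= l.
Proof. intros HU Hc. apply (@Rle_cv_lim (fun _ => c) U c l); [exact Hc|apply Un_cv_const|exact HU]. Qed.

Lemma ccv_Cmod (Z : nat -> C) l : ccv Z l -> Un_cv (fun n => Cmod (Z n)) (Cmod l).
Proof.
  intros HZ eps He. destruct (HZ eps He) as [N HN]. exists N. intros n Hn.
  specialize (HN n ltac:(lia)). unfold Rdist.
  pose proof (Cmod_triangle (Z n - l)%C l) as H1. pose proof (Cmod_triangle (l - Z n)%C (Z n)) as H2.
  replace (Z n - l + l)%C with (Z n) in H1 by ring. replace (l - Z n + Z n)%C with l in H2 by ring.
  rewrite (Cmod_sym l) in H2. apply Rabs_def1; lra.
Qed.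

Lemma ccv_minus (Z W : nat -> C) l m : ccv Z l -> ccv W m -> ccv (fun n => Z n - W n)%C (l - m)%C.
Proof.
  intros HZ HW eps He. destruct (HZ (eps / 2) ltac:(lra)) as [N1 H1].
  destruct (HW (eps / 2) ltac:(lra)) as [N2 H2]. exists (max N1 N2). intros n Hn.
  specialize (H1 n ltac:(lia)). specialize (H2 n ltac:(lia)).
  replace (Z n - W n - (l - m))%C with ((Z n - l) + (m - W n))%C by ring.
  eapply Rle_lt_trans; [apply Cmod_triangle|]. rewrite (Cmod_sym m). lra.
Qed.

Lemma continuity_pt_ln x : 0 < x -> continuity_pt ln x.
Proof. intros Hx. apply derivable_continuous_pt. exists (/ x). apply derivable_pt_lim_ln, Hx. Qed.

Lemma energy_cv u N (Z : nat -> nat -> C) (l : nat -> C) :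
  (forall i, (i < S N)%nat -> ccv (fun n => Z n i) (l i)) ->
  (forall i, (i < S N)%nat -> ccont u (l i)) ->
  Un_cv (fun n => energy u N (Z n)) (energy u N l).
Proof.
  intros HZ Hu. unfold energy. apply CV_mult; [apply Un_cv_const|].
  apply (psum_cv (fun n i => exp (2 * u (Z n i)) * Cmod (edge (Z n) i) ^ 2)). intros i Hi.
  apply CV_mult.
  - apply (continuity_seq exp (fun n => 2 * u (Z n i))); [apply continuity_pt_exp|].
    apply CV_mult; [apply Un_cv_const|]. apply (ccont_cv u (l i) (fun n => Z n i)); [apply Hu|apply HZ]; lia.
  - assert (H : Un_cv (fun n => Cmod (edge (Z n) i)) (Cmod (edge l i))).
    { apply ccv_Cmod. apply (ccv_minus (fun n => Z n (S i)) (fun n => Z n i)); apply HZ; lia. }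
    simpl. apply CV_mult; [exact H|]. apply CV_mult; [exact H|apply Un_cv_const].
Qed.

(* The variation only gives [Lap E <= C (1 + E)] and [|grad E|^2 <= C E], but then [ln (1 + E)]
   has bounded gradient and Laplacian, which is what a barrier needs. *)
Definition penalty (u : C -> R) (T : R) (N : nat) (z : nat -> C) : R := T - ln (1 + energy u N z).

Lemma penalty_pos u T N z : 1 + energy u N z < exp T -> 0 < penalty u T N z.
Proof.
  intros H. pose proof (energy_ge0 u N z). unfold penalty.
  assert (ln (1 + energy u N z) < ln (exp T)) by (apply ln_increasing; lra).
  rewrite ln_exp in H1. lra.
Qed.

Lemma penalty_le u T N z : penalty u T N z <= T.
Proof.
  pose proof (energy_ge0 u N z). unfold penalty.
  assert (0 <= ln (1 + energy u N z)); [|lra].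
  rewrite <- ln_1. apply ln_le; lra.
Qed.

(** With [X] the penalty, [ln X] has Laplacian [Lap X / X - |grad X|^2 / X^2]. Here [Lap X >= -32],
    the squared gradient of [E] entering [- ln (1 + E)] with the favourable sign, and
    [|grad X|^2 <= 36 E / (1 + E)^2 <= 36]. *)
Lemma penalty_jet u T N (z : C -> nat -> C) G l E : E = energy u N (z 0%C) -> 1 + E < exp T ->
  cjet (fun s => energy u N (z s)) G l -> l <= 32 * (1 + E) -> Cmod G ^ 2 <= 36 * E ->
  exists G' l', cjet (fun s => ln (penalty u T N (z s))) G' l' /\
    - (32 / penalty u T N (z 0%C) + 36 / penalty u T N (z 0%C) ^ 2) <= l'.
Proof.
  intros HE HR Hj Hl HG.
  assert (HE0 : 0 <= E) by (rewrite HE; apply energy_ge0).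
  rewrite HE in HR. pose proof (penalty_pos u T N (z 0%C) HR) as HX. rewrite <- HE in HR.
  set (X := penalty u T N (z 0%C)) in *.
  pose proof (cjet_affine _ _ _ 1 1 Hj) as H1.
  pose proof (cjet_comp _ _ _ ln _ _ H1 (rjet_ln (1 + 1 * energy u N (z 0%C)) ltac:(lra))) as H2.
  pose proof (cjet_affine _ _ _ T (-1) H2) as H3.
  assert (EX : T + -1 * ln (1 + 1 * energy u N (z 0%C)) = X).
  { unfold X, penalty. rewrite Rmult_1_l. ring. }
  assert (Hpos : 0 < T + -1 * ln (1 + 1 * energy u N (z 0%C))) by (rewrite EX; exact HX).
  pose proof (cjet_comp _ _ _ ln _ _ H3 (rjet_ln _ Hpos)) as H4.
  rewrite EX, <- HE in H4. rewrite !Cmod_Rmult in H4.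
  eexists. eexists. split.
  - eapply cjet_ext; [|exact H4]. intros s. cbv beta. unfold penalty. f_equal. rewrite Rmult_1_l. ring.
  - clear H1 H2 H3 H4.
    rewrite (Rabs_right 1), Rmult_1_l, (Rabs_left (-1)) by lra.
    rewrite (Rabs_right (/ (1 + E))) by (left; apply Rinv_0_lt_compat; lra).
    rewrite !Rmult_1_l.
    match goal with |- _ <= ?y => replace y with
      (- ((l / (1 + E) - Cmod G ^ 2 / (1 + E) ^ 2) / X + Cmod G ^ 2 / (1 + E) ^ 2 / X ^ 2))
      by (field; lra) end.
    assert (B1 : l / (1 + E) <= 32) by (apply Rle_div_l; lra).
    assert (B2 : 0 <= Cmod G ^ 2 / (1 + E) ^ 2 <= 36).
    { pose proof (pow2_ge_0 (Cmod G)) as H0. split.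
      - apply Rmult_le_pos; [exact H0|]. left. apply Rinv_0_lt_compat, pow_lt. lra.
      - apply Rle_div_l; [apply pow_lt; lra|]. nra. }
    apply Ropp_le_contravar, Rplus_le_compat.
    + apply Rmult_le_compat_r; [left; apply Rinv_0_lt_compat; lra|lra].
    + apply Rmult_le_compat_r; [left; apply Rinv_0_lt_compat, pow_lt; lra|lra].
Qed.

Section AhlforsYau.
Variables (O : C -> Prop) (u v : C -> R) (gu gv : C -> C) (Lu Lv : C -> R).
Hypothesis Oopen : is_open O.
Hypothesis Hu : jet_on O u gu Lu.
Hypothesis Hv : jet_on O v gv Lv.
Hypothesis HLu : forall z, O z -> Lu z <= exp (2 * u z).
Hypothesis HLv : forall z, O z -> exp (2 * v z) <= Lv z.
Hypothesis Hcomp : chain_complete O (fun z => exp (u z)).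
Notation cd := (chain_dist O (fun z => exp (u z))).

(** The logarithm of the penalty tends to minus infinity as [1 + energy] approaches [exp T]; this
    keeps a maximiser strictly inside the admissible region, where it can be varied freely. *)
Definition objective (T : R) (N : nat) (z : nat -> C) : R :=
  v (z N) - u (z N) + ln (penalty u T N z).

Lemma ccont_diff z : O z -> ccont (fun z => v z - u z) z.
Proof.
  intros Hz. apply (ccont_ext (fun z => 1 * v z + -1 * u z)); [intros p; ring|].
  apply ccont_lin; eapply jet_on_cont; eassumption.
Qed.

Lemma ball_compact x0 T : O x0 -> rel_compact O (fun z => cd x0 z (2 * sqrt (exp T) + 1)).
Proof.
  intros Hx0. apply chain_ball_compact; auto using exp_pos.
  - intros z Hz. apply ccont_exp. apply (jet_on_cont _ _ _ _ z Hu Hz).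
  - pose proof (sqrt_pos (exp T)). lra.
Qed.

Lemma objective_max x0 T M N : O x0 -> 0 < T -> 1 <= M ->
  exp M ^ 2 * exp T <= INR N * / (50 * M ^ 2) ->
  (forall z, cd x0 z (2 * sqrt (exp T) + 1) -> uniform_at O u gu M z) ->
  exists z : nat -> C, z 0%nat = x0 /\ 1 + energy u N z < exp T /\
    v x0 - u x0 + ln T <= objective T N z /\
    forall z', z' 0%nat = x0 -> 1 + energy u N z' < exp T -> objective T N z' <= objective T N z.
Proof.
  intros Hx0 HR HM HN Hball.
  set (c := v x0 - u x0 + ln T).
  (* Only competitors at least as good as the constant polygon are kept. This closes the set under
     limits in spite of the strict bound on the energy. *)
  set (A := fun z : nat -> C => z 0%nat = x0 /\ 1 + energy u N z < exp T /\ c <= objective T N z).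
  set (K := fun z => cd x0 z (2 * sqrt (exp T) + 1)).
  assert (HK : rel_compact O K) by (apply ball_compact, Hx0).
  assert (HAK : forall z i, z 0%nat = x0 -> 1 + energy u N z < exp T -> (i <= N)%nat -> K (z i)).
  { intros z i H0 HE Hi.
    apply (vertex_in_ball O u gu x0 M (exp T) N Hx0 HM (exp_pos T) HN Hball z H0 ltac:(lra) i Hi). }
  destruct (rel_compact_room O K Oopen HK) as [d [Hd Hroom]].
  destruct (rel_compact_cont_bound O K _ HK ccont_diff) as [W [_ HW]].
  destruct (rel_compact_bounded O K Cmod HK) as [Q HQ].
  { intros z Hz. exists 1, (Cmod z + 1). split; [lra|]. intros w Hw.
    pose proof (Cmod_triangle (w - z)%C z) as H. replace (w - z + z)%C with w in H by ring. lra. }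
  destruct (max_attained (nat -> C) A (objective T N)) as [z [Hz1 Hz2]].
  (* The constant polygon has energy 0 and penalty [T], and its objective is exactly [c]. *)
  - exists (fun _ => x0).
    assert (E0 : energy u N (fun _ => x0) = 0).
    { rewrite energy_elen. rewrite <- (Rmult_0_r (INR N)). f_equal.
      apply Rle_antisym; [|apply psum_ge0; intros; apply pow2_ge_0].
      rewrite <- (Rmult_0_l (psum (fun i => elen u (fun _ => x0) i ^ 2) N)), <- psum_scal.
      apply psum_le. intros i _. unfold elen, edge.
      rewrite Cmod_diag. right. ring. }
    split; [reflexivity|]. split.
    + rewrite E0, Rplus_0_r, <- exp_0. apply exp_increasing, HR.
    + unfold objective, penalty. rewrite E0, Rplus_0_r, ln_1, Rminus_0_r. unfold c. lra.
  - intros X HX.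
    destruct (bounded_chain_subseq (S N) X Q) as [p [l [Hp Hl]]].
    { intros n j Hj. apply HQ. apply HAK; [apply HX|apply HX|lia]. }
    exists p, l.
    assert (HlO : forall i, (i < S N)%nat -> O (l i)).
    { intros i Hi. destruct (Hl i Hi d Hd) as [n Hn]. specialize (Hn n (le_n _)).
      rewrite Cmod_sym in Hn. apply (Hroom (X (p n) i)); [|exact Hn].
      apply HAK; [apply HX|apply HX|lia]. }
    assert (Hl0 : l 0%nat = x0).
    { apply Cmod_le_0_eq, (ccv_Cmod_le (fun n => X (p n) 0%nat)); [apply Hl; lia|].
      intros n. rewrite (proj1 (HX (p n))). rewrite Cmod_diag. lra. }
    assert (HEcv : Un_cv (fun n => energy u N (X (p n))) (energy u N l)).
    { apply (energy_cv u N (fun n => X (p n))); [exact Hl|].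
      intros i Hi. apply (jet_on_cont _ _ _ _ _ Hu (HlO i Hi)). }
    (* An objective at least [c], with [v - u <= W] on the ball, forces the penalty to be at least
       [exp (c - W)]. This survives the limit and keeps the energy away from the forbidden value. *)
    assert (HEl : 1 + energy u N l < exp T).
    { apply Rle_lt_trans with (exp (T - exp (c - W))).
      - assert (energy u N l <= exp (T - exp (c - W)) - 1); [|lra].
        apply (Un_cv_le _ _ _ HEcv). intros n. destruct (HX (p n)) as [H0 [H1 H2]].
        pose proof (penalty_pos u T N _ H1) as Hpp.
        pose proof (HW _ (HAK _ N H0 H1 (le_n _))) as H3. apply Rabs_le_between in H3.
        unfold objective in H2.
        assert (H4 : exp (c - W) <= penalty u T N (X (p n))).
        { rewrite <- (exp_ln _ Hpp). apply exp_monotone. lra. }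
        unfold penalty in H4.
        assert (1 + energy u N (X (p n)) <= exp (T - exp (c - W))); [|lra].
        pose proof (energy_ge0 u N (X (p n))).
        rewrite <- (exp_ln (1 + energy u N (X (p n)))) by lra. apply exp_monotone. lra.
      - apply exp_increasing. pose proof (exp_pos (c - W)). lra. }
    assert (Hobj : Un_cv (fun n => objective T N (X (p n))) (objective T N l)).
    { unfold objective. apply CV_plus.
      - apply (ccont_cv (fun z => v z - u z) (l N) (fun n => X (p n) N)).
        + apply ccont_diff, HlO. lia.
        + apply Hl. lia.
      - apply (continuity_seq ln (fun n => penalty u T N (X (p n)))).
        + apply continuity_pt_ln, penalty_pos, HEl.
        + unfold penalty. apply CV_minus; [apply Un_cv_const|].
          apply (continuity_seq ln (fun n => 1 + energy u N (X (p n)))).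
          * apply continuity_pt_ln. pose proof (energy_ge0 u N l). lra.
          * apply CV_plus; [apply Un_cv_const|exact HEcv]. }
    repeat (split; try assumption). apply (Un_cv_ge _ _ _ Hobj). intros n. apply HX.
  - destruct Hz1 as [H0 [H1 H2]]. exists z. repeat (split; [assumption|]). intros z' H0' H1'.
    destruct (Rle_lt_dec c (objective T N z')) as [H|H]; [|lra].
    apply Hz2. repeat split; assumption.
Qed.

(** At a maximum the Laplacian in [s] is nonpositive. The end point moves by [s * P] and contributes
    [(Lv - Lu) |P|^2], at least [tnorm * (exp (2 (v - u)) - 1)] with [tnorm >= 1/2]; the penalty
    contributes at least minus the right-hand side. *)
Lemma objective_max_ineq x0 T M N z : O x0 -> 1 <= M -> (0 < N)%nat ->
  exp M ^ 2 * exp T <= INR N * / (50 * M ^ 2) ->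
  (forall z, cd x0 z (2 * sqrt (exp T) + 1) -> uniform_at O u gu M z) ->
  z 0%nat = x0 -> 1 + energy u N z < exp T -> u (z N) <= v (z N) ->
  (forall z', z' 0%nat = x0 -> 1 + energy u N z' < exp T -> objective T N z' <= objective T N z) ->
  / 2 * (exp (2 * (v (z N) - u (z N))) - 1) <=
    32 / penalty u T N z + 36 / penalty u T N z ^ 2.
Proof.
  intros Hx0 HM HN0 HN Hball Hz0 HE Hpos Hmax.
  assert (HNR : 0 < INR N) by (apply lt_0_INR; exact HN0).
  assert (HE' : energy u N z <= exp T) by lra.
  assert (Hdom : forall i, (i <= N)%nat -> O (z i)).
  { intros i Hi. eapply (fun H => proj2 (chain_dom _ _ x0 (z i) (2 * sqrt (exp T) + 1) H)).
    apply (vertex_in_ball O u gu x0 M (exp T) N Hx0 HM (exp_pos T) HN Hball z Hz0 HE' i Hi). }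
  pose proof (tnorm_bounds O u gu x0 M (exp T) N Hx0 HM (exp_pos T) HN Hball z Hz0 HE') as Ht.
  destruct (energy_jet u gu Lu N z HN0) as [G [l [HG1 [HG2 HG3]]]].
  { intros i Hi. pose proof (Hdom i ltac:(lia)) as HO. split; [apply Hu, HO|].
    split; [apply HLu, HO|]. split; [apply Ht; lia|].
    pose proof (vertex_uniform O u gu x0 M (exp T) N Hx0 HM (exp_pos T) HN Hball z Hz0 HE' i
      ltac:(lia)) as Hun.
    pose proof (edge_small u M (exp T) N HM (exp_pos T) HN z HE' i Hi (proj1 Hun)) as Hsm.
    destruct (uniform_step O u gu M (z i) _ HM Hun Hsm) as [_ [H2 _]].
    rewrite Cmod_mult. destruct Hun as [_ [Hg _]]. pose proof (Cmod_ge_0 (edge z i)). nra. }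
  assert (V0 : vary u gu N z 0%C = z) by (apply functional_extensionality, vary_0).
  destruct (penalty_jet u T N (vary u gu N z) G l (energy u N z)) as [G' [l' [HG' Hl']]];
    try assumption; [rewrite V0; reflexivity|]. rewrite V0 in Hl'.
  set (P := transport u gu z N).
  assert (EP : forall s, vary u gu N z s N = (z N + s * P)%C).
  { intros s. unfold vary. fold P. unfold Rdiv. rewrite Rinv_r by lra. ring. }
  destruct (Hu (z N) (Hdom N (le_n _))) as [Ju _]. destruct (Hv (z N) (Hdom N (le_n _))) as [Jv _].
  pose proof (cjet_plus _ _ _ _ _ _ (cjet_plus _ _ _ _ _ _ (cjet_dilate _ _ _ P Jv)
    (cjet_affine _ _ _ 0 (-1) (cjet_dilate _ _ _ P Ju))) HG') as J.
  (* The energy is continuous in [s], so small variations remain admissible competitors. *)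
  pose proof (cjet_cont _ _ _ HG1 (exp T - (1 + energy u N z)) ltac:(lra)) as [d [Hd HEd]].
  eapply (cjet_ext _ (fun s => objective T N (vary u gu N z s))) in J.
  2: { intros s. unfold objective. rewrite EP. ring. }
  eapply cjet_local_max in J; [|exact Hd|].
  - specialize (HLu (z N) (Hdom N (le_n _))). specialize (HLv (z N) (Hdom N (le_n _))).
    destruct (Ht N (le_n _)) as [Ht1 _]. unfold tnorm in Ht1. fold P in Ht1.
    pose proof (pow2_ge_0 (Cmod P)) as HP. set (q := Cmod P ^ 2) in *.
    assert (He : exp (2 * v (z N)) = exp (2 * u (z N)) * exp (2 * (v (z N) - u (z N)))).
    { rewrite <- exp_plus. f_equal. ring. }
    assert (H1 : 1 <= exp (2 * (v (z N) - u (z N)))).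
    { rewrite <- exp_0. apply exp_monotone. lra. }
    set (e := exp (2 * (v (z N) - u (z N)))) in *.
    assert (/ 2 * (e - 1) <= (exp (2 * u (z N)) * q) * (e - 1)).
    { apply Rmult_le_compat_r; lra. }
    assert ((exp (2 * u (z N)) * q) * (e - 1) <= (Lv (z N) - Lu (z N)) * q).
    { replace (exp (2 * u (z N)) * q * (e - 1)) with ((exp (2 * u (z N)) * e - exp (2 * u (z N))) * q) by ring.
      apply Rmult_le_compat_r; lra. }
    lra.
  - intros s Hs. cbv beta.
    rewrite V0. apply Hmax.
    + unfold vary. simpl INR. unfold Rdiv. rewrite Rmult_0_l, Hz0. ring.
    + specialize (HEd s). replace (s - 0)%C with s in HEd by ring. specialize (HEd Hs).
      rewrite V0 in HEd. apply Rabs_def2 in HEd. lra.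
Qed.

Theorem ahlfors_yau : forall z, O z -> v z <= u z.
Proof.
  intros x0 Hx0. apply Rnot_lt_le. intros Hlt.
  set (c := v x0 - u x0). assert (Hc : 0 < c) by (unfold c; lra).
  assert (Hec : 1 < exp (2 * c)) by (rewrite <- exp_0; apply exp_increasing; lra).
  (* The inequality at the maximum will give [exp (2 c) T^2 <= T^2 + 64 T + 72], where
     [64 T + 72 <= 136 T] because [T >= 1]; this [T] violates it. Since [M] and [N] do not occur
     there, they may be chosen after [T]. *)
  set (T := 1 + 136 / (exp (2 * c) - 1)).
  assert (HR : 1 < T).
  { unfold T. assert (0 < 136 / (exp (2 * c) - 1)) by (apply Rdiv_lt_0_compat; lra). lra. }
  assert (HRc : 136 < (exp (2 * c) - 1) * T).
  { unfold T. rewrite Rmult_plus_distr_l.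
    replace ((exp (2 * c) - 1) * (136 / (exp (2 * c) - 1))) with 136 by (field; lra). lra. }
  pose proof (ball_compact x0 T Hx0) as HK.
  destruct (jet_on_uniform O _ u gu Lu Oopen Hu HK) as [M [HM Hball]].
  destruct (INR_unbounded (exp M ^ 2 * exp T * (50 * M ^ 2))) as [N HN].
  assert (HM2 : 0 < 50 * M ^ 2) by nra.
  assert (HN0 : (0 < N)%nat).
  { apply INR_lt. simpl. apply Rle_lt_trans with (2 := HN). left.
    apply Rmult_lt_0_compat; [apply Rmult_lt_0_compat|exact HM2]; [apply pow_lt, exp_pos|apply exp_pos]. }
  assert (HN' : exp M ^ 2 * exp T <= INR N * / (50 * M ^ 2)).
  { apply (proj1 (Rle_div_r _ _ _ HM2)). lra. }
  destruct (objective_max x0 T M N Hx0 ltac:(lra) HM HN' Hball) as [z [Hz0 [HE [Hobj Hmax]]]].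
  pose proof (penalty_pos u T N z HE) as HX. pose proof (penalty_le u T N z) as HXR.
  fold c in Hobj. unfold objective in Hobj.
  set (X := penalty u T N z) in *. set (w := v (z N) - u (z N)) in *.
  assert (Hw : exp c * T <= exp w * X).
  { rewrite <- (exp_ln T) by lra. rewrite <- (exp_ln X) by exact HX. rewrite <- !exp_plus.
    apply exp_monotone. lra. }
  assert (Hw0 : 0 <= w).
  { assert (ln X <= ln T) by (apply ln_le; lra). lra. }
  pose proof (objective_max_ineq x0 T M N z Hx0 HM HN0 HN' Hball Hz0 HE ltac:(unfold w in Hw0; lra) Hmax)
    as Hin.
  fold X w in Hin.
  assert (Hin2 : / 2 * (exp (2 * w) * X ^ 2 - X ^ 2) <= 32 * X + 36).
  { apply Rmult_le_compat_r with (r := X ^ 2) in Hin; [|apply pow2_ge_0].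
    replace ((32 / X + 36 / X ^ 2) * X ^ 2) with (32 * X + 36) in Hin by (field; lra). lra. }
  assert (Hsq : exp (2 * c) * T ^ 2 <= exp (2 * w) * X ^ 2).
  { rewrite !exp_double. rewrite <- !Rpow_mult_distr. apply pow_incr. split; [|exact Hw].
    apply Rmult_le_pos; [left; apply exp_pos|lra]. }
  assert (X ^ 2 <= T ^ 2) by (apply pow_incr; lra).
  assert ((exp (2 * c) - 1) * T * T <= 136 * T) by lra. nra.
Qed.

End AhlforsYau.

(** * Regularity of hyperbolic densities *)

Lemma cont2_ccont f z : cont2_at f z -> ccont (fun w => f (fst w) (snd w)) z.
Proof.
  intros H eps He. destruct (H eps He) as [d [Hd H']]. exists d. split; [exact Hd|].
  intros w Hw. apply H'. rewrite cdist_Cmod, Cmod_sym. exact Hw.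
Qed.

Lemma derive_le_right (f : R -> R) (t c r : R) : is_derive f t c -> 0 < r ->
  (forall s, 0 < s < r -> f (t + s) <= f t) -> c <= 0.
Proof.
  intros Hd Hr H. apply Rnot_lt_le. intros Hc. apply is_derive_Reals in Hd.
  destruct (Hd c Hc) as [d Hd']. pose proof (cond_pos d) as Hdp.
  set (s := Rmin d r / 2).
  assert (Hs : 0 < s /\ s < d /\ s < r) by (unfold s, Rmin; destruct Rle_dec; lra).
  specialize (H s ltac:(lra)). specialize (Hd' s ltac:(lra) ltac:(rewrite Rabs_right; lra)).
  apply Rabs_def2 in Hd'.
  assert (0 < (f (t + s) - f t) / s) by lra.
  assert (0 < (f (t + s) - f t) / s * s) by (apply Rmult_lt_0_compat; lra).
  replace ((f (t + s) - f t) / s * s) with (f (t + s) - f t) in H1 by (field; lra). lra.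
Qed.

Lemma second_derivative_min (f f1 : R -> R) (t c r : R) : 0 < r ->
  (forall s, Rabs (s - t) < r -> is_derive f s (f1 s)) -> is_derive f1 t c ->
  (forall s, Rabs (s - t) < r -> f t <= f s) -> 0 <= c.
Proof.
  intros Hr H1 H2 Hmin. apply Rnot_lt_le. intros Hc.
  assert (Htt : Rabs (t - t) < r) by (rewrite Rminus_diag, Rabs_R0; exact Hr).
  assert (H0 : f1 t = 0).
  { assert (pr : derivable_pt f t) by (exists (f1 t); apply is_derive_Reals, H1, Htt).
    rewrite <- (deriv_minimum f (t - r) (t + r) t pr ltac:(lra) ltac:(lra)).
    - symmetry. apply derive_pt_eq_0, is_derive_Reals, H1, Htt.
    - intros x Hx1 Hx2. apply Hmin, Rabs_def1; lra. }
  apply is_derive_Reals in H2. destruct (H2 (- c) ltac:(lra)) as [d Hd].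
  pose proof (cond_pos d) as Hdp.
  set (s := Rmin d r / 2).
  assert (Hs : 0 < s /\ s < d /\ s < r) by (unfold s, Rmin; destruct Rle_dec; lra).
  destruct (MVT_cor2 f f1 t (t + s)) as [x [Hx2 Hx1]]; [lra| |].
  - intros x Hx. apply is_derive_Reals, H1, Rabs_def1; lra.
  - specialize (Hmin (t + s) ltac:(apply Rabs_def1; lra)).
    specialize (Hd (x - t) ltac:(lra) ltac:(rewrite Rabs_right; lra)).
    replace (t + (x - t)) with x in Hd by ring. rewrite H0, Rminus_0_r in Hd.
    apply Rabs_def2 in Hd.
    assert (0 < - (f1 x / (x - t)) * (x - t)) by (apply Rmult_lt_0_compat; lra).
    replace (- (f1 x / (x - t)) * (x - t)) with (- f1 x) in H by (field; lra). nra.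
Qed.

(** Pure derivatives are all that the definition of a hyperbolic metric supplies and all that the
    elementary maximum principle consumes; no mixed derivative is presupposed. *)
Record pderivs (w wx wy wxx wyy : R -> R -> R) (z : C) : Prop := {
  pd_x : is_derive (fun t => w t (snd z)) (fst z) (wx (fst z) (snd z));
  pd_y : is_derive (fun t => w (fst z) t) (snd z) (wy (fst z) (snd z));
  pd_xx : is_derive (fun t => wx t (snd z)) (fst z) (wxx (fst z) (snd z));
  pd_yy : is_derive (fun t => wy (fst z) t) (snd z) (wyy (fst z) (snd z));
  pd_cont : ccont (fun p => w (fst p) (snd p)) z }.

Lemma is_derive_lin (f g : R -> R) (a b t f' g' : R) : is_derive f t f' -> is_derive g t g' ->
  is_derive (fun s => a * f s + b * g s) t (a * f' + b * g').
Proof.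
  intros Hf Hg. apply (is_derive_plus (fun s => a * f s) (fun s => b * g s)).
  - apply (is_derive_scal f t a f' Hf).
  - apply (is_derive_scal g t b g' Hg).
Qed.

Lemma pderivs_lin w wx wy wxx wyy v vx vy vxx vyy a b z :
  pderivs w wx wy wxx wyy z -> pderivs v vx vy vxx vyy z ->
  pderivs (fun x y => a * w x y + b * v x y) (fun x y => a * wx x y + b * vx x y)
    (fun x y => a * wy x y + b * vy x y) (fun x y => a * wxx x y + b * vxx x y)
    (fun x y => a * wyy x y + b * vyy x y) z.
Proof.
  intros [H1 H2 H3 H4 H5] [K1 K2 K3 K4 K5]. constructor.
  - apply is_derive_lin; assumption.
  - apply is_derive_lin; assumption.
  - apply is_derive_lin; assumption.
  - apply is_derive_lin; assumption.
  - apply (ccont_lin (fun p => w (fst p) (snd p)) (fun p => v (fst p) (snd p))); assumption.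
Qed.

Lemma is_derive_affine (f : R -> R) (t x0 e c : R) : is_derive f (x0 + e * t) c ->
  is_derive (fun s => f (x0 + e * s)) t (e * c).
Proof.
  intros H. apply (is_derive_comp f (fun s => x0 + e * s) t c e); [exact H|].
  auto_derive; [auto|ring].
Qed.

Lemma is_derive_eq (f : R -> R) (t c c' : R) : is_derive f t c -> c = c' -> is_derive f t c'.
Proof. intros H <-. exact H. Qed.

(** [e = 1] gives the translations behind difference quotients, [e = -1] the reflection behind the
    odd part in [x]. *)
Lemma pderivs_affine w wx wy wxx wyy (x0 y0 e x y : R) : e * e = 1 ->
  pderivs w wx wy wxx wyy (x0 + e * x, y0 + y) ->
  pderivs (fun x y => w (x0 + e * x) (y0 + y)) (fun x y => e * wx (x0 + e * x) (y0 + y))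
    (fun x y => wy (x0 + e * x) (y0 + y)) (fun x y => wxx (x0 + e * x) (y0 + y))
    (fun x y => wyy (x0 + e * x) (y0 + y)) (x, y).
Proof.
  intros He [H1 H2 H3 H4 H5]. simpl in H1, H2, H3, H4.
  assert (Hsh : forall (f : R -> R) (c : R), is_derive f (y0 + y) c -> is_derive (fun s => f (y0 + s)) y c).
  { intros f c Hf. apply (is_derive_ext (fun s => f (y0 + 1 * s))).
    - intros t. f_equal. ring.
    - apply (is_derive_eq _ _ (1 * c)); [|ring].
      apply is_derive_affine. rewrite Rmult_1_l. exact Hf. }
  constructor; simpl fst; simpl snd.
  - apply (is_derive_affine (fun s => w s (y0 + y))), H1.
  - apply (Hsh (fun s => w (x0 + e * x) s)), H2.
  - eapply is_derive_eq.
    + apply (is_derive_scal (fun t => wx (x0 + e * t) (y0 + y)) x e).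
      apply (is_derive_affine (fun s => wx s (y0 + y))), H3.
    + rewrite <- Rmult_assoc, He. ring.
  - apply (Hsh (fun s => wy (x0 + e * x) s)), H4.
  - intros eps Heps. destruct (H5 eps Heps) as [d [Hd H]]. exists d. split; [exact Hd|].
    intros [a b] Hp. apply (H ((x0 + e * a)%R, (y0 + b)%R)).
    replace (Cmod _) with (Cmod ((a, b) - (x, y))%C); [exact Hp|].
    unfold Cmod. f_equal. simpl.
    replace (x0 + e * a + - (x0 + e * x)) with (e * (a - x)) by ring.
    replace (e * (a - x) * (e * (a - x) * 1)) with (e * e * (a - x) ^ 2) by ring. rewrite He. ring.
Qed.

Lemma ccont_fst z : ccont (fun p : C => fst p) z.
Proof.
  intros eps He. exists eps. split; [exact He|]. intros w Hw.
  apply Rle_lt_trans with (2 := Hw). apply (fst_le_Cmod (w - z)%C).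
Qed.

Lemma ccont_snd z : ccont (fun p : C => snd p) z.
Proof.
  intros eps He. exists eps. split; [exact He|]. intros w Hw.
  apply Rle_lt_trans with (2 := Hw). apply (snd_le_Cmod (w - z)%C).
Qed.

Lemma pderivs_separated (f f1 f2 g g1 g2 : R -> R) z :
  (forall t : R, is_derive f t (f1 t)) -> (forall t : R, is_derive f1 t (f2 t)) ->
  (forall t : R, is_derive g t (g1 t)) -> (forall t : R, is_derive g1 t (g2 t)) ->
  pderivs (fun x y => 1 * f x + 1 * g y) (fun x _ => f1 x) (fun _ y => g1 y)
    (fun x _ => f2 x) (fun _ y => g2 y) z.
Proof.
  intros Hf Hf1 Hg Hg1.
  constructor; simpl; auto.
  - eapply is_derive_eq.
    + apply (is_derive_lin f (fun _ => g (snd z)) 1 1 (fst z) (f1 (fst z)) 0); [apply Hf|].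
      apply @is_derive_const.
    + ring.
  - eapply is_derive_eq.
    + apply (is_derive_lin (fun _ => f (fst z)) g 1 1 (snd z) 0 (g1 (snd z))); [|apply Hg].
      apply @is_derive_const.
    + ring.
  - apply (ccont_lin (fun p : C => f (fst p)) (fun p : C => g (snd p))).
    + apply (ccont_comp f (fun p : C => fst p)); [|apply ccont_fst].
      apply derivable_continuous_pt. exists (f1 (fst z)). apply is_derive_Reals, Hf.
    + apply (ccont_comp g (fun p : C => snd p)); [|apply ccont_snd].
      apply derivable_continuous_pt. exists (g1 (snd z)). apply is_derive_Reals, Hg.
Qed.

(** A negative minimum would be interior, and both pure second derivatives would be nonnegative
    there. *)
Lemma rectangle_min_nonneg h hx hy hxx hyy (d : R) : 0 < d ->
  (forall a b, 0 <= a <= d -> Rabs b <= d -> pderivs h hx hy hxx hyy (a, b)) ->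
  (forall a b, 0 <= a <= d -> Rabs b <= d -> a = 0 \/ a = d \/ Rabs b = d -> 0 <= h a b) ->
  (forall a b, 0 < a < d -> Rabs b < d -> hxx a b + hyy a b < 0) ->
  forall a b, 0 <= a <= d -> Rabs b <= d -> 0 <= h a b.
Proof.
  intros Hd Hp Hbd Hlap.
  destruct (max_attained C (fun z => 0 <= fst z <= d /\ Rabs (snd z) <= d)
    (fun z => - h (fst z) (snd z))) as [[a b] [[Ha Hb] Hmax]].
  - exists (0, 0). simpl. rewrite Rabs_R0. lra.
  - intros X HX.
    destruct (bounded_chain_subseq 1 (fun n _ => X n) (d + d)) as [p [l [Hp' Hl]]].
    { intros n _ _. eapply Rle_trans; [apply Cmod_le_sum|]. destruct (HX n) as [H1 H2].
      rewrite Rabs_right by lra. lra. }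
    specialize (Hl 0%nat ltac:(lia)). set (z := l 0%nat) in *.
    assert (Hf : Un_cv (fun n => fst (X (p n))) (fst z)) by (apply (ccont_cv _ _ _ (ccont_fst z) Hl)).
    assert (Hs : Un_cv (fun n => snd (X (p n))) (snd z)) by (apply (ccont_cv _ _ _ (ccont_snd z) Hl)).
    assert (HA : 0 <= fst z <= d /\ Rabs (snd z) <= d).
    { split; [split|].
      - apply (Un_cv_ge _ _ _ Hf). intros n. apply HX.
      - apply (Un_cv_le _ _ _ Hf). intros n. apply HX.
      - apply Rabs_le. split.
        + apply (Un_cv_ge _ _ _ Hs). intros n. destruct (HX (p n)) as [_ H].
          apply Rabs_le_between in H. lra.
        + apply (Un_cv_le _ _ _ Hs). intros n. destruct (HX (p n)) as [_ H].
          apply Rabs_le_between in H. lra. }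
    exists p, z. split; [exact Hp'|]. split; [exact HA|].
    apply (CV_opp (fun n => h (fst (X (p n))) (snd (X (p n))))).
    destruct z as [a b]. destruct (Hp a b (proj1 HA) (proj2 HA)) as [_ _ _ _ Hc].
    apply (ccont_cv (fun p => h (fst p) (snd p)) _ _ Hc Hl).
  - simpl in Ha, Hb. simpl fst in Hmax. simpl snd in Hmax.
    assert (H0 : 0 <= h a b).
    { destruct (classic (a = 0 \/ a = d \/ Rabs b = d)) as [H|H]; [apply Hbd; assumption|].
      exfalso.
      assert (Ha' : 0 < a < d).
      { split; apply Rnot_le_lt; intros K; apply H; [left|right; left]; lra. }
      assert (Hb' : Rabs b < d).
      { apply Rnot_le_lt. intros K. apply H. right; right. lra. }
      specialize (Hlap a b Ha' Hb').
      assert (Hr1 : 0 < Rmin a (d - a)) by (apply Rmin_pos; lra).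
      assert (Hi1 : forall s, Rabs (s - a) < Rmin a (d - a) -> 0 <= s <= d).
      { intros s K. pose proof (Rmin_l a (d - a)). pose proof (Rmin_r a (d - a)).
        apply Rabs_def2 in K. lra. }
      assert (Hi2 : forall s, Rabs (s - b) < d - Rabs b -> Rabs s <= d).
      { intros s K. replace s with ((s - b) + b) by ring.
        pose proof (Rabs_triang (s - b) b). lra. }
      assert (0 <= hxx a b).
      { apply (second_derivative_min (fun t => h t b) (fun t => hx t b) a _ _ Hr1).
        - intros s K. apply (pd_x _ _ _ _ _ _ (Hp s b (Hi1 s K) Hb)).
        - apply (pd_xx _ _ _ _ _ _ (Hp a b Ha Hb)).
        - intros s K. specialize (Hmax (s, b) (conj (Hi1 s K) Hb)). simpl in Hmax. lra. }
      assert (0 <= hyy a b).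
      { apply (second_derivative_min (fun t => h a t) (fun t => hy a t) b _ (d - Rabs b)); [lra| | |].
        - intros s K. apply (pd_y _ _ _ _ _ _ (Hp a s Ha (Hi2 s K))).
        - apply (pd_yy _ _ _ _ _ _ (Hp a b Ha Hb)).
        - intros s K. specialize (Hmax (a, s) (conj Ha (Hi2 s K))). simpl in Hmax. lra. }
      lra. }
    intros a' b' Ha' Hb'. specialize (Hmax (a', b') (conj Ha' Hb')). simpl in Hmax. lra.
Qed.

(* Gilbarg-Trudinger, Section 3.4: compare the odd part of [w] in [x] with a quadratic
   barrier on a half box. *)
Lemma gradient_upper w wx wy wxx wyy (x0 y0 d M F : R) : 0 < d ->
  (forall x y, Rabs (x - x0) <= d -> Rabs (y - y0) <= d ->
     pderivs w wx wy wxx wyy (x, y) /\ Rabs (w x y) <= M /\ Rabs (wxx x y + wyy x y) < F) ->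
  wx x0 y0 <= 2 * M / d + F * d / 2.
Proof.
  intros Hd H.
  assert (Hbox : forall e a b, e = 1 \/ e = -1 -> 0 <= a <= d -> Rabs b <= d ->
    Rabs (x0 + e * a - x0) <= d /\ Rabs (y0 + b - y0) <= d).
  { intros e a b He Ha Hb. replace (x0 + e * a - x0) with (e * a) by ring.
    replace (y0 + b - y0) with b by ring. split; [|exact Hb].
    apply Rabs_le. destruct He as [-> | ->]; lra. }
  assert (Hc : Rabs (x0 - x0) <= d /\ Rabs (y0 - y0) <= d).
  { rewrite !Rminus_diag, Rabs_R0. lra. }
  assert (HM : 0 <= M).
  { destruct (H x0 y0 (proj1 Hc) (proj2 Hc)) as [_ [H1 _]]. pose proof (Rabs_pos (w x0 y0)). lra. }
  assert (HF : 0 < F).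
  { destruct (H x0 y0 (proj1 Hc) (proj2 Hc)) as [_ [_ H1]].
    pose proof (Rabs_pos (wxx x0 y0 + wyy x0 y0)). lra. }
  set (k := M / d ^ 2).
  assert (Hk : 0 <= k).
  { apply Rmult_le_pos; [exact HM|]. left. apply Rinv_0_lt_compat, pow_lt, Hd. }
  assert (Hkd : k * d ^ 2 = M) by (unfold k; field; lra).
  (* The barrier is [f a + g b]. Its part [k (a (2 d - a) + b^2)] is harmonic and reaches at least
     [k d^2 = M] on the sides [a = d] and [|b| = d]; the part [F / 2 * a (d - a)] has Laplacian
     [- F] and beats that of the odd part of [w]. *)
  set (f := fun a => k * (a * (2 * d - a)) + F / 2 * (a * (d - a))).
  set (f1 := fun a => k * (2 * d - 2 * a) + F / 2 * (d - 2 * a)).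
  set (g := fun b : R => k * b ^ 2).
  pose (w1 := fun a b : R => w (x0 + 1 * a) (y0 + b)).
  pose (w2 := fun a b : R => w (x0 + -1 * a) (y0 + b)).
  pose (h := fun a b => 1 * (1 * f a + 1 * g b) + 1 * (- / 2 * w1 a b + / 2 * w2 a b)).
  pose (hxx := fun a b => 1 * (- 2 * k - F) + 1 * (- / 2 * wxx (x0 + 1 * a) (y0 + b) +
    / 2 * wxx (x0 + -1 * a) (y0 + b))).
  pose (hyy := fun a b => 1 * (2 * k) + 1 * (- / 2 * wyy (x0 + 1 * a) (y0 + b) +
    / 2 * wyy (x0 + -1 * a) (y0 + b))).
  assert (Hh : forall a b, 0 <= a <= d -> Rabs b <= d -> 0 <= h a b).
  { eapply (rectangle_min_nonneg h _ _ hxx hyy d Hd).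
    - intros a b Ha Hb.
      destruct (Hbox 1 a b (or_introl eq_refl) Ha Hb) as [B1 B2].
      destruct (Hbox (-1) a b (or_intror eq_refl) Ha Hb) as [B3 B4].
      apply (pderivs_lin (fun a b => 1 * f a + 1 * g b) (fun a _ => f1 a) (fun _ b => k * (2 * b))
        (fun _ _ => - 2 * k - F) (fun _ _ => 2 * k)).
      + apply (pderivs_separated f f1 (fun _ => - 2 * k - F) g (fun b => k * (2 * b)) (fun _ => 2 * k)).
        * intros t. unfold f, f1. auto_derive; [auto|field].
        * intros t. unfold f1. auto_derive; [auto|field].
        * intros t. unfold g. auto_derive; [auto|ring].
        * intros t. auto_derive; [auto|ring].
      + apply pderivs_lin.
        * apply (pderivs_affine w wx wy wxx wyy); [ring|]. apply (H _ _ B1 B2).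
        * apply (pderivs_affine w wx wy wxx wyy); [ring|]. apply (H _ _ B3 B4).
    - intros a b Ha Hb Hab. unfold h.
      destruct (Hbox 1 a b (or_introl eq_refl) Ha Hb) as [B1 B2].
      destruct (Hbox (-1) a b (or_intror eq_refl) Ha Hb) as [B3 B4].
      destruct (H _ _ B1 B2) as [_ [M1 _]]. destruct (H _ _ B3 B4) as [_ [M2 _]].
      fold (w1 a b) in M1. fold (w2 a b) in M2. apply Rabs_le_between in M1, M2.
      assert (Hb2 : 0 <= k * b ^ 2) by (apply Rmult_le_pos; [exact Hk|apply pow2_ge_0]).
      assert (Hf0 : 0 <= k * (a * (2 * d - a))).
      { apply Rmult_le_pos; [exact Hk|]. apply Rmult_le_pos; lra. }
      assert (Hf1 : 0 <= F / 2 * (a * (d - a))).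
      { apply Rmult_le_pos; [lra|]. apply Rmult_le_pos; lra. }
      destruct Hab as [-> |[-> |Hbd]].
      + replace (w2 0 b) with (w1 0 b) by (unfold w1, w2; f_equal; ring). unfold f, g. lra.
      + unfold f, g. replace (d * (2 * d - d)) with (d ^ 2) by ring. nra.
      + unfold f, g. rewrite <- (pow2_abs b), Hbd. nra.
    - intros a b Ha Hb. unfold hxx, hyy.
      destruct (Hbox 1 a b (or_introl eq_refl) ltac:(lra) ltac:(lra)) as [B1 B2].
      destruct (Hbox (-1) a b (or_intror eq_refl) ltac:(lra) ltac:(lra)) as [B3 B4].
      destruct (H _ _ B1 B2) as [_ [_ M1]]. destruct (H _ _ B3 B4) as [_ [_ M2]].
      apply Rabs_def2 in M1, M2. lra. }
  apply Rminus_le.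
  set (K := 2 * M / d + F * d / 2).
  assert (EK : K = k * (2 * d) + F / 2 * d) by (unfold K, k; field; lra).
  pose proof (pd_x _ _ _ _ _ _ (proj1 (H x0 y0 (proj1 Hc) (proj2 Hc)))) as Hx. simpl in Hx.
  assert (Hdf : is_derive (fun a => / 2 * w (x0 + 1 * a) y0 + - / 2 * w (x0 + -1 * a) y0 - K * a) 0
    (wx x0 y0 - K)).
  { apply (is_derive_minus (fun a => / 2 * w (x0 + 1 * a) y0 + - / 2 * w (x0 + -1 * a) y0)
      (fun a => K * a)).
    - eapply is_derive_eq.
      + apply (is_derive_lin (fun a => w (x0 + 1 * a) y0) (fun a => w (x0 + -1 * a) y0)).
        * apply (is_derive_affine (fun t => w t y0)). rewrite Rmult_0_r, Rplus_0_r. exact Hx.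
        * apply (is_derive_affine (fun t => w t y0)). rewrite Rmult_0_r, Rplus_0_r. exact Hx.
      + field.
    - auto_derive; [auto|ring]. }
  apply (derive_le_right _ _ _ d Hdf Hd). intros s Hs.
  specialize (Hh s 0 ltac:(lra) ltac:(rewrite Rabs_R0; lra)).
  unfold h, w1, w2, f, g in Hh. rewrite !Rplus_0_r in Hh.
  rewrite !Rplus_0_l, !Rmult_0_r, !Rplus_0_r, EK.
  assert (0 <= k * s ^ 2) by (apply Rmult_le_pos; [exact Hk|apply pow2_ge_0]).
  assert (0 <= F / 2 * s ^ 2) by (apply Rmult_le_pos; [lra|apply pow2_ge_0]).
  lra.
Qed.

Lemma gradient_bound w wx wy wxx wyy (x0 y0 d M F : R) : 0 < d ->
  (forall x y, Rabs (x - x0) <= d -> Rabs (y - y0) <= d ->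
     pderivs w wx wy wxx wyy (x, y) /\ Rabs (w x y) <= M /\ Rabs (wxx x y + wyy x y) < F) ->
  Rabs (wx x0 y0) <= 2 * M / d + F * d / 2.
Proof.
  intros Hd H. apply Rabs_le. split.
  (* The lower bound is the upper one for [- w], written as a combination so that [pderivs_lin]
     applies. *)
  - assert (- 1 * wx x0 y0 + 0 * wx x0 y0 <= 2 * M / d + F * d / 2); [|lra].
    apply (gradient_upper (fun x y => -1 * w x y + 0 * w x y) (fun x y => -1 * wx x y + 0 * wx x y)
      (fun x y => -1 * wy x y + 0 * wy x y) (fun x y => -1 * wxx x y + 0 * wxx x y)
      (fun x y => -1 * wyy x y + 0 * wyy x y) x0 y0 d M F Hd).
    intros x y Hx Hy. destruct (H x y Hx Hy) as [H1 [H2 H3]]. split; [apply pderivs_lin; exact H1|].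
    split.
    + replace (-1 * w x y + 0 * w x y) with (- w x y) by ring. rewrite Rabs_Ropp. exact H2.
    + replace (_ + _) with (- (wxx x y + wyy x y)) by ring. rewrite Rabs_Ropp. exact H3.
  - apply (gradient_upper w wx wy wxx wyy); assumption.
Qed.

Lemma rel_compact_unif_cont O A f : rel_compact O A -> (forall z, O z -> ccont f z) ->
  forall eps, 0 < eps -> exists d, 0 < d /\
    forall z, A z -> forall w, Cmod (w - z)%C < d -> Rabs (f w - f z) <= eps.
Proof.
  intros HA Hf eps He.
  apply (rel_compact_radius O A (fun d z => forall w, Cmod (w - z)%C < d -> Rabs (f w - f z) <= eps));
    [| |exact HA].
  - intros d d' z Hdd H w Hw. apply H. lra.
  - intros z Hz. destruct (Hf z Hz (eps / 2) ltac:(lra)) as [r [Hr H]].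
    exists (r / 2), (r / 2). repeat (split; [lra|]). intros w Hw q Hq.
    assert (H1 : Rabs (f w - f z) < eps / 2) by (apply H; lra).
    assert (H2 : Rabs (f q - f z) < eps / 2).
    { apply H. pose proof (Cmod_dist_triangle q w z). lra. }
    apply Rabs_def2 in H1, H2. apply Rabs_le. lra.
Qed.

Lemma Rabs_dist_triangle (b a c : R) : Rabs (a - c) <= Rabs (a - b) + Rabs (b - c).
Proof. replace (a - c) with ((a - b) + (b - c)) by ring. apply Rabs_triang. Qed.

(** * Second-order expansions from the pure second derivatives *)

Section Regularity.
Variables (O : C -> Prop) (u ux uy uxx uyy f fy : R -> R -> R).
Hypothesis Oopen : is_open O.
Hypothesis Hpd : forall z, O z -> pderivs u ux uy uxx uyy z.
Hypothesis Hux : forall z, O z -> ccont (fun p => ux (fst p) (snd p)) z.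
Hypothesis Huy : forall z, O z -> ccont (fun p => uy (fst p) (snd p)) z.
Hypothesis Huxx : forall z, O z -> ccont (fun p => uxx (fst p) (snd p)) z.
Hypothesis Huyy : forall z, O z -> ccont (fun p => uyy (fst p) (snd p)) z.
Hypothesis Hlap : forall z, O z -> uxx (fst z) (snd z) + uyy (fst z) (snd z) = f (fst z) (snd z).
Hypothesis Hfy : forall z, O z -> is_derive (fun t => f (fst z) t) (snd z) (fy (fst z) (snd z)).
Hypothesis Hfyc : forall z, O z -> ccont (fun p => fy (fst p) (snd p)) z.

Section Local.
Variables (x0 y0 d : R).
Hypothesis Hd : 0 < d.
Hypothesis Hdisc : forall z : C, Cmod (z - (x0, y0))%C <= 6 * d -> O z.
Notation K := (fun z : C => Cmod (z - (x0, y0))%C <= 6 * d).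

(** The radius [6 d] leaves room for three displacements of size [d] in each coordinate: of the base
    point, within the box of the gradient estimate, and by the difference step. *)
Lemma box_in_disc x y : Rabs (x - x0) <= 3 * d -> Rabs (y - y0) <= 3 * d -> K (x, y).
Proof.
  intros Hx Hy. eapply Rle_trans; [apply Cmod_le_sum|]. simpl. unfold Rminus in *. lra.
Qed.

Lemma K_compact : rel_compact O K.
Proof. apply rel_compact_disc, Hdisc. Qed.

Lemma y_quotient (g g1 : R -> R -> R) x y k c e : Rabs k <= d ->
  Rabs (x - x0) <= 2 * d -> Rabs (y - y0) <= 2 * d ->
  (forall z, O z -> is_derive (fun t => g (fst z) t) (snd z) (g1 (fst z) (snd z))) ->
  (forall t, Rabs (t - y) <= Rabs k -> Rabs (g1 x t - c) <= e) ->
  Rabs (g x (y + k) - g x y - c * k) <= e * Rabs k.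
Proof.
  intros Hkd Hx Hy Hg He. apply (mvt_quotient (fun t => g x t) (fun t => g1 x t)); [|exact He].
  intros t Ht. apply (Hg (x, t)), Hdisc, box_in_disc; [lra|].
  pose proof (Rabs_dist_triangle y t y0). lra.
Qed.

Lemma box_shift x y k : Rabs (x - x0) <= 2 * d -> Rabs (y - y0) <= 2 * d -> Rabs k <= d ->
  O (x, y) /\ O (x, y + k).
Proof.
  intros Hx Hy Hk. split; apply Hdisc, box_in_disc; try lra.
  replace (y + k - y0) with ((y - y0) + k) by ring. pose proof (Rabs_triang (y - y0) k). lra.
Qed.

Definition dif (w : R -> R -> R) (k x y : R) : R := w x (y + k) - w x y.

Lemma pderivs_dif k x y : O (x, y) -> O (x, y + k) ->
  pderivs (dif u k) (dif ux k) (dif uy k) (dif uxx k) (dif uyy k) (x, y).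
Proof.
  intros H1 H2.
  assert (Hs : pderivs u ux uy uxx uyy ((0 + 1 * x)%R, (k + y)%R)).
  { replace (0 + 1 * x) with x by ring. replace (k + y) with (y + k) by ring. apply Hpd, H2. }
  pose proof (pderivs_lin _ _ _ _ _ _ _ _ _ _ 1 (-1) _
    (pderivs_affine u ux uy uxx uyy 0 k 1 x y ltac:(ring) Hs) (Hpd _ H1)) as H.
  assert (E : forall w a b, 1 * w (0 + 1 * a) (k + b) + -1 * w a b = dif w k a b).
  { intros w a b. unfold dif. replace (0 + 1 * a) with a by ring.
    replace (k + b) with (b + k) by ring. ring. }
  destruct H as [P1 P2 P3 P4 P5]. simpl in P1, P2, P3, P4.
  constructor; simpl.
  - rewrite <- E. eapply is_derive_ext; [intros t; apply E|].
    rewrite Rmult_1_l in P1. exact P1.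
  - rewrite <- E. eapply is_derive_ext; [intros t; apply E|exact P2].
  - rewrite <- E. eapply is_derive_ext; [intros t; apply E|].
    eapply is_derive_ext; [|exact P3]. intros t. simpl. rewrite Rmult_1_l. reflexivity.
  - rewrite <- E. eapply is_derive_ext; [intros t; apply E|exact P4].
  - intros eps He. destruct (P5 eps He) as [r [Hr H]]. exists r. split; [exact Hr|].
    intros w Hw. specialize (H w Hw). cbv beta in H. rewrite !E in H. exact H.
Qed.

(** The Laplacian of [dif u k] is [dif f k], and both are of order [k] by the bounds on [uy] and
    [fy]; the interior gradient estimate passes this order on to [dif ux k]. The [+ 1] provides the
    strict inequality that [gradient_bound] asks for. *)
Lemma ux_lipschitz M x y k : Rabs (x - x0) <= d -> Rabs (y - y0) <= d -> Rabs k <= d ->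
  (forall z, K z -> Rabs (uy (fst z) (snd z)) <= M) ->
  (forall z, K z -> Rabs (fy (fst z) (snd z)) <= M) ->
  Rabs (ux x (y + k) - ux x y) <= (2 * M / d + (M + 1) * d / 2) * Rabs k.
Proof.
  intros Hx Hy Hk M1 M2. destruct (Req_dec k 0) as [->|Hk0].
  { rewrite Rplus_0_r, Rminus_diag, Rabs_R0. lra. }
  assert (Hk' : 0 < Rabs k) by (apply Rabs_pos_lt, Hk0).
  replace ((2 * M / d + (M + 1) * d / 2) * Rabs k) with
    (2 * (M * Rabs k) / d + ((M + 1) * Rabs k) * d / 2) by (field; lra).
  apply (gradient_bound (dif u k) (dif ux k) (dif uy k) (dif uxx k) (dif uyy k) x y d _ _ Hd).
  intros a b Ha Hb.
  assert (Ha' : Rabs (a - x0) <= 2 * d).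
  { pose proof (Rabs_dist_triangle x a x0). lra. }
  assert (Hb' : Rabs (b - y0) <= 2 * d).
  { pose proof (Rabs_dist_triangle y b y0). lra. }
  destruct (box_shift a b k Ha' Hb' Hk) as [O1 O2].
  assert (HKt : forall t, Rabs (t - b) <= Rabs k -> K (a, t)).
  { intros t Ht. apply box_in_disc; [lra|]. pose proof (Rabs_dist_triangle b t y0). lra. }
  split; [apply pderivs_dif; assumption|]. split.
  - replace (dif u k a b) with (u a (b + k) - u a b - 0 * k) by (unfold dif; ring).
    apply (y_quotient u uy); try assumption.
    + intros z Hz. apply (pd_y _ _ _ _ _ _ (Hpd z Hz)).
    + intros t Ht. rewrite Rminus_0_r. apply (M1 (a, t)), HKt, Ht.
  - replace (dif uxx k a b + dif uyy k a b) with (f a (b + k) - f a b - 0 * k).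
    + eapply Rle_lt_trans.
      * apply (y_quotient f fy a b k 0 M); try assumption.
        intros t Ht. rewrite Rminus_0_r. apply (M2 (a, t)), HKt, Ht.
      * apply Rmult_lt_compat_r; lra.
    + unfold dif. pose proof (Hlap _ O1) as E1. pose proof (Hlap _ O2) as E2. simpl in E1, E2. lra.
Qed.

(** Two difference quotients of [u] are both close to [uy] on a whole box, and their Laplacians both
    close to [fy]; the gradient estimate transfers the smallness of their difference to [ux]. *)
Lemma ux_quotient_cauchy eps : 0 < eps -> exists r, 0 < r /\ forall k k',
  k <> 0 -> k' <> 0 -> Rabs k < r -> Rabs k' < r ->
  Rabs (dif ux k x0 y0 / k - dif ux k' x0 y0 / k') <= eps.
Proof.
  (* The difference is at most [2 om], its Laplacian likewise, enlarged to [4 om] for strictness;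
     the gradient estimate then reads [om * (4 / d + 2 * d) = eps]. *)
  intros He. set (om := eps / (4 / d + 2 * d)).
  assert (Hp : 0 < 4 / d) by (apply Rdiv_lt_0_compat; lra).
  assert (Hom : 0 < om) by (apply Rdiv_lt_0_compat; lra).
  destruct (rel_compact_unif_cont O K _ K_compact Huy om Hom) as [r1 [Hr1 U1]].
  destruct (rel_compact_unif_cont O K _ K_compact Hfyc om Hom) as [r2 [Hr2 U2]].
  set (r := Rmin d (Rmin r1 r2)).
  assert (Hr : 0 < r /\ r <= d /\ r <= r1 /\ r <= r2).
  { unfold r, Rmin. repeat destruct Rle_dec; lra. }
  exists r. split; [lra|]. intros k k' Hk0 Hk0' Hk Hk'.
  assert (Hq : forall j a b (g g1 : R -> R -> R), j <> 0 -> Rabs j < r ->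
    Rabs (a - x0) <= d -> Rabs (b - y0) <= d ->
    (forall z, O z -> is_derive (fun t => g (fst z) t) (snd z) (g1 (fst z) (snd z))) ->
    (forall z w, K z -> Cmod (w - z)%C < r -> Rabs (g1 (fst w) (snd w) - g1 (fst z) (snd z)) <= om) ->
    Rabs (dif g j a b / j - g1 a b) <= om).
  { intros j a b g g1 Hj Hjr Ha Hb Hg HU. assert (Hj' : 0 < Rabs j) by (apply Rabs_pos_lt, Hj).
    apply (Rmult_le_reg_r (Rabs j)); [exact Hj'|]. rewrite <- Rabs_mult.
    replace ((dif g j a b / j - g1 a b) * j) with (g a (b + j) - g a b - g1 a b * j)
      by (unfold dif; field; exact Hj).
    apply (y_quotient g g1); try assumption; try lra.
    intros t Ht. apply (HU (a, b) (a, t)); [apply box_in_disc; lra|].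
    eapply Rle_lt_trans; [apply Cmod_le_sum|]. simpl. rewrite Rplus_opp_r, Rabs_R0.
    unfold Rminus in Ht. lra. }
  assert (E : eps = 2 * (2 * om) / d + (4 * om) * d / 2).
  { unfold om. field. split; nra. }
  rewrite E.
  replace (dif ux k x0 y0 / k - dif ux k' x0 y0 / k') with
    (/ k * dif ux k x0 y0 + - / k' * dif ux k' x0 y0) by (field; auto).
  apply (gradient_bound (fun x y => / k * dif u k x y + - / k' * dif u k' x y)
    (fun x y => / k * dif ux k x y + - / k' * dif ux k' x y)
    (fun x y => / k * dif uy k x y + - / k' * dif uy k' x y)
    (fun x y => / k * dif uxx k x y + - / k' * dif uxx k' x y)
    (fun x y => / k * dif uyy k x y + - / k' * dif uyy k' x y) x0 y0 d _ _ Hd).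
  intros a b Ha Hb.
  destruct (box_shift a b k ltac:(lra) ltac:(lra) ltac:(lra)) as [O1 O2].
  destruct (box_shift a b k' ltac:(lra) ltac:(lra) ltac:(lra)) as [_ O3].
  split; [apply pderivs_lin; apply pderivs_dif; assumption|].
  assert (Hg : forall z, O z -> is_derive (fun t => u (fst z) t) (snd z) (uy (fst z) (snd z))).
  { intros z Hz. apply (pd_y _ _ _ _ _ _ (Hpd z Hz)). }
  assert (HU1 : forall z w, K z -> Cmod (w - z)%C < r ->
    Rabs (uy (fst w) (snd w) - uy (fst z) (snd z)) <= om).
  { intros z w Hz Hw. apply U1; [exact Hz|lra]. }
  assert (HU2 : forall z w, K z -> Cmod (w - z)%C < r ->
    Rabs (fy (fst w) (snd w) - fy (fst z) (snd z)) <= om).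
  { intros z w Hz Hw. apply U2; [exact Hz|lra]. }
  split.
  - pose proof (Hq k a b u uy Hk0 Hk Ha Hb Hg HU1) as Q1.
    pose proof (Hq k' a b u uy Hk0' Hk' Ha Hb Hg HU1) as Q2.
    apply Rabs_le_between in Q1, Q2. apply Rabs_le. unfold Rdiv in Q1, Q2. lra.
  - pose proof (Hq k a b f fy Hk0 Hk Ha Hb Hfy HU2) as Q1.
    pose proof (Hq k' a b f fy Hk0' Hk' Ha Hb Hfy HU2) as Q2.
    apply Rabs_le_between in Q1, Q2.
    replace (_ + _) with (dif f k a b / k - dif f k' a b / k').
    + apply Rabs_def1; lra.
    + unfold dif. pose proof (Hlap _ O1) as E1. pose proof (Hlap _ O2) as E2.
      pose proof (Hlap _ O3) as E3. simpl in E1, E2, E3. rewrite <- E1, <- E2, <- E3. field. auto.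
Qed.

(** The limit [B] of the difference quotients is the mixed derivative at the centre. It is obtained
    at this one point, with no claim of continuity, which matches the pointwise expansion in
    [cjet]. *)
Lemma ux_dy : exists B, forall eps, 0 < eps -> exists r, 0 < r /\ forall k, Rabs k < r ->
  Rabs (ux x0 (y0 + k) - ux x0 y0 - B * k) <= eps * Rabs k.
Proof.
  set (Q := fun n => dif ux (/ (INR n + 1)) x0 y0 / (/ (INR n + 1))).
  assert (Hpos : forall n, 0 < / (INR n + 1)).
  { intros n. apply Rinv_0_lt_compat. pose proof (pos_INR n). lra. }
  destruct (Rcomplete.R_complete Q) as [B HB].
  { intros eps He. destruct (ux_quotient_cauchy (eps / 2) ltac:(lra)) as [r [Hr H]].
    destruct (inv_INR_small r Hr) as [N HN]. exists N. intros n m Hn Hm.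
    unfold Rdist, Q. eapply Rle_lt_trans.
    - apply H; try (apply Rgt_not_eq, Hpos); rewrite Rabs_right by (left; apply Hpos); apply HN; lia.
    - lra. }
  exists B. intros eps He. destruct (ux_quotient_cauchy (eps / 2) ltac:(lra)) as [r [Hr H]].
  exists r. split; [exact Hr|]. intros k Hk. destruct (Req_dec k 0) as [->|Hk0].
  { rewrite Rplus_0_r, Rabs_R0. replace (_ - _ - _) with 0 by ring. rewrite Rabs_R0. lra. }
  destruct (inv_INR_small r Hr) as [N HN]. destruct (HB (eps / 2) ltac:(lra)) as [N' HN'].
  set (n := max N N'). specialize (HN n ltac:(lia)). specialize (HN' n ltac:(lia)).
  specialize (H k (/ (INR n + 1)) Hk0 ltac:(apply Rgt_not_eq, Hpos) Hk
    ltac:(rewrite Rabs_right; [exact HN|left; apply Hpos])).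
  fold (Q n) in H. unfold Rdist in HN'.
  replace (ux x0 (y0 + k) - ux x0 y0 - B * k) with ((dif ux k x0 y0 / k - B) * k)
    by (unfold dif; field; exact Hk0).
  rewrite Rabs_mult. apply Rmult_le_compat_r; [apply Rabs_pos|].
  apply Rabs_def2 in HN'. apply Rabs_le_between in H. apply Rabs_le. lra.
Qed.

End Local.

(** The increment is split into a vertical one at [x] and a horizontal one at height [y + b], and
    [ux x (y + b)] is brought back to [ux x y] through [B]. With the true derivatives this is the
    expansion at a point; with zeros and a large [e] it is a locally uniform quadratic bound. *)
Lemma increment_split (x y a b c1 c2 B e d : R) : Rabs a < d -> Rabs b < d ->
  (forall s t, Rabs s < d -> Rabs t < d -> O (x + s, y + t)) ->
  (forall s, Rabs s < d -> Rabs (uxx (x + s) (y + b) - c1) <= e) ->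
  (forall t, Rabs t < d -> Rabs (uyy x (y + t) - c2) <= e) ->
  Rabs (ux x (y + b) - ux x y - B * b) <= e * Rabs b ->
  Rabs (u (x + a) (y + b) - u x y - (ux x y * a + uy x y * b)
     - (c1 / 2 * a ^ 2 + B * (a * b) + c2 / 2 * b ^ 2)) <= 2 * e * (a ^ 2 + b ^ 2).
Proof.
  intros Ha Hb HO H1 H2 H3.
  assert (Hd : 0 < d) by (pose proof (Rabs_pos a); lra).
  assert (H00 : Rabs 0 < d) by (rewrite Rabs_R0; exact Hd).
  assert (T1 := taylor2 (fun s => u (x + 1 * s) (y + b)) (fun s => ux (x + 1 * s) (y + b))
    (fun s => uxx (x + 1 * s) (y + b)) d c1 e a).
  assert (T2 := taylor2 (fun t => u x (y + 1 * t)) (fun t => uy x (y + 1 * t))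
    (fun t => uyy x (y + 1 * t)) d c2 e b).
  cbv beta in T1, T2. rewrite !Rmult_0_r, !Rplus_0_r, !Rmult_1_l in T1, T2.
  assert (T1' : Rabs (u (x + a) (y + b) - u x (y + b) - ux x (y + b) * a - c1 / 2 * a ^ 2) <= e * a ^ 2).
  { apply T1; [| | |exact Ha].
    - intros s Hs. apply (is_derive_eq _ _ (1 * ux (x + 1 * s) (y + b))); [|ring].
      apply (is_derive_affine (fun s => u s (y + b))).
      apply (pd_x _ _ _ _ _ _ (Hpd (x + 1 * s, y + b)%R ltac:(rewrite Rmult_1_l; apply HO; assumption))).
    - intros s Hs. apply (is_derive_eq _ _ (1 * uxx (x + 1 * s) (y + b))); [|ring].
      apply (is_derive_affine (fun s => ux s (y + b))).
      apply (pd_xx _ _ _ _ _ _ (Hpd (x + 1 * s, y + b)%R ltac:(rewrite Rmult_1_l; apply HO; assumption))).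
    - intros s Hs. rewrite Rmult_1_l. apply H1, Hs. }
  assert (HOy : forall t, Rabs t < d -> O (x, y + 1 * t)%R).
  { intros t Ht. rewrite Rmult_1_l. rewrite <- (Rplus_0_r x). apply HO; assumption. }
  assert (T2' : Rabs (u x (y + b) - u x y - uy x y * b - c2 / 2 * b ^ 2) <= e * b ^ 2).
  { apply T2; [| | |exact Hb].
    - intros t Ht. apply (is_derive_eq _ _ (1 * uy x (y + 1 * t))); [|ring].
      apply (is_derive_affine (fun t => u x t)).
      apply (pd_y _ _ _ _ _ _ (Hpd (x, y + 1 * t)%R (HOy t Ht))).
    - intros t Ht. apply (is_derive_eq _ _ (1 * uyy x (y + 1 * t))); [|ring].
      apply (is_derive_affine (fun t => uy x t)).
      apply (pd_yy _ _ _ _ _ _ (Hpd (x, y + 1 * t)%R (HOy t Ht))).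
    - intros t Ht. rewrite Rmult_1_l. apply H2, Ht. }
  assert (T3 : Rabs (a * (ux x (y + b) - ux x y - B * b)) <= e * (Rabs a * Rabs b)).
  { rewrite Rabs_mult. pose proof (Rabs_pos a). nra. }
  assert (He : 0 <= e).
  { eapply Rle_trans; [apply Rabs_pos|apply (H2 0 H00)]. }
  assert (Hab : Rabs a * Rabs b <= a ^ 2 + b ^ 2).
  { rewrite <- (pow2_abs a), <- (pow2_abs b). pose proof (Rabs_pos a). pose proof (Rabs_pos b). nra. }
  assert (e * (Rabs a * Rabs b) <= e * (a ^ 2 + b ^ 2)) by (apply Rmult_le_compat_l; assumption).
  apply Rabs_le_between in T1', T2', T3. apply Rabs_le. lra.
Qed.

Theorem regular_jet_on :
  jet_on O (fun z => u (fst z) (snd z)) (fun z => (ux (fst z) (snd z), - uy (fst z) (snd z)))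
    (fun z => f (fst z) (snd z)).
Proof.
  intros [x0 y0] Hz. destruct (open_ball O _ Oopen Hz) as [r [Hr HB]].
  set (d := r / 8). assert (Hd : 0 < d) by (unfold d; lra).
  assert (Hdisc : forall z : C, Cmod (z - (x0, y0))%C <= 6 * d -> O z).
  { intros z H. apply HB. unfold d in H. lra. }
  assert (Hin : forall s t, Rabs s < 3 * d -> Rabs t < 3 * d -> O ((x0 + s)%R, (y0 + t)%R)).
  { intros s t Hs Ht. apply Hdisc, box_in_disc.
    - replace (x0 + s - x0) with s by ring. lra.
    - replace (y0 + t - y0) with t by ring. lra. }
  simpl fst. simpl snd. split.
  - destruct (ux_dy x0 y0 d Hd Hdisc) as [B HBl].
    set (A := uxx x0 y0). set (D := uyy x0 y0).
    (* For [s = a + i b], [Re (Q s^2) = (A - D) / 4 * (a^2 - b^2) + B a b], which together with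
       [(A + D) / 4 * |s|^2] is the full quadratic form. *)
    exists ((A - D) / 4, - B / 2)%R. intros eps He.
    destruct (HBl (eps / 2) ltac:(lra)) as [r1 [Hr1 H1]].
    destruct (Huxx _ Hz (eps / 2) ltac:(lra)) as [r2 [Hr2 H2]].
    destruct (Huyy _ Hz (eps / 2) ltac:(lra)) as [r3 [Hr3 H3]].
    set (m := Rmin (Rmin d r1) (Rmin (r2 / 2) (r3 / 2))).
    assert (Hm : 0 < m /\ m <= d /\ m <= r1 /\ m <= r2 / 2 /\ m <= r3 / 2).
    { unfold m, Rmin. repeat destruct Rle_dec; lra. }
    exists m. split; [lra|]. intros [a b] Hs.
    pose proof (fst_le_Cmod (a, b)) as Ha. pose proof (snd_le_Cmod (a, b)) as Hb. simpl in Ha, Hb.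
    assert (Hnear : forall s t, Rabs s < m -> Rabs t < m ->
       Cmod (((x0 + s)%R, (y0 + t)%R) - (x0, y0))%C < 2 * m).
    { intros s t Hs' Ht'. eapply Rle_lt_trans; [apply Cmod_le_sum|]. simpl.
      replace (x0 + s + - x0) with s by ring. replace (y0 + t + - y0) with t by ring. lra. }
    assert (H := increment_split x0 y0 a b A D B (eps / 2) m ltac:(lra) ltac:(lra)).
    assert (H' : Rabs (u (x0 + a) (y0 + b) - u x0 y0 - (ux x0 y0 * a + uy x0 y0 * b) -
      (A / 2 * a ^ 2 + B * (a * b) + D / 2 * b ^ 2)) <= 2 * (eps / 2) * (a ^ 2 + b ^ 2)).
    { apply H.
      - intros s t Hs' Ht'. apply Hin; lra.
      - intros s Hs'. left. apply (H2 ((x0 + s)%R, (y0 + b)%R)).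
        specialize (Hnear s b Hs' ltac:(lra)). lra.
      - intros t Ht'. left. apply (H3 (x0, (y0 + t)%R)).
        specialize (Hnear 0 t ltac:(rewrite Rabs_R0; lra) Ht'). rewrite Rplus_0_r in Hnear. lra.
      - apply H1. lra. }
    rewrite Cmod_sqr. pose proof (Hlap _ Hz) as El. simpl in El. rewrite <- El.
    simpl fst. simpl snd. fold A D.
    unfold Cplus, Cmult. simpl fst. simpl snd. rewrite !Rplus_0_r.
    replace (2 * (eps / 2)) with eps in H' by field.
    match goal with |- Rabs ?x <= _ => match type of H' with Rabs ?y <= _ =>
      replace x with y by field end end. exact H'.
  - set (K := fun z : C => Cmod (z - (x0, y0))%C <= 6 * d).
    assert (HK : rel_compact O K) by (apply rel_compact_disc, Hdisc).
    destruct (rel_compact_cont_bound O K _ HK Hux) as [M1 [P1 HM1]].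
    destruct (rel_compact_cont_bound O K _ HK Huy) as [M2 [P2 HM2]].
    destruct (rel_compact_cont_bound O K _ HK Huxx) as [M3 [P3 HM3]].
    destruct (rel_compact_cont_bound O K _ HK Huyy) as [M4 [P4 HM4]].
    destruct (rel_compact_cont_bound O K _ HK Hfyc) as [M5 [P5 HM5]].
    set (M := M1 + M2 + M3 + M4 + M5).
    assert (HM : 0 <= M /\ M1 + M2 <= M /\ M2 <= M /\ M3 <= M /\ M4 <= M /\ M5 <= M) by (unfold M; lra).
    set (L := 2 * M / d + (M + 1) * d / 2).
    assert (HL : 0 <= L).
    { unfold L. assert (0 <= 2 * M / d).
      { apply Rmult_le_pos; [lra|]. left. apply Rinv_0_lt_compat, Hd. } nra. }
    exists d, (2 * (M + L)). split; [exact Hd|]. intros [x y] [a b] Hw Hh.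
    pose proof (fst_le_Cmod ((x, y) - (x0, y0))%C) as Hx. simpl in Hx.
    pose proof (snd_le_Cmod ((x, y) - (x0, y0))%C) as Hy. simpl in Hy.
    fold (Rminus x x0) in Hx. fold (Rminus y y0) in Hy.
    pose proof (fst_le_Cmod (a, b)) as Ha. pose proof (snd_le_Cmod (a, b)) as Hb. simpl in Ha, Hb.
    assert (HKs : forall s t, Rabs s < d -> Rabs t < d -> K ((x + s)%R, (y + t)%R)).
    { intros s t Hs Ht. apply box_in_disc.
      - replace (x + s - x0) with ((x - x0) + s) by ring. pose proof (Rabs_triang (x - x0) s). lra.
      - replace (y + t - y0) with ((y - y0) + t) by ring. pose proof (Rabs_triang (y - y0) t). lra. }
    assert (H00 : Rabs 0 < d) by (rewrite Rabs_R0; exact Hd).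
    assert (HKx : K (x, y)).
    { specialize (HKs 0 0 H00 H00). rewrite !Rplus_0_r in HKs. exact HKs. }
    simpl fst. simpl snd. split.
    + eapply Rle_trans; [apply Cmod_le_sum|]. simpl. rewrite Rabs_Ropp.
      specialize (HM1 _ HKx). specialize (HM2 _ HKx). simpl in HM1, HM2. lra.
    + assert (H := increment_split x y a b 0 0 0 (M + L) d ltac:(lra) ltac:(lra)).
      rewrite Cmod_sqr. unfold Cplus, Cmult. simpl fst. simpl snd.
      match goal with |- Rabs ?z <= _ => replace z with (u (x + a) (y + b) - u x y -
       (ux x y * a + uy x y * b) - (0 / 2 * a ^ 2 + 0 * (a * b) + 0 / 2 * b ^ 2)) by field end.
      apply H.
      * intros s t Hs Ht. apply Hdisc, HKs; assumption.
      * intros s Hs. rewrite Rminus_0_r.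
        specialize (HM3 _ (HKs s b Hs ltac:(lra))). simpl in HM3. lra.
      * intros t Ht. rewrite Rminus_0_r. specialize (HKs 0 t H00 Ht). rewrite Rplus_0_r in HKs.
        specialize (HM4 _ HKs). simpl in HM4. lra.
      * rewrite Rmult_0_l, Rminus_0_r. eapply Rle_trans.
        -- apply (ux_lipschitz x0 y0 d Hd Hdisc M); try lra.
           ++ intros z Hz'. specialize (HM2 z Hz'). lra.
           ++ intros z Hz'. specialize (HM5 z Hz'). lra.
        -- fold L. apply Rmult_le_compat_r; [apply Rabs_pos|lra].
Qed.

End Regularity.

(** * Curves and completeness *)

Lemma continuity_pt_sqr x : continuity_pt (fun t => t ^ 2) x.
Proof. apply derivable_continuous_pt, derivable_pt_pow. Qed.

Lemma ccont_scal c f z : ccont f z -> ccont (fun p => c * f p) z.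
Proof.
  intros H. apply (ccont_ext (fun p => c * f p + 0 * f p)); [intros p; ring|].
  apply ccont_lin; exact H.
Qed.

Lemma ccont_mult f h z : ccont f z -> ccont h z -> ccont (fun p => f p * h p) z.
Proof.
  intros Hf Hh.
  apply (ccont_ext (fun p => / 4 * (1 * f p + 1 * h p) ^ 2 + - / 4 * (1 * f p + -1 * h p) ^ 2)).
  { intros p. field. }
  apply (ccont_lin (fun p => (1 * f p + 1 * h p) ^ 2) (fun p => (1 * f p + -1 * h p) ^ 2)).
  - apply (ccont_comp (fun t => t ^ 2) (fun p => 1 * f p + 1 * h p)).
    + apply continuity_pt_sqr.
    + apply ccont_lin; assumption.
  - apply (ccont_comp (fun t => t ^ 2) (fun p => 1 * f p + -1 * h p)).
    + apply continuity_pt_sqr.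
    + apply ccont_lin; assumption.
Qed.

Definition loglam (lam : R -> R -> R) (z : C) : R := ln (lamv lam z).

Lemma exp_loglam O lam z : hyperbolic_metric O lam -> O z -> exp (loglam lam z) = lamv lam z.
Proof. intros [H _] Hz. apply exp_ln, H, Hz. Qed.

Lemma hyperbolic_cont O lam z : hyperbolic_metric O lam -> O z -> ccont (lamv lam) z.
Proof. intros [_ [H _]] Hz. apply cont2_ccont, H, Hz. Qed.

(** The curvature equation feeds the regularity theorem: its right side [exp (2 u)] has the
    continuous [y]-derivative [2 uy exp (2 u)]. *)
Lemma hyperbolic_jet_on O lam : is_open O -> hyperbolic_metric O lam ->
  exists g, jet_on O (loglam lam) g (fun z => exp (2 * loglam lam z)).
Proof.
  intros HO Hh. pose proof Hh as [Hpos [Hcont [[ux [uy [uxx [uyy H]]]] _]]].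
  set (u := fun x y => ln (lam x y)).
  assert (Huc : forall z, O z -> ccont (fun p => u (fst p) (snd p)) z).
  { intros z Hz. apply (ccont_comp ln (fun p : C => lam (fst p) (snd p))).
    - apply continuity_pt_ln, Hpos, Hz.
    - apply cont2_ccont, Hcont, Hz. }
  eexists.
  apply (regular_jet_on O u ux uy uxx uyy (fun x y => exp (2 * u x y))
    (fun x y => 2 * (uy x y * exp (2 * u x y))) HO);
    try (intros z Hz; apply cont2_ccont, (H z Hz)).
  - intros z Hz. destruct (H z Hz) as [H1 [H2 [H3 [H4 _]]]].
    constructor; try (apply is_derive_Reals; assumption). apply Huc, Hz.
  - intros z Hz. destruct (H z Hz) as [_ [_ [_ [_ [_ [_ [_ [_ E]]]]]]]].
    rewrite E, exp_double. unfold u. rewrite exp_ln; [reflexivity|]. apply Hpos, Hz.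
  - intros z Hz. destruct (H z Hz) as [_ [H2 _]]. apply is_derive_Reals in H2.
    fold (u (fst z)) in H2.
    apply (is_derive_eq _ _ (2 * uy (fst z) (snd z) * exp (2 * u (fst z) (snd z)))); [|ring].
    apply (is_derive_comp exp (fun t => 2 * u (fst z) t)).
    + apply is_derive_Reals, derivable_pt_lim_exp.
    + apply (is_derive_scal (u (fst z))), H2.
  - intros z Hz. pose proof (cont2_ccont _ _ (proj1 (proj2 (proj2 (proj2 (proj2 (proj2 (H z Hz)))))))) as Hc.
    apply (ccont_scal 2 (fun p : C => uy (fst p) (snd p) * exp (2 * u (fst p) (snd p)))).
    apply (ccont_mult (fun p : C => uy (fst p) (snd p))); [exact Hc|].
    apply (ccont_exp (fun p : C => 2 * u (fst p) (snd p))).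
    apply (ccont_scal 2 (fun p : C => u (fst p) (snd p))), Huc, Hz.
Qed.

Definition ramp (t : R) : R := (t + Rabs t) / 2.

Lemma ramp_left t : t <= 0 -> ramp t = 0.
Proof. intros H. unfold ramp. rewrite Rabs_left1 by exact H. field. Qed.

Lemma ramp_right t : 0 <= t -> ramp t = t.
Proof. intros H. unfold ramp. rewrite Rabs_right by lra. field. Qed.

Lemma is_derive_ramp_sqr t : is_derive (fun t => ramp t ^ 2) t (2 * ramp t).
Proof.
  apply is_derive_Reals. intros eps He. exists (mkposreal _ He). intros h Hh Hd. simpl in Hd.
  assert (B : Rabs (ramp (t + h) ^ 2 - ramp t ^ 2 - 2 * ramp t * h) <= h ^ 2).
  { apply Rabs_le. unfold ramp, Rabs. repeat destruct Rcase_abs; nra. }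
  replace ((ramp (t + h) ^ 2 - ramp t ^ 2) / h - 2 * ramp t) with
    ((ramp (t + h) ^ 2 - ramp t ^ 2 - 2 * ramp t * h) * / h) by (field; exact Hh).
  rewrite Rabs_mult, Rabs_inv. apply Rle_lt_trans with (2 := Hd).
  assert (0 < Rabs h) by (apply Rabs_pos_lt, Hh).
  apply (Rmult_le_reg_r (Rabs h)); [assumption|].
  rewrite Rmult_assoc, Rinv_l, Rmult_1_r by lra. rewrite <- (pow2_abs h) in B. lra.
Qed.

(* A C^1 step from 0 to 1 on [0, 1], constant outside: reparametrised by it, curves can be
   joined without losing smoothness. *)
Definition step (t : R) : R := 2 * ramp t ^ 2 + -4 * ramp (t - 1 / 2) ^ 2 + 2 * ramp (t - 1) ^ 2.
Definition dstep (t : R) : R := 4 * ramp t - 8 * ramp (t - 1 / 2) + 4 * ramp (t - 1).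

Lemma is_derive_step t : is_derive step t (dstep t).
Proof.
  assert (H : forall c, is_derive (fun s => ramp (s - c) ^ 2) t (2 * ramp (t - c))).
  { intros c. apply (is_derive_eq _ _ (1 * (2 * ramp (t - c)))); [|ring].
    apply (is_derive_comp (fun t => ramp t ^ 2) (fun s => s - c)); [apply is_derive_ramp_sqr|].
    auto_derive; [auto|ring]. }
  apply (is_derive_eq _ _ ((2 * (2 * ramp t) + -4 * (2 * ramp (t - 1 / 2))) +
    2 * (2 * ramp (t - 1)))); [|unfold dstep; ring].
  apply (is_derive_plus (fun t => 2 * ramp t ^ 2 + -4 * ramp (t - 1 / 2) ^ 2)).
  - apply (is_derive_lin (fun t => ramp t ^ 2)); [apply is_derive_ramp_sqr|apply H].
  - apply (is_derive_scal (fun t => ramp (t - 1) ^ 2)), H.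
Qed.

Lemma step_low t : t <= 0 -> step t = 0 /\ dstep t = 0.
Proof. intros H. unfold step, dstep. rewrite !ramp_left by lra. split; ring. Qed.

Lemma step_high t : 1 <= t -> step t = 1 /\ dstep t = 0.
Proof. intros H. unfold step, dstep. rewrite !ramp_right by lra. split; field. Qed.

Lemma step_range t : 0 <= t <= 1 -> 0 <= step t <= 1 /\ 0 <= dstep t.
Proof.
  intros H. unfold step, dstep. rewrite (ramp_right t), (ramp_left (t - 1)) by lra.
  destruct (Rle_lt_dec t (1 / 2)).
  - rewrite ramp_left by lra. nra.
  - rewrite ramp_right by lra. nra.
Qed.

Lemma curve_near (g1 g2 : R -> R) t r : continuity_pt g1 t -> continuity_pt g2 t -> 0 < r ->
  exists d, 0 < d /\ forall s, Rabs (s - t) < d -> Cmod ((g1 s, g2 s) - (g1 t, g2 t))%C < r.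
Proof.
  intros H1 H2 Hr.
  destruct (H1 (r / 2) ltac:(lra)) as [a1 [Ha1 K1]]. destruct (H2 (r / 2) ltac:(lra)) as [a2 [Ha2 K2]].
  exists (Rmin a1 a2). split; [apply Rmin_pos; assumption|]. intros s Hs.
  destruct (Req_dec s t) as [->|Hne].
  { rewrite Cmod_diag. exact Hr. }
  eapply Rle_lt_trans; [apply Cmod_le_sum|]. simpl.
  assert (L1 : Rabs (s - t) < a1) by (apply Rlt_le_trans with (1 := Hs), Rmin_l).
  assert (L2 : Rabs (s - t) < a2) by (apply Rlt_le_trans with (1 := Hs), Rmin_r).
  assert (Hx : D_x no_cond t s) by (split; [exact I|auto]).
  specialize (K1 s (conj Hx L1)). specialize (K2 s (conj Hx L2)).
  simpl in K1, K2. unfold R_dist, Rminus in K1, K2. lra.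
Qed.

Section Curves.
Variables (O : C -> Prop) (lam : R -> R -> R).
Hypothesis lam_pos : forall z, O z -> 0 < lamv lam z.
Hypothesis lam_cont : forall z, O z -> ccont (lamv lam) z.

Definition speed (g1 g2 d1 d2 : R -> R) (t : R) : R :=
  lam (g1 t) (g2 t) * sqrt (d1 t ^ 2 + d2 t ^ 2).

Lemma lam_along_continuous (g1 g2 : R -> R) t : continuity_pt g1 t -> continuity_pt g2 t ->
  O (g1 t, g2 t) -> continuity_pt (fun t => lam (g1 t) (g2 t)) t.
Proof.
  intros H1 H2 HO eps He. destruct (lam_cont _ HO eps He) as [r [Hr H]].
  destruct (curve_near g1 g2 t r H1 H2 Hr) as [d [Hd Hn]].
  exists d. split; [exact Hd|]. intros s [_ Hs]. apply (H (g1 s, g2 s)), Hn, Hs.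
Qed.

Lemma speed_continuous g1 g2 d1 d2 t : continuity_pt g1 t -> continuity_pt g2 t ->
  continuity d1 -> continuity d2 -> O (g1 t, g2 t) -> continuity_pt (speed g1 g2 d1 d2) t.
Proof.
  intros H1 H2 H3 H4 HO. unfold speed. apply continuity_pt_mult.
  - apply lam_along_continuous; assumption.
  - apply (continuity_pt_comp (fun t => d1 t ^ 2 + d2 t ^ 2) sqrt).
    + apply continuity_pt_plus.
      * apply (continuity_pt_comp d1 (fun t => t ^ 2)); [apply H3|apply continuity_pt_sqr].
      * apply (continuity_pt_comp d2 (fun t => t ^ 2)); [apply H4|apply continuity_pt_sqr].
    + apply continuity_pt_sqrt. pose proof (pow2_ge_0 (d1 t)). pose proof (pow2_ge_0 (d2 t)). lra.
Qed.

Lemma derivable_lim_continuity g d : (forall t, derivable_pt_lim g t (d t)) -> continuity g.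
Proof. intros H t. apply derivable_continuous_pt. exists (d t). apply H. Qed.

Lemma speed_ex_RInt g1 g2 d1 d2 :
  (forall t, derivable_pt_lim g1 t (d1 t)) -> (forall t, derivable_pt_lim g2 t (d2 t)) ->
  continuity d1 -> continuity d2 -> (forall t, 0 <= t <= 1 -> O (g1 t, g2 t)) ->
  forall a b, 0 <= a -> a <= b -> b <= 1 -> ex_RInt (speed g1 g2 d1 d2) a b.
Proof.
  intros H1 H2 H3 H4 HO a b Ha Hab Hb. apply (ex_RInt_continuous (V := R_CompleteNormedModule)).
  intros t Ht. rewrite Rmin_left, Rmax_right in Ht by lra.
  apply continuity_pt_filterlim, speed_continuous; try assumption.
  - apply (derivable_lim_continuity g1 d1 H1).
  - apply (derivable_lim_continuity g2 d2 H2).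
  - apply HO. lra.
Qed.

Lemma short_curve_intro (a b : C) r g1 g2 d1 d2 :
  (forall t, derivable_pt_lim g1 t (d1 t)) -> (forall t, derivable_pt_lim g2 t (d2 t)) ->
  continuity d1 -> continuity d2 ->
  g1 0 = fst a -> g2 0 = snd a -> g1 1 = fst b -> g2 1 = snd b ->
  (forall t, 0 <= t <= 1 -> O (g1 t, g2 t)) ->
  RInt (speed g1 g2 d1 d2) 0 1 < r -> short_curve O lam a b r.
Proof.
  intros H1 H2 H3 H4 E1 E2 E3 E4 HO Hr. exists g1, g2, d1, d2.
  repeat (split; [assumption|]).
  assert (pr : Riemann_integrable (speed g1 g2 d1 d2) 0 1).
  { apply ex_RInt_Reals_0, speed_ex_RInt; try assumption; lra. }
  exists pr. rewrite <- RInt_Reals. exact Hr.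
Qed.

Lemma short_curve_seg (a b : C) m r :
  (forall t, 0 <= t <= 1 -> O (seg a b t) /\ lamv lam (seg a b t) <= m) ->
  m * Cmod (b - a)%C < r -> short_curve O lam a b r.
Proof.
  intros H Hm.
  set (g1 := fun t => fst a + (fst b - fst a) * t). set (g2 := fun t => snd a + (snd b - snd a) * t).
  assert (Es : forall t, (g1 t, g2 t) = seg a b t).
  { intros t. unfold g1, g2, seg, Cplus, Cminus, Cmult, Copp, Cplus, RtoC. simpl. f_equal; ring. }
  assert (H1 : forall t, derivable_pt_lim g1 t (fst b - fst a)).
  { intros t. apply is_derive_Reals. unfold g1. auto_derive; [auto|ring]. }
  assert (H2 : forall t, derivable_pt_lim g2 t (snd b - snd a)).
  { intros t. apply is_derive_Reals. unfold g2. auto_derive; [auto|ring]. }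
  assert (HO : forall t, 0 <= t <= 1 -> O (g1 t, g2 t)).
  { intros t Ht. rewrite Es. apply H, Ht. }
  assert (Hc : forall c : R, continuity (fun _ => c)) by (intros c; reg).
  apply (short_curve_intro a b r g1 g2 (fun _ => fst b - fst a) (fun _ => snd b - snd a)); auto;
    try (unfold g1, g2; ring).
  apply Rle_lt_trans with (2 := Hm).
  replace (m * Cmod (b - a)%C) with (RInt (fun _ => m * Cmod (b - a)%C) 0 1).
  - apply RInt_le; [lra|apply speed_ex_RInt; auto; lra|apply ex_RInt_const|].
    intros t Ht. unfold speed. apply Rmult_le_compat_r; [apply sqrt_pos|].
    destruct (H t ltac:(lra)) as [_ H3]. rewrite <- Es in H3. exact H3.
  - rewrite RInt_const. unfold scal. simpl. unfold mult. simpl. ring.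
Qed.

Lemma speed_reparam g1 g2 d1 d2 (s ds : R -> R) (a b : R) :
  (forall t, derivable_pt_lim g1 t (d1 t)) -> (forall t, derivable_pt_lim g2 t (d2 t)) ->
  continuity d1 -> continuity d2 -> (forall t, 0 <= t <= 1 -> O (g1 t, g2 t)) ->
  a <= b -> s a = 0 -> s b = 1 ->
  (forall t, a <= t <= b -> 0 <= s t <= 1 /\ 0 <= ds t) ->
  (forall t, is_derive s t (ds t)) -> continuity ds ->
  RInt (speed (fun t => g1 (s t)) (fun t => g2 (s t)) (fun t => d1 (s t) * ds t)
    (fun t => d2 (s t) * ds t)) a b = RInt (speed g1 g2 d1 d2) 0 1.
Proof.
  intros H1 H2 H3 H4 HO Hab Ea Eb Hs Hd Hc.
  rewrite <- Ea, <- Eb. rewrite <- (RInt_comp (speed g1 g2 d1 d2) s ds a b).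
  - apply RInt_ext. intros t Ht. rewrite Rmin_left, Rmax_right in Ht by lra.
    destruct (Hs t ltac:(lra)) as [_ Hds]. unfold speed, scal. simpl. unfold mult. simpl.
    replace (sqrt _) with (ds t * sqrt (d1 (s t) ^ 2 + d2 (s t) ^ 2)); [simpl; ring|].
    rewrite <- (sqrt_pow2 (ds t)) at 1 by exact Hds.
    rewrite <- sqrt_mult; [f_equal; ring|apply pow2_ge_0|].
    pose proof (pow2_ge_0 (d1 (s t))). pose proof (pow2_ge_0 (d2 (s t))). lra.
  - intros t Ht. rewrite Rmin_left, Rmax_right in Ht by lra.
    apply continuity_pt_filterlim, speed_continuous; try assumption.
    + apply (derivable_lim_continuity g1 d1 H1).
    + apply (derivable_lim_continuity g2 d2 H2).
    + apply HO, Hs, Ht.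
  - intros t _. split; [apply Hd|apply continuity_pt_filterlim, Hc].
Qed.

Lemma is_derive_step_affine (c : R) t : is_derive (fun t => step (2 * t - c)) t (2 * dstep (2 * t - c)).
Proof.
  apply (is_derive_comp step (fun t => 2 * t - c)); [apply is_derive_step|].
  auto_derive; [auto|ring].
Qed.

Lemma continuity_dstep_affine (c : R) : continuity (fun t => 2 * dstep (2 * t - c)).
Proof. unfold dstep, ramp. reg. Qed.

(** Each summand rests while the other one moves, and [h 0] cancels the resting value of the second.
    One formula on the whole line makes the result C^1 without matching derivatives at [1/2]. *)
Definition join (g h : R -> R) (t : R) : R := g (step (2 * t - 0)) + h (step (2 * t - 1)) - h 0.
Definition djoin (dg dh : R -> R) (t : R) : R :=
  dg (step (2 * t - 0)) * (2 * dstep (2 * t - 0)) + dh (step (2 * t - 1)) * (2 * dstep (2 * t - 1)).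

Lemma join_left g h t : t <= 1 / 2 -> join g h t = g (step (2 * t - 0)).
Proof. intros H. unfold join. destruct (step_low (2 * t - 1) ltac:(lra)) as [-> _]. ring. Qed.

Lemma join_right g h t : g 1 = h 0 -> 1 / 2 <= t -> join g h t = h (step (2 * t - 1)).
Proof. intros E H. unfold join. destruct (step_high (2 * t - 0) ltac:(lra)) as [-> _]. rewrite E. ring. Qed.

Lemma djoin_left g h t : t <= 1 / 2 -> djoin g h t = g (step (2 * t - 0)) * (2 * dstep (2 * t - 0)).
Proof. intros H. unfold djoin. destruct (step_low (2 * t - 1) ltac:(lra)) as [_ ->]. ring. Qed.

Lemma djoin_right g h t : 1 / 2 <= t -> djoin g h t = h (step (2 * t - 1)) * (2 * dstep (2 * t - 1)).
Proof. intros H. unfold djoin. destruct (step_high (2 * t - 0) ltac:(lra)) as [_ ->]. ring. Qed.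

Lemma join_derive g h dg dh t :
  (forall t, derivable_pt_lim g t (dg t)) -> (forall t, derivable_pt_lim h t (dh t)) ->
  derivable_pt_lim (join g h) t (djoin dg dh t).
Proof.
  intros Hg Hh. apply is_derive_Reals.
  apply (is_derive_ext (fun t => 1 * g (step (2 * t - 0)) + 1 * (h (step (2 * t - 1)) - h 0))).
  { intros s. unfold join. simpl. ring. }
  apply (is_derive_eq _ _ (1 * ((2 * dstep (2 * t - 0)) * dg (step (2 * t - 0))) +
    1 * ((2 * dstep (2 * t - 1)) * dh (step (2 * t - 1))))); [|unfold djoin; ring].
  apply (is_derive_lin (fun t => g (step (2 * t - 0))) (fun t => h (step (2 * t - 1)) - h 0)).
  - apply (is_derive_comp g (fun t => step (2 * t - 0))); [apply is_derive_Reals, Hg|].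
    apply is_derive_step_affine.
  - apply (is_derive_eq _ _ ((2 * dstep (2 * t - 1)) * dh (step (2 * t - 1)) - 0)); [|ring].
    apply (is_derive_minus (fun t => h (step (2 * t - 1))) (fun _ => h 0)); [|apply @is_derive_const].
    apply (is_derive_comp h (fun t => step (2 * t - 1))); [apply is_derive_Reals, Hh|].
    apply is_derive_step_affine.
Qed.

Lemma djoin_continuity dg dh : continuity dg -> continuity dh -> continuity (djoin dg dh).
Proof.
  intros Hg Hh t. apply continuity_pt_plus; apply continuity_pt_mult.
  - apply (continuity_pt_comp (fun t => step (2 * t - 0)) dg); [|apply Hg].
    apply derivable_continuous_pt. eexists. apply is_derive_Reals, is_derive_step_affine.
  - apply continuity_dstep_affine.
  - apply (continuity_pt_comp (fun t => step (2 * t - 1)) dh); [|apply Hh].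
    apply derivable_continuous_pt. eexists. apply is_derive_Reals, is_derive_step_affine.
  - apply continuity_dstep_affine.
Qed.

Lemma short_curve_cat (a b c : C) r1 r2 :
  short_curve O lam a b r1 -> short_curve O lam b c r2 -> short_curve O lam a c (r1 + r2).
Proof.
  intros [g1 [g2 [d1 [d2 [A1 [A2 [A3 [A4 [A5 [A6 [A7 [A8 [A9 [prA HA]]]]]]]]]]]]]].
  intros [h1 [h2 [e1 [e2 [B1 [B2 [B3 [B4 [B5 [B6 [B7 [B8 [B9 [prB HB]]]]]]]]]]]]]].
  rewrite <- RInt_Reals in HA, HB. fold (speed g1 g2 d1 d2) in HA. fold (speed h1 h2 e1 e2) in HB.
  assert (E1 : g1 1 = h1 0) by congruence. assert (E2 : g2 1 = h2 0) by congruence.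
  assert (HJ : forall t, 0 <= t <= 1 -> O (join g1 h1 t, join g2 h2 t)).
  { intros t Ht. destruct (Rle_lt_dec t (1 / 2)) as [K|K].
    - rewrite !join_left by exact K. apply A9. apply step_range. lra.
    - rewrite !join_right by (assumption || lra). apply B9. apply step_range. lra. }
  assert (S00 : step (2 * 0 - 0) = 0) by (apply step_low; lra).
  assert (S01 : step (2 * (1 / 2) - 0) = 1) by (apply step_high; lra).
  assert (S10 : step (2 * (1 / 2) - 1) = 0) by (apply step_low; lra).
  assert (S11 : step (2 * 1 - 1) = 1) by (apply step_high; lra).
  assert (J1 : forall t, derivable_pt_lim (join g1 h1) t (djoin d1 e1 t))
    by (intros t; apply join_derive; assumption).
  assert (J2 : forall t, derivable_pt_lim (join g2 h2) t (djoin d2 e2 t))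
    by (intros t; apply join_derive; assumption).
  pose proof (djoin_continuity d1 e1 A3 B3) as J3. pose proof (djoin_continuity d2 e2 A4 B4) as J4.
  apply (short_curve_intro a c (r1 + r2) (join g1 h1) (join g2 h2) (djoin d1 e1) (djoin d2 e2));
    try assumption.
  - rewrite join_left by lra. rewrite S00. exact A5.
  - rewrite join_left by lra. rewrite S00. exact A6.
  - rewrite join_right by (assumption || lra). rewrite S11. exact B7.
  - rewrite join_right by (assumption || lra). rewrite S11. exact B8.
  - rewrite <- (RInt_Chasles _ 0 (1 / 2) 1);
      [|apply speed_ex_RInt; (assumption || lra)|apply speed_ex_RInt; (assumption || lra)].
    apply Rplus_lt_compat.
    + eapply Rle_lt_trans; [right|exact HA].
      rewrite <- (speed_reparam g1 g2 d1 d2 (fun t => step (2 * t - 0)) (fun t => 2 * dstep (2 * t - 0))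
        0 (1 / 2)); try assumption; try lra.
      * apply RInt_ext. intros t Ht. rewrite Rmin_left, Rmax_right in Ht by lra.
        unfold speed. rewrite !join_left, !djoin_left by lra. reflexivity.
      * intros t Ht. destruct (step_range (2 * t - 0)); lra.
      * intros t. apply is_derive_step_affine.
      * apply continuity_dstep_affine.
    + eapply Rle_lt_trans; [right|exact HB].
      rewrite <- (speed_reparam h1 h2 e1 e2 (fun t => step (2 * t - 1)) (fun t => 2 * dstep (2 * t - 1))
        (1 / 2) 1); try assumption; try lra.
      * apply RInt_ext. intros t Ht. rewrite Rmin_left, Rmax_right in Ht by lra.
        unfold speed. rewrite !join_right, !djoin_right by (assumption || lra). reflexivity.
      * intros t Ht. destruct (step_range (2 * t - 1)); lra.
      * intros t. apply is_derive_step_affine.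
      * apply continuity_dstep_affine.
Qed.

Lemma chain_short_curve a b r : chain_dist O (lamv lam) a b r -> short_curve O lam a b r.
Proof.
  induction 1 as [a b m r H Hm Hr|a b c r1 r2 _ IH1 _ IH2].
  - apply (short_curve_seg a b m r H Hm).
  - apply (short_curve_cat a b c); assumption.
Qed.

(* The bump [(r^2 - |z - p|^2)_+^2] is C^1 with gradient at most [4 r^3], supported where
   [lam >= c]; its variation along a curve is thus controlled by the length, with no need
   for an exit time. *)
Lemma short_curve_close (a p : C) L r c : 0 < r -> 0 < c ->
  (forall w, Cmod (w - p)%C < r -> c <= lamv lam w) ->
  short_curve O lam a p L -> 4 * L < c * r -> Cmod (a - p)%C < r.
Proof.
  intros Hr Hc Hlam [g1 [g2 [d1 [d2 [A1 [A2 [A3 [A4 [A5 [A6 [A7 [A8 [A9 [prA HA]]]]]]]]]]]]]] HL.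
  rewrite <- RInt_Reals in HA. fold (speed g1 g2 d1 d2) in HA.
  destruct p as [p1 p2]. simpl in A7, A8.
  set (q := fun t => r ^ 2 - (g1 t - p1) ^ 2 - (g2 t - p2) ^ 2).
  set (dq := fun t => - 2 * ((g1 t - p1) * d1 t + (g2 t - p2) * d2 t)).
  set (D := fun t => dq t * (2 * ramp (q t))).
  pose proof (derivable_lim_continuity g1 d1 A1) as Cg1.
  pose proof (derivable_lim_continuity g2 d2 A2) as Cg2.
  assert (HD : forall t, is_derive (fun t => ramp (q t) ^ 2) t (D t)).
  { intros t. apply (is_derive_comp (fun t => ramp t ^ 2) q); [apply is_derive_ramp_sqr|].
    pose proof (proj2 (is_derive_Reals _ _ _) (A1 t)) as D1.
    pose proof (proj2 (is_derive_Reals _ _ _) (A2 t)) as D2. unfold q, dq. auto_derive.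
    - split; [exists (d1 t); exact D1|]. split; [exists (d2 t); exact D2|auto].
    - replace (Derive (fun x => g1 x) t) with (d1 t) by (symmetry; apply is_derive_unique, D1).
      replace (Derive (fun x => g2 x) t) with (d2 t) by (symmetry; apply is_derive_unique, D2). ring. }
  assert (CD : continuity D) by (unfold D, dq, q, ramp; reg).
  set (k := 4 * r ^ 3 / c).
  assert (Hk : 0 < k).
  { unfold k. apply Rdiv_lt_0_compat; [|exact Hc]. apply Rmult_lt_0_compat; [lra|apply pow_lt, Hr]. }
  assert (HI : is_RInt D 0 1 (ramp (q 1) ^ 2 - ramp (q 0) ^ 2)).
  { apply (is_RInt_derive (fun t => ramp (q t) ^ 2) D); intros t _; [apply HD|apply continuity_pt_filterlim, CD]. }
  assert (Hex : ex_RInt (speed g1 g2 d1 d2) 0 1) by (apply speed_ex_RInt; (assumption || lra)).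
  assert (Hle : RInt D 0 1 <= k * RInt (speed g1 g2 d1 d2) 0 1).
  { change (RInt D 0 1 <= scal k (RInt (speed g1 g2 d1 d2) 0 1)).
    rewrite <- (RInt_scal (V := R_CompleteNormedModule) (speed g1 g2 d1 d2) 0 1 k Hex).
    apply RInt_le; [lra|eexists; exact HI|apply (ex_RInt_scal (V := R_NormedModule)), Hex|].
    intros t Ht. unfold scal. simpl. unfold mult. simpl. unfold speed, D.
    pose proof (lam_pos _ (A9 t ltac:(lra))) as Hlp. unfold lamv in Hlp. simpl in Hlp.
    set (v := sqrt (d1 t ^ 2 + d2 t ^ 2)).
    assert (Hv : 0 <= v) by apply sqrt_pos.
    assert (Hv2 : v ^ 2 = d1 t ^ 2 + d2 t ^ 2).
    { unfold v. apply pow2_sqrt. pose proof (pow2_ge_0 (d1 t)). pose proof (pow2_ge_0 (d2 t)). lra. }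
    assert (Hrhs : 0 <= k * (lam (g1 t) (g2 t) * v)).
    { apply Rmult_le_pos; [lra|]. apply Rmult_le_pos; lra. }
    destruct (Rle_lt_dec (q t) 0) as [Hq|Hq].
    - rewrite ramp_left by exact Hq. rewrite !Rmult_0_r. exact Hrhs.
    - rewrite ramp_right by lra.
      assert (Hin : c <= lam (g1 t) (g2 t)).
      { apply (Hlam (g1 t, g2 t)). apply Rsqr_incrst_0; [|apply Cmod_ge_0|lra].
        rewrite !Rsqr_pow2, Cmod_sqr. simpl. unfold q in Hq. unfold Rminus in Hq. lra. }
      set (x := g1 t - p1) in *. set (y := g2 t - p2) in *.
      assert (Hxy : x ^ 2 + y ^ 2 < r ^ 2) by (unfold q in Hq; fold x y in Hq; lra).
      assert (Hqr : q t <= r ^ 2).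
      { unfold q. fold x y. pose proof (pow2_ge_0 x). pose proof (pow2_ge_0 y). lra. }
      assert (Hdq1 : dq t <= 2 * (r * v)).
      { unfold dq. fold x y.
        assert (Hcs : (x * d1 t + y * d2 t) ^ 2 <= (r * v) ^ 2).
        { rewrite Rpow_mult_distr, Hv2.
          apply Rle_trans with ((x ^ 2 + y ^ 2) * (d1 t ^ 2 + d2 t ^ 2)).
          - pose proof (pow2_ge_0 (x * d2 t - y * d1 t)). lra.
          - apply Rmult_le_compat_r; [rewrite <- Hv2; apply pow2_ge_0|lra]. }
        assert (- (r * v) <= x * d1 t + y * d2 t); [|lra].
        apply Rnot_lt_le. intros K. assert (0 <= r * v) by (apply Rmult_le_pos; lra). nra. }
      apply Rle_trans with (2 * (r * v) * (2 * r ^ 2)).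
      + assert (0 <= r * v) by (apply Rmult_le_pos; lra).
        apply Rle_trans with (2 * (r * v) * (2 * q t)).
        * apply Rmult_le_compat_r; lra.
        * apply Rmult_le_compat_l; lra.
      + apply Rle_trans with (k * (c * v)).
        * right. unfold k. field. lra.
        * apply Rmult_le_compat_l; [lra|]. apply Rmult_le_compat_r; lra. }
  rewrite (is_RInt_unique _ _ _ _ HI) in Hle.
  (* The bump has height [r^4] at [p]; the curve is too short to lose all of it, so the bump is
     still positive at [a], which puts [a] in the disc. *)
  assert (Q1 : ramp (q 1) ^ 2 = r ^ 4).
  { unfold q. rewrite A7, A8, !Rminus_diag.
    replace (r ^ 2 - 0 ^ 2 - 0 ^ 2) with (r ^ 2) by ring. rewrite ramp_right by apply pow2_ge_0. ring. }
  assert (HkL : k * RInt (speed g1 g2 d1 d2) 0 1 < r ^ 4).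
  { apply Rlt_trans with (k * L); [apply Rmult_lt_compat_l; assumption|].
    unfold k. replace (4 * r ^ 3 / c * L) with (r ^ 3 / c * (4 * L)) by (field; lra).
    replace (r ^ 4) with (r ^ 3 / c * (c * r)) by (field; lra).
    apply Rmult_lt_compat_l; [|exact HL]. apply Rdiv_lt_0_compat; [apply pow_lt, Hr|exact Hc]. }
  assert (Q0 : 0 < ramp (q 0) ^ 2) by lra.
  assert (Hq0 : 0 < q 0).
  { apply Rnot_le_lt. intros K. rewrite ramp_left in Q0 by exact K. lra. }
  apply Rsqr_incrst_0; [|apply Cmod_ge_0|lra].
  rewrite !Rsqr_pow2, Cmod_sqr. simpl. unfold q in Hq0. rewrite A5, A6 in Hq0.
  unfold Rminus in Hq0. lra.
Qed.

Lemma chain_geometric (x : nat -> C) K : (forall n, chain_dist O (lamv lam) (x n) (x (S n)) (K * (/ 2) ^ n)) ->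
  forall m n, (m <= n)%nat -> chain_dist O (lamv lam) (x m) (x n) (3 * K * (/ 2) ^ m).
Proof.
  intros H m n Hmn.
  assert (HK : 0 < K).
  { pose proof (chain_pos _ _ _ _ _ (H 0%nat)) as H0. simpl in H0. lra. }
  assert (Hp : forall n, 0 < K * (/ 2) ^ n).
  { intros j. apply Rmult_lt_0_compat; [exact HK|apply pow_lt; lra]. }
  (* The geometric tail costs [2 K / 2^m - 2 K / 2^(m + j)]; the additional [K / 2^m] keeps the
     bound positive at [j = 0], as chains require. *)
  assert (Hj : forall j, chain_dist O (lamv lam) (x m) (x (m + j)%nat)
    (3 * (K * (/ 2) ^ m) - 2 * (K * (/ 2) ^ (m + j)))).
  { induction j as [|j IH].
    - rewrite Nat.add_0_r. apply chain_refl; [apply (chain_dom _ _ _ _ _ (H m))|].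
      specialize (Hp m). lra.
    - rewrite Nat.add_succ_r.
      replace (_ - _) with ((3 * (K * (/ 2) ^ m) - 2 * (K * (/ 2) ^ (m + j))) + K * (/ 2) ^ (m + j)).
      + apply (chain_cat _ _ _ (x (m + j)%nat)); [exact IH|apply H].
      + simpl. field. }
  specialize (Hj (n - m)%nat). replace (m + (n - m))%nat with n in Hj by lia.
  eapply chain_weaken; [exact Hj|]. specialize (Hp n). lra.
Qed.

(** Polygons can be smoothed, so a geometric sequence is Cauchy in the sense of C^1 curves; short
    curves ending at the limit [p] then yield Euclidean convergence through [short_curve_close]. *)
Lemma complete_metric_chain : is_open O -> complete_metric O lam -> chain_complete O (lamv lam).
Proof.
  intros HO Hcomp x K Hx.
  assert (HK : 0 < K).
  { pose proof (chain_pos _ _ _ _ _ (Hx 0%nat)) as H0. simpl in H0. lra. }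
  destruct (Hcomp x) as [p [Hp Hlim]].
  - intros n. apply (chain_dom _ _ _ _ _ (Hx n)).
  - intros eps He.
    destruct (pow_lt_1_zero (/ 2) ltac:(rewrite Rabs_right; lra) (eps / (3 * K))) as [N HN].
    { apply Rdiv_lt_0_compat; lra. }
    assert (Hs : forall i, (N <= i)%nat -> 3 * K * (/ 2) ^ i <= eps).
    { intros i Hi. specialize (HN i Hi). rewrite Rabs_right in HN by (apply Rle_ge, pow_le; lra).
      apply Rlt_le. replace eps with (3 * K * (eps / (3 * K))) by (field; lra).
      apply Rmult_lt_compat_l; lra. }
    exists N. intros m n Hm Hn. apply chain_short_curve.
    destruct (Nat.le_ge_cases m n) as [Hmn|Hmn].
    + eapply chain_weaken; [apply (chain_geometric x K Hx m n Hmn)|apply Hs, Hm].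
    + apply chain_sym. eapply chain_weaken; [apply (chain_geometric x K Hx n m Hmn)|apply Hs, Hn].
  - exists p. split; [exact Hp|]. intros eps He.
    destruct (open_ball O p HO Hp) as [r0 [Hr0 HB]].
    pose proof (lam_pos p Hp) as Hlp.
    destruct (lam_cont p Hp (lamv lam p / 2) ltac:(lra)) as [d [Hd Hdc]].
    set (r := Rmin eps d). assert (Hr : 0 < r) by (apply Rmin_pos; lra).
    set (c := lamv lam p / 2). assert (Hc : 0 < c) by (unfold c; lra).
    destruct (Hlim (c * r / 8)) as [N HN].
    { assert (0 < c * r) by (apply Rmult_lt_0_compat; assumption). lra. }
    exists N. intros n Hn. apply Rlt_le_trans with r; [|apply Rmin_l].
    apply (short_curve_close (x n) p (c * r / 8) r c Hr Hc).
    + intros w Hw. specialize (Hdc w ltac:(pose proof (Rmin_r eps d); unfold r in Hw; lra)).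
      apply Rabs_def2 in Hdc. unfold c. lra.
    + apply HN, Hn.
    + assert (0 < c * r) by (apply Rmult_lt_0_compat; assumption). lra.
Qed.

End Curves.

(** * Strong maximum principle and components *)

Lemma jet_on_subset O O' u g L : subset O' O -> jet_on O u g L -> jet_on O' u g L.
Proof. intros HO H z Hz. apply H, HO, Hz. Qed.

Lemma jet_on_lin O u v gu gv Lu Lv (a b : R) : jet_on O u gu Lu -> jet_on O v gv Lv ->
  jet_on O (fun z => a * u z + b * v z) (fun z => RtoC a * gu z + RtoC b * gv z)%C
    (fun z => a * Lu z + b * Lv z).
Proof.
  intros Hu Hv z Hz. destruct (Hu z Hz) as [J1 [r1 [M1 [Hr1 U1]]]].
  destruct (Hv z Hz) as [J2 [r2 [M2 [Hr2 U2]]]]. split.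
  - eapply cjet_ext; [|exact (cjet_plus _ _ _ _ _ _ (cjet_affine _ _ _ 0 a J1) (cjet_affine _ _ _ 0 b J2))].
    intros s. cbv beta. ring.
  - exists (Rmin r1 r2), (Rabs a * M1 + Rabs b * M2). split; [apply Rmin_pos; assumption|].
    intros w h Hw Hh. pose proof (Rmin_l r1 r2). pose proof (Rmin_r r1 r2).
    destruct (U1 w h ltac:(lra) ltac:(lra)) as [G1 E1].
    destruct (U2 w h ltac:(lra) ltac:(lra)) as [G2 E2].
    pose proof (Rabs_pos a) as Ha. pose proof (Rabs_pos b) as Hb. split.
    + eapply Rle_trans; [apply Cmod_triangle|]. rewrite !Cmod_Rmult.
      apply Rplus_le_compat; apply Rmult_le_compat_l; assumption.
    + replace (_ - _ - _) with (a * (u (w + h)%C - u w - fst (gu w * h)%C)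
        + b * (v (w + h)%C - v w - fst (gv w * h)%C)).
      * eapply Rle_trans; [apply Rabs_triang|]. rewrite !Rabs_mult, Rmult_plus_distr_r, !Rmult_assoc.
        apply Rplus_le_compat; apply Rmult_le_compat_l; assumption.
      * unfold Cplus, Cmult, RtoC. simpl. ring.
Qed.

(** By convexity of [exp]. It turns the two nonlinear inequalities into the linear
    [Lap (u - v) <= 2 exp (2 u) (u - v)], which a barrier can exploit. *)
Lemma exp_diff_le x y : exp (2 * x) - exp (2 * y) <= 2 * exp (2 * x) * (x - y).
Proof.
  assert (H : 1 + 2 * (y - x) <= exp (2 * (y - x))).
  { destruct (Req_dec (y - x) 0) as [->|Hn]; [rewrite Rmult_0_r, exp_0; lra|].
    left. apply exp_ineq1. lra. }
  replace (exp (2 * y)) with (exp (2 * x) * exp (2 * (y - x)))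
    by (rewrite <- exp_plus; f_equal; ring).
  pose proof (exp_pos (2 * x)). nra.
Qed.

Lemma gauss_jet (z b : C) (al e c : R) :
  cjet (fun s => e * exp (- al * Cmod ((z + s) - b)%C ^ 2) + c)
    (RtoC e * (RtoC (exp (- al * Cmod (z - b)%C ^ 2)) * (RtoC (- al) * (RtoC 2 * Cconj (z - b)))))%C
    (e * exp (- al * Cmod (z - b)%C ^ 2) * (4 * al ^ 2 * Cmod (z - b)%C ^ 2 - 4 * al)).
Proof.
  pose proof (cjet_affine _ _ _ 0 (- al) (cjet_normsq (z - b)%C 1%C)) as H1.
  pose proof (cjet_comp _ _ _ exp _ _ H1 (rjet_exp _)) as H2. cbv beta in H2.
  replace (0 + - al * Cmod (z - b + 0 * 1)%C ^ 2) with (- al * Cmod (z - b)%C ^ 2) in H2.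
  2: { replace (z - b + 0 * 1)%C with (z - b)%C by ring. ring. }
  pose proof (cjet_affine _ _ _ c e H2) as H3. eapply cjet_eq.
  - eapply cjet_ext; [|exact H3]. intros s. cbv beta.
    replace (z - b + s * 1)%C with (z + s - b)%C by ring. rewrite Rplus_0_l. ring.
  - ring.
  - rewrite !Cmod_mult, Cmod_conj, !Cmod_R, Rabs_R1, Rabs_Ropp, (Rabs_right 2) by lra.
    replace ((Rabs al * (2 * Cmod (z - b)%C * 1)) ^ 2) with (4 * Rabs al ^ 2 * Cmod (z - b)%C ^ 2) by ring.
    rewrite pow2_abs. ring.
Qed.

Section StrongMax.
Variables (O : C -> Prop) (u v : C -> R) (gu gv : C -> C) (Lu Lv : C -> R).
Hypothesis Oopen : is_open O.
Hypothesis Hu : jet_on O u gu Lu.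
Hypothesis Hv : jet_on O v gv Lv.
Hypothesis HLu : forall z, O z -> Lu z <= exp (2 * u z).
Hypothesis HLv : forall z, O z -> exp (2 * v z) <= Lv z.
Hypothesis Hvu : forall z, O z -> v z <= u z.

(* If [u > v] near [b], a Gaussian barrier centred at [b] keeps [u - v] positive on the
   whole disc. *)
Lemma barrier_positive (a b : C) (r B : R) : 0 < r -> 0 < B ->
  (forall z, Cmod (z - b)%C <= 3 * r -> O z /\ 2 * exp (2 * u z) <= B) ->
  Cmod (a - b)%C < 2 * r -> v b < u b -> v a < u a.
Proof.
  intros Hr HB HK Ha Hb. apply Rnot_le_lt. intros Hle.
  assert (Hob : O b). { apply HK. rewrite Cmod_diag. lra. }
  set (g := fun z => 1 * u z + -1 * v z).
  assert (Hg : jet_on O g (fun z => RtoC 1 * gu z + RtoC (-1) * gv z)%C (fun z => 1 * Lu z + -1 * Lv z))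
    by (apply jet_on_lin; assumption).
  set (m := g b / 2). assert (Hm : 0 < m) by (unfold m, g; lra).
  destruct (jet_on_cont _ _ _ _ b Hg Hob m Hm) as [rho [Hrho Hgb]].
  (* With [al * rho^2 >= 2], the Gaussian's factor [4 al^2 |z - b|^2 - 4 al] is at least [4 al >= B]
     outside the disc of radius [rho]. *)
  set (al := 2 / rho ^ 2 + B).
  assert (Hrho2 : 0 < rho ^ 2) by (apply pow_lt, Hrho).
  assert (H2r : 0 < 2 / rho ^ 2) by (apply Rdiv_lt_0_compat; lra).
  assert (Hal : 0 < al) by (unfold al; lra).
  assert (Halr : 2 <= al * rho ^ 2).
  { unfold al. rewrite Rmult_plus_distr_r. replace (2 / rho ^ 2 * rho ^ 2) with 2 by (field; lra). nra. }
  set (psi := fun z => m * exp (- al * Cmod (z - b)%C ^ 2) + - (m * exp (- al * (3 * r) ^ 2))).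
  assert (Hpc : forall z, ccont psi z).
  { intros z. eapply cjet_ccont, gauss_jet. }
  destruct (max_attained C (fun z => Cmod (z - b)%C <= 3 * r) (fun z => 1 * psi z + -1 * g z))
    as [z [Hz Hmax]].
  - exists a. lra.
  - intros X HX. destruct (closed_disc_subseq b (3 * r) X HX) as [p [l [Hp [Hl Hlb]]]].
    exists p, l. split; [exact Hp|]. split; [exact Hlb|].
    apply (ccont_cv (fun z => 1 * psi z + -1 * g z) l (fun n => X (p n))); [|exact Hl].
    apply ccont_lin; [apply Hpc|]. apply (jet_on_cont _ _ _ _ l Hg), HK, Hlb.
  - assert (Hpsi : forall t, 0 <= t -> t < 3 * r -> exp (- al * (3 * r) ^ 2) < exp (- al * t ^ 2)).
    { intros t Ht1 Ht2. apply exp_increasing. assert (t ^ 2 < (3 * r) ^ 2) by nra. nra. }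
    (* If [u a <= v a], then [psi - g] has a positive maximum. It is not on the outer circle, where
       [psi = 0 <= g], nor within [rho] of [b], where [psi <= m < g]; in the annulus between, the
       Laplacians contradict it. *)
    assert (Hpos : 0 < 1 * psi z + -1 * g z).
    { apply Rlt_le_trans with (2 := Hmax a ltac:(lra)).
      assert (0 < psi a).
      { unfold psi. specialize (Hpsi (Cmod (a - b)%C) (Cmod_ge_0 _) ltac:(lra)). nra. }
      unfold g. lra. }
    destruct (HK z Hz) as [HOz HBz].
    assert (Hgz : 0 <= g z) by (specialize (Hvu z HOz); unfold g; lra).
    assert (Hz1 : Cmod (z - b)%C < 3 * r).
    { apply Rnot_le_lt. intros K. replace (psi z) with 0 in Hpos; [lra|].
      unfold psi. replace (Cmod (z - b)%C) with (3 * r) by lra. ring. }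
    assert (Hz2 : rho <= Cmod (z - b)%C).
    { apply Rnot_lt_le. intros K. specialize (Hgb z K). apply Rabs_def2 in Hgb.
      assert (psi z <= m); [|unfold m in *; lra].
      unfold psi. assert (exp (- al * Cmod (z - b)%C ^ 2) <= 1).
      { rewrite <- exp_0. apply exp_monotone. pose proof (pow2_ge_0 (Cmod (z - b)%C)). nra. }
      pose proof (exp_pos (- al * (3 * r) ^ 2)). nra. }
    pose proof (cjet_plus _ _ _ _ _ _ (cjet_affine _ _ _ 0 1
        (gauss_jet z b al m (- (m * exp (- al * (3 * r) ^ 2)))))
      (cjet_affine _ _ _ 0 (-1) (proj1 (Hg z HOz)))) as J.
    apply (cjet_local_max _ _ _ (3 * r - Cmod (z - b)%C)) in J; [|lra|].
    + set (E := exp (- al * Cmod (z - b)%C ^ 2)) in *.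
      assert (HE : 0 < E) by apply exp_pos.
      assert (HmE : 0 < m * E) by (apply Rmult_lt_0_compat; assumption).
      assert (Hfac : B <= 4 * al ^ 2 * Cmod (z - b)%C ^ 2 - 4 * al).
      { assert (rho ^ 2 <= Cmod (z - b)%C ^ 2) by (apply pow_incr; lra).
        assert (al * 2 <= al * (al * Cmod (z - b)%C ^ 2)) by (apply Rmult_le_compat_l; nra).
        unfold al at 1 in Hal. assert (B <= 4 * al) by (unfold al; lra). lra. }
      assert (Hpz : psi z < m * E).
      { unfold psi. fold E. pose proof (exp_pos (- al * (3 * r) ^ 2)). nra. }
      assert (HL1 : B * psi z < m * E * (4 * al ^ 2 * Cmod (z - b)%C ^ 2 - 4 * al)).
      { apply Rlt_le_trans with (B * (m * E)); [apply Rmult_lt_compat_l; assumption|].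
        rewrite Rmult_comm. apply Rmult_le_compat_l; lra. }
      specialize (HLu z HOz). specialize (HLv z HOz). pose proof (exp_diff_le (u z) (v z)) as Hd.
      assert (2 * exp (2 * u z) * (u z - v z) <= B * g z).
      { replace (g z) with (u z - v z) by (unfold g; ring). apply Rmult_le_compat_r; [|exact HBz].
        specialize (Hvu z HOz). lra. }
      assert (B * g z < B * psi z) by (apply Rmult_lt_compat_l; lra). lra.
    + intros s Hs. cbv beta. rewrite !Cplus_0_r, !Rplus_0_l.
      apply (Hmax (z + s)%C). replace (z + s - b)%C with ((z - b) + s)%C by ring.
      eapply Rle_trans; [apply Cmod_triangle|]. lra.
Qed.

(** The radius depends on [p] alone and [a], [b] are interchangeable, so the contact set is open and
    relatively closed at once, in the form that [path_induction] uses. A fifth of the available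
    radius suffices: the disc of radius [3 r] about [b] stays within [4 r] of [p]. *)
Lemma contact_locally_constant p : O p -> exists r, 0 < r /\ forall a b,
  Cmod (a - p)%C < r -> Cmod (b - p)%C < r -> u a = v a -> u b = v b.
Proof.
  intros Hp. destruct (open_ball O p Oopen Hp) as [r1 [Hr1 HB]].
  destruct (ccont_exp _ p (ccont_scal 2 u p (jet_on_cont _ _ _ _ p Hu Hp)) 1 Rlt_0_1)
    as [r2 [Hr2 Hexp]].
  set (r := Rmin r1 r2 / 5).
  assert (Hr : 0 < r /\ 5 * r <= r1 /\ 5 * r <= r2) by (unfold r, Rmin; destruct Rle_dec; lra).
  exists r. split; [lra|]. intros a b Ha Hb Heq.
  destruct (Rle_lt_dec (u b) (v b)) as [K|K].
  - apply Rle_antisym; [exact K|]. apply Hvu, HB. lra.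
  - exfalso. pose proof (exp_pos (2 * u p)) as He.
    assert (H : v a < u a); [|lra].
    apply (barrier_positive a b r (2 * (exp (2 * u p) + 1))); [lra|lra| | |exact K].
    + intros z Hz. assert (Hzp : Cmod (z - p)%C < 5 * r).
      { pose proof (Cmod_dist_triangle z b p). lra. }
      split; [apply HB; lra|]. specialize (Hexp z ltac:(lra)). apply Rabs_def2 in Hexp. lra.
    + pose proof (Cmod_dist_triangle a p b) as Ht. rewrite (Cmod_sym p b) in Ht. lra.
Qed.

End StrongMax.

(** At [T = 0] the assumption below [T] is vacuous, so the one premise covers the start, the passage
    to a limit from the left and the continuation to the right. *)
Lemma real_induction (P : R -> Prop) :
  (forall T, 0 <= T <= 1 -> (forall t, 0 <= t < T -> P t) ->
     exists d, 0 < d /\ forall t, T <= t < T + d -> P t) ->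
  forall t, 0 <= t <= 1 -> P t.
Proof.
  intros H. set (E := fun t => 0 <= t <= 1 /\ forall s, 0 <= s < t -> P s).
  assert (E0 : E 0) by (split; [lra|]; intros s Hs; lra).
  destruct (completeness E) as [T [HT1 HT2]].
  { exists 1. intros t [Ht _]. lra. }
  { exists 0. exact E0. }
  assert (HT : 0 <= T <= 1).
  { split; [apply HT1, E0|]. apply HT2. intros t [Ht _]. lra. }
  destruct (H T HT) as [d [Hd Hext]].
  { intros t Ht. apply NNPP. intros K. assert (T <= t); [|lra].
    apply HT2. intros s [_ Hs]. apply Rnot_lt_le. intros K'. apply K, Hs. lra. }
  assert (Hall : forall s, 0 <= s < T + d -> P s).
  { intros s Hs. destruct (Rlt_le_dec s T) as [K|K]; [|apply Hext; lra].
    apply NNPP. intros K2. assert (T <= s); [|lra].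
    apply HT2. intros s' [_ Hs']. apply Rnot_lt_le. intros K'. apply K2, Hs'. lra. }
  intros t Ht. destruct (Rlt_le_dec t (T + d)) as [K|K]; [apply Hall; lra|].
  assert (T + d <= T); [|lra]. apply HT1. split; [lra|exact Hall].
Qed.

Lemma path_induction (U P : C -> Prop) (g1 g2 : R -> R) :
  continuity g1 -> continuity g2 -> (forall t, 0 <= t <= 1 -> U (g1 t, g2 t)) ->
  (forall p, U p -> exists r, 0 < r /\ forall a b,
     Cmod (a - p)%C < r -> Cmod (b - p)%C < r -> P a -> P b) ->
  P (g1 0, g2 0) -> P (g1 1, g2 1).
Proof.
  intros C1 C2 HU Hloc H0. apply (real_induction (fun t => P (g1 t, g2 t))); [|lra].
  intros T HT Hbelow. destruct (Hloc _ (HU T HT)) as [r [Hr Hab]].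
  destruct (curve_near g1 g2 T r (C1 T) (C2 T) Hr) as [d [Hd Hnear]].
  exists d. split; [exact Hd|]. intros t Ht.
  assert (Hs : exists s, Rabs (s - T) < d /\ P (g1 s, g2 s)).
  { destruct (Req_dec T 0) as [->|K].
    - exists 0. rewrite Rminus_diag, Rabs_R0. split; assumption.
    - exists (Rmax 0 (T - d / 2)). pose proof (Rmax_l 0 (T - d / 2)). pose proof (Rmax_r 0 (T - d / 2)).
      assert (Rmax 0 (T - d / 2) < T) by (apply Rmax_lub_lt; lra).
      split; [apply Rabs_def1; lra|]. apply Hbelow. lra. }
  destruct Hs as [s [Hs1 Hs2]].
  apply (Hab (g1 s, g2 s)); [apply Hnear, Hs1|apply Hnear, Rabs_def1; lra|exact Hs2].
Qed.

Lemma component_refl U z : U z -> component U z z.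
Proof.
  intros Hz. split; [exact Hz|]. split; [exact Hz|].
  exists (fun _ => fst z), (fun _ => snd z).
  assert (Hc : forall c : R, continuity (fun _ => c)) by (intros c; reg).
  repeat (split; [apply Hc || reflexivity|]). intros t _. destruct z. exact Hz.
Qed.

Lemma component_mono U U' z : subset U U' -> subset (component U z) (component U' z).
Proof.
  intros H w [H1 [H2 [g1 [g2 [C1 [C2 [E1 [E2 [E3 [E4 HU]]]]]]]]]].
  split; [apply H, H1|]. split; [apply H, H2|]. exists g1, g2.
  repeat (split; [assumption|]). intros t Ht. apply H, HU, Ht.
Qed.

Lemma component_seg U z a b : component U z a -> (forall t, 0 <= t <= 1 -> U (seg a b t)) ->
  component U z b.
Proof.
  intros [H1 [H2 [g1 [g2 [C1 [C2 [E1 [E2 [E3 [E4 HU]]]]]]]]]] Hs.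
  split; [exact H1|]. split.
  { rewrite <- (seg_1 a b). apply Hs. lra. }
  (* Two clocks: [lo] runs from 0 to 1 on the first half and then rests, [hi] waits and then runs.
     They concatenate path and segment by a formula that is visibly continuous. *)
  pose (lo := fun t => 1 - ramp (1 - 2 * t)). pose (hi := fun t => ramp (2 * t - 1)).
  assert (Cj : forall g c, continuity g -> continuity (fun t => g (lo t) + c * hi t)).
  { intros g c Cg. apply (continuity_plus (fun t => g (lo t)) (fun t => c * hi t)).
    - apply (continuity_comp lo g); [unfold lo, ramp; reg|exact Cg].
    - unfold hi, ramp. reg. }
  assert (L : forall t, t <= 1 / 2 -> lo t = 2 * t /\ hi t = 0).
  { intros t Ht. unfold lo, hi. rewrite ramp_right, ramp_left by lra. lra. }
  assert (Rr : forall t, 1 / 2 <= t -> lo t = 1 /\ hi t = 2 * t - 1).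
  { intros t Ht. unfold lo, hi. rewrite ramp_left, ramp_right by lra. lra. }
  exists (fun t => g1 (lo t) + (fst b - fst a) * hi t), (fun t => g2 (lo t) + (snd b - snd a) * hi t).
  split; [apply Cj, C1|]. split; [apply Cj, C2|].
  destruct (L 0 ltac:(lra)) as [-> ->]. destruct (Rr 1 ltac:(lra)) as [-> ->].
  replace (2 * 0) with 0 by ring. rewrite E1, E2, E3, E4.
  split; [ring|]. split; [ring|]. split; [ring|]. split; [ring|].
  intros t Ht. destruct (Rle_lt_dec t (1 / 2)) as [K|K].
  - destruct (L t K) as [-> ->]. rewrite !Rmult_0_r, !Rplus_0_r. apply HU. lra.
  - destruct (Rr t ltac:(lra)) as [-> ->]. rewrite E3, E4.
    replace (_, _) with (seg a b (2 * t - 1)).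
    + apply Hs. lra.
    + unfold seg, Cplus, Cminus, Cmult, Copp, Cplus, RtoC. simpl. f_equal; ring.
Qed.

Lemma component_induction (U P : C -> Prop) (z w : C) :
  (forall p, U p -> exists r, 0 < r /\ forall a b,
     Cmod (a - p)%C < r -> Cmod (b - p)%C < r -> P a -> P b) ->
  P z -> component U z w -> P w.
Proof.
  intros Hloc Hz [H1 [H2 [g1 [g2 [C1 [C2 [E1 [E2 [E3 [E4 HU]]]]]]]]]].
  destruct z as [z1 z2], w as [w1 w2]. simpl in *. rewrite <- E3, <- E4.
  apply (path_induction U P g1 g2 C1 C2 HU Hloc). rewrite E1, E2. exact Hz.
Qed.

(** A disc of [O2] that meets the component lies in it, hence in [O1]; carrying both memberships
    along the path therefore keeps it in the intersection. *)
Lemma component_inter O1 O2 z w : is_open O1 -> is_open O2 ->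
  O1 z -> O2 z -> subset (component O2 z) O1 -> component O2 z w -> component (inter O1 O2) z w.
Proof.
  intros HO1 HO2 H1 H2 Hs Hw.
  assert (HP : component O2 z w /\ component (inter O1 O2) z w); [|apply HP].
  apply (component_induction O2 (fun p => component O2 z p /\ component (inter O1 O2) z p) z w); [| |exact Hw].
  - intros p Hp. destruct (open_ball O2 p HO2 Hp) as [r [Hr HB]]. exists r. split; [exact Hr|].
    intros a b Ha Hb [Ca Ia].
    assert (Hseg : forall t, 0 <= t <= 1 -> component O2 z (seg a b t)).
    { intros t Ht. apply (component_seg O2 z a _ Ca). intros s Hs'. apply HB.
      apply Cmod_seg_le; [exact Hs'|exact Ha|]. apply Cmod_seg_le; assumption. }
    split.
    + rewrite <- (seg_1 a b). apply Hseg. lra.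
    + apply (component_seg _ z a b Ia). intros t Ht. split.
      * apply Hs, Hseg, Ht.
      * apply (Hseg t Ht).
  - split; apply component_refl; [exact H2|split; assumption].
Qed.

(* A segment leaving [O] inside a region where the density stays bounded would be a
   [rho]-Cauchy path without limit in [O]. *)
Lemma segment_stays (O : C -> Prop) (rho : C -> R) (a b : C) (m : R) :
  is_open O -> chain_complete O rho -> O a -> 0 < m ->
  (forall T, 0 <= T <= 1 -> (forall t, 0 <= t <= T -> O (seg a b t)) -> rho (seg a b T) <= m) ->
  forall t, 0 <= t <= 1 -> O (seg a b t).
Proof.
  intros HO Hcomp Ha Hm Hrho. apply (real_induction (fun t => O (seg a b t))). intros T HT Hlt.
  assert (K : O (seg a b T)); [apply NNPP; intros HTn|]; cycle 1.
  { destruct (open_ball O _ HO K) as [r [Hr HB]].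
    set (D := Cmod (b - a)%C). assert (HD : 0 <= D) by apply Cmod_ge_0.
    set (d := r / (D + 1)). assert (Hd : 0 < d) by (apply Rdiv_lt_0_compat; lra).
    assert (HdD : d * (D + 1) = r) by (unfold d; field; lra).
    exists d. split; [exact Hd|]. intros s Hs. apply HB.
    replace (seg a b s - seg a b T)%C with (RtoC (s - T) * (b - a))%C
      by (unfold seg; rewrite RtoC_minus; ring).
    rewrite Cmod_Rmult, Rabs_right by lra. fold D. nra. }
  assert (HT0 : 0 < T).
  { destruct (Req_dec T 0) as [K|K]; [|lra]. exfalso. apply HTn. rewrite K, seg_0. exact Ha. }
  (* Points approaching [T] dyadically from below. Consecutive ones are joined inside [O] with
     density at most [m], at a cost below a multiple of [(/ 2) ^ n]; the [+ 1] in the factor makes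
     the inequality strict. *)
  set (x := fun n => seg a b (T * (1 - (/ 2) ^ n))).
  assert (Hpw : forall n, 0 < (/ 2) ^ n <= 1).
  { intros n. split; [apply pow_lt; lra|]. rewrite <- (pow1 n). apply pow_incr. lra. }
  destruct (Hcomp x (m * Cmod (b - a)%C + 1)) as [p [Hp Hcv]].
  - intros n. pose proof (Hpw n) as H1. pose proof (Hpw (S n)) as H2.
    pose proof (Cmod_ge_0 (b - a)%C) as HD.
    apply (chain_seg O rho _ _ m).
    + intros t Ht.
      set (q := (/ 2) ^ n) in *. assert (Eq : (/ 2) ^ S n = q / 2) by (unfold q; simpl; field).
      assert (Es : seg (x n) (x (S n)) t = seg a b (T * (1 - q) + t * (T * (q / 2)))).
      { unfold x. rewrite Eq. fold q. unfold seg.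
        repeat rewrite ?RtoC_plus, ?RtoC_mult, ?RtoC_minus. unfold Rdiv.
        repeat rewrite ?RtoC_plus, ?RtoC_mult, ?RtoC_minus, ?RtoC_inv by lra. field. }
      assert (Hb : 0 <= T * (1 - q) + t * (T * (q / 2)) < T).
      { assert (0 < T * q) by (apply Rmult_lt_0_compat; lra).
        assert (0 <= t * (T * q)) by (apply Rmult_le_pos; lra).
        assert (t * (T * q) <= 1 * (T * q)) by (apply Rmult_le_compat_r; lra).
        assert (0 <= T * (1 - q)) by (apply Rmult_le_pos; lra). lra. }
      rewrite Es. split; [apply Hlt; lra|]. apply Hrho; [lra|]. intros s Hs. apply Hlt; lra.
    + replace (x (S n) - x n)%C with (RtoC (T * ((/ 2) ^ n - (/ 2) ^ S n)) * (b - a))%C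
        by (unfold x, seg; rewrite !RtoC_mult, !RtoC_minus; ring).
      rewrite Cmod_Rmult. simpl pow. set (q := (/ 2) ^ n) in *.
      rewrite Rabs_right by nra.
      assert (HmD : 0 <= m * Cmod (b - a)%C) by (apply Rmult_le_pos; lra).
      assert (T * (q - / 2 * q) <= q) by nra.
      replace (m * (T * (q - / 2 * q) * Cmod (b - a)%C)) with
        (m * Cmod (b - a)%C * (T * (q - / 2 * q))) by ring.
      apply Rle_lt_trans with (m * Cmod (b - a)%C * q); [apply Rmult_le_compat_l; assumption|]. nra.
    + assert (HmD : 0 <= m * Cmod (b - a)%C) by (apply Rmult_le_pos; lra).
      apply Rmult_lt_0_compat; lra.
  - apply HTn. replace (seg a b T) with p; [exact Hp|].
    apply (ccv_unique x); [exact Hcv|]. intros eps He.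
    pose proof (Cmod_ge_0 (b - a)%C) as HD.
    destruct (pow_lt_1_zero (/ 2) ltac:(rewrite Rabs_right; lra) (eps / (Cmod (b - a)%C + 1))) as [N HN].
    { apply Rdiv_lt_0_compat; lra. }
    exists N. intros n Hn'. specialize (HN n Hn'). pose proof (Hpw n) as H1.
    rewrite Rabs_right in HN by lra.
    replace (x n - seg a b T)%C with (RtoC (- (T * (/ 2) ^ n)) * (b - a))%C
      by (unfold x, seg; rewrite RtoC_opp, !RtoC_mult, RtoC_minus; ring).
    rewrite Cmod_Rmult, Rabs_Ropp. set (q := (/ 2) ^ n) in *. rewrite Rabs_right by nra.
    apply Rle_lt_trans with (q * (Cmod (b - a)%C + 1)).
    + assert (T * q <= q) by nra. assert (0 <= T * q) by nra.
      apply Rmult_le_compat; lra.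
    + replace eps with (eps / (Cmod (b - a)%C + 1) * (Cmod (b - a)%C + 1)) by (field; lra).
      apply Rmult_lt_compat_r; lra.
Qed.

(** The component of [O] is relatively closed in that of [U]: on it [rho] equals [rhoU], which is
    bounded near each point of [U], so completeness of [rho] stops short segments of [U] from
    leaving [O]. *)
Lemma component_absorbs (O U : C -> Prop) (rho rhoU : C -> R) z :
  is_open O -> is_open U -> subset O U -> O z -> chain_complete O rho ->
  (forall p, U p -> ccont rhoU p) ->
  (forall p, component O z p -> rho p = rhoU p) ->
  subset (component U z) (component O z).
Proof.
  intros HO HU Hsub Hz Hcomp Hc Heq w Hw.
  apply (component_induction U (component O z) z w); [|apply component_refl, Hz|exact Hw].
  intros p Hp. destruct (open_ball U p HU Hp) as [r1 [Hr1 HB]].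
  destruct (Hc p Hp 1 Rlt_0_1) as [r2 [Hr2 Hcp]].
  exists (Rmin r1 r2). split; [apply Rmin_pos; assumption|]. intros a b Ha Hb Hca.
  apply (component_seg O z a b Hca).
  apply (segment_stays O rho a b (Rabs (rhoU p) + 1) HO Hcomp).
  - apply Hca.
  - pose proof (Rabs_pos (rhoU p)). lra.
  - intros T HT Hs. rewrite Heq.
    + assert (Hd : Cmod (seg a b T - p)%C < r2).
      { apply Rlt_le_trans with (Rmin r1 r2); [apply Cmod_seg_le; assumption|apply Rmin_r]. }
      specialize (Hcp _ Hd). apply Rabs_def2 in Hcp. pose proof (Rle_abs (rhoU p)). lra.
    + apply (component_seg O z a _ Hca). intros t Ht.
      replace (seg a (seg a b T) t) with (seg a b (t * T)).
      * apply Hs. nra.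
      * unfold seg. rewrite RtoC_mult. ring.
Qed.

(** * Monotonicity, contact and the product of hyperbolic densities *)

Lemma hyperbolic_chain_complete O lam : is_open O -> hyperbolic_metric O lam ->
  chain_complete O (fun z => exp (loglam lam z)).
Proof.
  intros HO Hh x K Hx.
  apply (complete_metric_chain O lam) with (K := K).
  - apply Hh.
  - intros z Hz. apply (hyperbolic_cont O lam z Hh Hz).
  - exact HO.
  - apply Hh.
  - intros n. apply (chain_mono O O (fun z => exp (loglam lam z))); [intros z Hz; exact Hz| |apply Hx].
    intros z Hz. rewrite (exp_loglam O lam z Hh Hz). lra.
Qed.

Lemma hyperbolic_monotone O U lam lamU : is_open O -> is_open U -> subset O U ->
  hyperbolic_metric O lam -> hyperbolic_metric U lamU ->
  forall z, O z -> loglam lamU z <= loglam lam z.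
Proof.
  intros HO HU Hsub H1 H2.
  destruct (hyperbolic_jet_on O lam HO H1) as [g1 J1].
  destruct (hyperbolic_jet_on U lamU HU H2) as [g2 J2].
  apply (ahlfors_yau O _ _ g1 g2 _ _ HO J1 (jet_on_subset _ _ _ _ _ Hsub J2)).
  - intros z _. lra.
  - intros z _. lra.
  - apply hyperbolic_chain_complete; assumption.
Qed.

(** [O'] stands for the other of the two sets: its component at [z] lies in that of [U], which
    contact at [z] makes part of the component of [O]. *)
Lemma hyperbolic_contact O O' U lam lamU z : is_open O -> is_open U -> subset O U -> subset O' U ->
  hyperbolic_metric O lam -> hyperbolic_metric U lamU -> O z ->
  loglam lam z = loglam lamU z -> subset (component O' z) (component O z).
Proof.
  intros HO HU Hsub Hsub' H1 H2 Hz Heq w Hw. apply (component_mono O' U) in Hw; [|exact Hsub'].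
  revert w Hw.
  destruct (hyperbolic_jet_on O lam HO H1) as [g1 J1].
  destruct (hyperbolic_jet_on U lamU HU H2) as [g2 J2].
  apply (component_absorbs O U (fun z => exp (loglam lam z)) (fun z => exp (loglam lamU z)));
    try assumption.
  - apply hyperbolic_chain_complete; assumption.
  - intros p Hp. apply ccont_exp, (jet_on_cont _ _ _ _ p J2 Hp).
  - intros p Hp. f_equal.
    apply (component_induction O (fun p => loglam lam p = loglam lamU p) z p); [|exact Heq|exact Hp].
    apply (contact_locally_constant O _ _ g1 g2 _ _ HO J1 (jet_on_subset _ _ _ _ _ Hsub J2)).
    + intros q _. lra.
    + intros q _. lra.
    + apply (hyperbolic_monotone O U); assumption.
Qed.

Section Solynin.
Variables (O1 O2 : C -> Prop) (l1 l2 lU lI : R -> R -> R).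
Hypothesis Oopen1 : is_open O1.
Hypothesis Oopen2 : is_open O2.
Hypothesis H1 : hyperbolic_metric O1 l1.
Hypothesis H2 : hyperbolic_metric O2 l2.
Hypothesis HU : hyperbolic_metric (union O1 O2) lU.
Hypothesis HI : hyperbolic_metric (inter O1 O2) lI.

Lemma open_union : is_open (union O1 O2).
Proof.
  intros z [Hz|Hz].
  - destruct (Oopen1 z Hz) as [r [Hr H]]. exists r. split; [exact Hr|]. intros w Hw. left. apply H, Hw.
  - destruct (Oopen2 z Hz) as [r [Hr H]]. exists r. split; [exact Hr|]. intros w Hw. right. apply H, Hw.
Qed.

Lemma open_inter : is_open (inter O1 O2).
Proof.
  intros z [Hz1 Hz2]. destruct (Oopen1 z Hz1) as [r1 [Hr1 K1]]. destruct (Oopen2 z Hz2) as [r2 [Hr2 K2]].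
  exists (Rmin r1 r2). split; [apply Rmin_pos; assumption|]. intros w Hw.
  pose proof (Rmin_l r1 r2). pose proof (Rmin_r r1 r2). split; [apply K1|apply K2]; lra.
Qed.

(** The logarithm of [l1 l2 / lU]; the explicit coefficients let two uses of [jet_on_lin] produce
    its jet verbatim. *)
Definition logmu (z : C) : R := 1 * loglam l1 z + 1 * (1 * loglam l2 z + -1 * loglam lU z).
Definition lapmu (z : C) : R := 1 * exp (2 * loglam l1 z) +
  1 * (1 * exp (2 * loglam l2 z) + -1 * exp (2 * loglam lU z)).

Lemma logmu_ge z : inter O1 O2 z ->
  loglam lU z <= loglam l1 z /\ loglam lU z <= loglam l2 z.
Proof.
  intros [Hz1 Hz2]. split.
  - apply (hyperbolic_monotone O1 (union O1 O2) l1 lU Oopen1 open_union); try assumption.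
    intros w Hw. left. exact Hw.
  - apply (hyperbolic_monotone O2 (union O1 O2) l2 lU Oopen2 open_union); try assumption.
    intros w Hw. right. exact Hw.
Qed.

Lemma logmu_jet : exists g, jet_on (inter O1 O2) logmu g lapmu.
Proof.
  destruct (hyperbolic_jet_on O1 l1 Oopen1 H1) as [g1 J1].
  destruct (hyperbolic_jet_on O2 l2 Oopen2 H2) as [g2 J2].
  destruct (hyperbolic_jet_on _ lU open_union HU) as [gU JU].
  eexists. apply jet_on_lin; [|apply jet_on_lin].
  - apply (jet_on_subset O1 _ _ _ _ (fun z Hz => proj1 Hz) J1).
  - apply (jet_on_subset O2 _ _ _ _ (fun z Hz => proj2 Hz) J2).
  - apply (jet_on_subset (union O1 O2) _ _ _ _ (fun z Hz => or_introl (proj1 Hz)) JU).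
Qed.

(* [(l1^2 - lU^2) (l2^2 - lU^2) >= 0] says exactly that [l1 l2 / lU] has curvature at
   least [-1]. *)
Lemma lapmu_identity z : exp (2 * loglam lU z) * (exp (2 * logmu z) - lapmu z) =
  (exp (2 * loglam l1 z) - exp (2 * loglam lU z)) * (exp (2 * loglam l2 z) - exp (2 * loglam lU z)).
Proof.
  assert (E : exp (2 * loglam lU z) * exp (2 * logmu z) = exp (2 * loglam l1 z) * exp (2 * loglam l2 z)).
  { rewrite <- !exp_plus. f_equal. unfold logmu. ring. }
  rewrite Rmult_minus_distr_l, E. unfold lapmu. ring.
Qed.

Lemma lapmu_le z : inter O1 O2 z -> lapmu z <= exp (2 * logmu z).
Proof.
  intros Hz. destruct (logmu_ge z Hz) as [K1 K2].
  assert (E1 : exp (2 * loglam lU z) <= exp (2 * loglam l1 z)) by (apply exp_monotone; lra).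
  assert (E2 : exp (2 * loglam lU z) <= exp (2 * loglam l2 z)) by (apply exp_monotone; lra).
  pose proof (lapmu_identity z) as E. pose proof (exp_pos (2 * loglam lU z)). nra.
Qed.

(** As [mu] dominates [l1] and [l2], a geometric sequence for [mu] is one for both and has a limit
    in [O1] and one in [O2]. Both limits are Euclidean, so they coincide and lie in the
    intersection. *)
Lemma logmu_complete : chain_complete (inter O1 O2) (fun z => exp (logmu z)).
Proof.
  intros x K Hx.
  assert (Hc : forall O lam, is_open O -> hyperbolic_metric O lam -> subset (inter O1 O2) O ->
    (forall z, inter O1 O2 z -> loglam lam z <= logmu z) -> exists p, O p /\ ccv x p).
  { intros O lam HO Hh Hs Hle. apply (hyperbolic_chain_complete O lam HO Hh x K). intros n.
    apply (chain_mono (inter O1 O2) O (fun z => exp (logmu z))); [exact Hs| |apply Hx].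
    intros z Hz. apply exp_monotone, Hle, Hz. }
  destruct (Hc O1 l1 Oopen1 H1) as [p1 [Hp1 C1]]; [intros z Hz; apply Hz| |].
  { intros z Hz. destruct (logmu_ge z Hz). unfold logmu. lra. }
  destruct (Hc O2 l2 Oopen2 H2) as [p2 [Hp2 C2]]; [intros z Hz; apply Hz| |].
  { intros z Hz. destruct (logmu_ge z Hz). unfold logmu. lra. }
  rewrite <- (ccv_unique _ _ _ C1 C2) in Hp2. exists p1. split; [split; assumption|exact C1].
Qed.

Lemma loglam_inter_le z : inter O1 O2 z -> loglam lI z <= logmu z.
Proof.
  destruct logmu_jet as [g J]. destruct (hyperbolic_jet_on _ lI open_inter HI) as [gI JI].
  apply (ahlfors_yau (inter O1 O2) _ _ g gI _ _ open_inter J JI lapmu_le).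
  - intros w _. lra.
  - exact logmu_complete.
Qed.

Lemma product_exp z : inter O1 O2 z ->
  lamv l1 z * lamv l2 z = lamv lU z * exp (logmu z) /\ lamv lI z = exp (loglam lI z) /\ 0 < lamv lU z.
Proof.
  intros [Hz1 Hz2].
  rewrite <- (exp_loglam O1 l1 z H1 Hz1), <- (exp_loglam O2 l2 z H2 Hz2).
  rewrite <- (exp_loglam _ lU z HU (or_introl Hz1)), <- (exp_loglam _ lI z HI (conj Hz1 Hz2)).
  rewrite <- !exp_plus. split; [f_equal; unfold logmu; ring|]. split; [|apply exp_pos].
  reflexivity.
Qed.

Lemma product_eq_iff z : inter O1 O2 z ->
  (lamv l1 z * lamv l2 z = lamv lU z * lamv lI z <-> logmu z = loglam lI z).
Proof.
  intros Hz. destruct (product_exp z Hz) as [-> [-> Hp]]. split.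
  - intros E. apply exp_inv. apply Rmult_eq_reg_l in E; [exact E|lra].
  - intros ->. reflexivity.
Qed.

Lemma inter_contact p : inter O1 O2 p -> exists r, 0 < r /\ forall a b,
  Cmod (a - p)%C < r -> Cmod (b - p)%C < r -> logmu a = loglam lI a -> logmu b = loglam lI b.
Proof.
  destruct logmu_jet as [g J]. destruct (hyperbolic_jet_on _ lI open_inter HI) as [gI JI].
  apply (contact_locally_constant (inter O1 O2) _ _ g gI _ _ open_inter J JI lapmu_le).
  - intros w _. lra.
  - exact loglam_inter_le.
Qed.

(** On a disc of contact [loglam lI - logmu] vanishes, so its Laplacian at [z] is at most 0. With
    [lapmu_le] this gives [mu] curvature exactly -1 at [z], and one factor of the product in
    [lapmu_identity] must be 0. *)
Lemma contact_cases z : inter O1 O2 z -> logmu z = loglam lI z ->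
  loglam l1 z = loglam lU z \/ loglam l2 z = loglam lU z.
Proof.
  intros Hz Heq.
  destruct logmu_jet as [g J]. destruct (hyperbolic_jet_on _ lI open_inter HI) as [gI JI].
  destruct (inter_contact z Hz) as [r [Hr Hloc]].
  assert (Hz0 : Cmod (z - z)%C < r).
  { rewrite Cmod_diag. exact Hr. }
  assert (Hs : forall s, Cmod s < r -> logmu (z + s)%C = loglam lI (z + s)%C).
  { intros s Hs. apply (Hloc z (z + s)%C Hz0); [|exact Heq].
    replace (z + s - z)%C with s by ring. exact Hs. }
  pose proof (cjet_plus _ _ _ _ _ _ (proj1 (JI z Hz)) (cjet_affine _ _ _ 0 (-1) (proj1 (J z Hz)))) as Jd.
  apply (cjet_local_max _ _ _ r) in Jd; [|exact Hr|].
  2: { intros s Hs'. cbv beta. rewrite (Hs s Hs'), (Hs 0%C) by (rewrite Cmod_0; exact Hr). lra. }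
  rewrite <- Heq in Jd.
  pose proof (lapmu_identity z) as E. pose proof (lapmu_le z Hz) as Hle.
  assert (E0 : exp (2 * logmu z) - lapmu z = 0) by lra. rewrite E0, Rmult_0_r in E.
  symmetry in E. apply Rmult_integral in E. destruct E as [E|E]; [left|right].
  - assert (2 * loglam l1 z = 2 * loglam lU z); [|lra]. apply exp_inv. lra.
  - assert (2 * loglam l2 z = 2 * loglam lU z); [|lra]. apply exp_inv. lra.
Qed.

End Solynin.

Theorem theorem2 (O1 O2 : Cpt -> Prop) (l1 l2 lU lI : R -> R -> R) :
  is_open O1 -> is_open O2 ->
  (exists z, inter O1 O2 z) ->
  hyperbolic (union O1 O2) ->
  hyperbolic_metric O1 l1 ->
  hyperbolic_metric O2 l2 ->
  hyperbolic_metric (union O1 O2) lU ->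
  hyperbolic_metric (inter O1 O2) lI ->
  (forall z, inter O1 O2 z -> lamv l1 z * lamv l2 z >= lamv lU z * lamv lI z) /\
  (forall z, inter O1 O2 z -> lamv l1 z * lamv l2 z = lamv lU z * lamv lI z ->
     (subset (component O1 z) (component O2 z) \/
      subset (component O2 z) (component O1 z)) /\
     (forall w, inter (component O1 z) (component O2 z) w ->
        lamv l1 w * lamv l2 w = lamv lU w * lamv lI w)).
Proof.
  intros Oo1 Oo2 _ _ H1 H2 HU HI. split.
  - intros z Hz. destruct (product_exp O1 O2 l1 l2 lU lI H1 H2 HU HI z Hz) as [-> [-> Hp]].
    apply Rle_ge, Rmult_le_compat_l; [lra|]. apply exp_monotone.
    apply (loglam_inter_le O1 O2); assumption.
  - intros z Hz Heq. pose proof Hz as [Hz1 Hz2].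
    apply (product_eq_iff O1 O2 l1 l2 lU lI H1 H2 HU HI z Hz) in Heq.
    (* Contact of [logmu] with [loglam lI] propagates over the component of the intersection; it
       remains to see that this component exhausts [O1(z)] intersected with [O2(z)]. *)
    assert (Heqw : forall w, component (inter O1 O2) z w ->
      lamv l1 w * lamv l2 w = lamv lU w * lamv lI w).
    { intros w Hw. apply (product_eq_iff O1 O2 l1 l2 lU lI H1 H2 HU HI w); [apply Hw|].
      apply (component_induction (inter O1 O2) (fun p => logmu l1 l2 lU p = loglam lI p) z w);
        [|exact Heq|exact Hw].
      intros p Hp. apply (inter_contact O1 O2); assumption. }
    pose proof (open_union O1 O2 Oo1 Oo2) as OoU.
    destruct (contact_cases O1 O2 l1 l2 lU lI Oo1 Oo2 H1 H2 HU HI z Hz Heq) as [E|E].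
    + assert (Hs : subset (component O2 z) (component O1 z)).
      { apply (hyperbolic_contact O1 O2 (union O1 O2) l1 lU); try assumption; intros p Hp;
          [left|right]; exact Hp. }
      (* The component of [O2] at [z] now lies in [O1], so paths in it are paths in the
         intersection. *)
      split; [right; exact Hs|]. intros w [_ Hw]. apply Heqw.
      apply component_inter; try assumption. intros p Hp. apply (Hs p Hp).
    + assert (Hs : subset (component O1 z) (component O2 z)).
      { apply (hyperbolic_contact O2 O1 (union O1 O2) l2 lU); try assumption; intros p Hp;
          [right|left]; exact Hp. }
      split; [left; exact Hs|]. intros w [Hw _]. apply Heqw.
      apply (component_mono (inter O2 O1)); [intros p [P1 P2]; split; assumption|].
      apply component_inter; try assumption. intros p Hp. apply (Hs p Hp).
Qed.
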